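(* There exists a rigid arrangement $\mathcal{H}_{57}$ of $57$ lines in the complex projective plane $\mathbb{P}^{2}_{\mathbb{C}}$ such that $$n_{2} = 252, \quad n_{3} = 108, \quad n_{4} = 72, \quad n_{8}=21,$$ and all other $n_k$ vanish. The arrangement $\mathcal{H}_{57}$ is free with exponents $(d_{1},d_{2}) = (25,31)$. Moreover, the Alexander polynomial of $\mathcal{H}_{57}$ is $$\triangle(t) = (t-1)^{56}.$$
   Context: For a line arrangement $\mathcal{L}$ and $k\ge 2$, $n_k$ denotes the number of points of $\mathbb{P}^2$ where exactly $k$ lines of $\mathcal{L}$ meet. A line arrangement is rigid if its realization space (the moduli space of line arrangements with the same intersection lattice, i.e. the same incidences between lines and intersection points, taken up to the action of $\mathrm{PGL}_3$) is zero-dimensional. Let $S=\mathbb{C}[x,y,z]$ and let $C: f=0$ be a reduced plane curve of degree $d$, with Jacobian ideal $J_f=\langle \partial_x f,\partial_y f,\partial_z f\rangle$ and Milnor algebra $M(f)=S/J_f$. The curve $C$ is free with exponents $(d_1,d_2)$, $d_1\le d_2$, if $M(f)$ has a minimal graded free resolution of the form $0\to S(1-d-d_1)\oplus S(1-d-d_2)\to S^3(1-d)\to S\to M(f)\to 0$; then $d_1+d_2=d-1$. The Alexander polynomial of $C$ is $\triangle(t)=\det(t\cdot \mathrm{Id}-h^{*}\mid H^1(F,\mathbb{C}))$, where $F=\{f=1\}\subset\mathbb{C}^3$ is the Milnor fibre and $h:F\to F$, $h(p)=e^{2\pi i/d}p$, is the monodromy. *)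

(* Defs.v *)
From HB Require Import structures.
From mathcomp Require Import all_boot all_order all_algebra.
From mathcomp Require Import complex mpoly boolp Rstruct.
From Stdlib Require Import Rdefinitions Rtrigo_def Rtrigo1.

Set Implicit Arguments.
Unset Strict Implicit.
Unset Printing Implicit Defensive.

Import Order.TTheory GRing.Theory Num.Theory.
Local Open Scope ring_scope.

Notation RR := Rdefinitions.R.
Notation CC := (complex RR).

(* A line is given by a nonzero linear form a = (a0,a1,a2) (a row vector);   *)
(* a point of P^2 by a nonzero column vector p, up to scaling;               *)

Definition on_line (a : 'rV[CC]_3) (p : 'cV[CC]_3) : bool := (a *m p) 0 0 == 0.

Definition line_arrangement (n : nat) (L : 'I_n -> 'rV[CC]_3) : Prop :=
  (forall i, L i != 0) /\
  (forall i j, i != j -> \rank (col_mx (L i) (L j)) = 2%N).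

Definition rows3 (n : nat) (L : 'I_n -> 'rV[CC]_3) (i j k : 'I_n) : 'M[CC]_3 :=
  \matrix_(r < 3, c < 3) L (nth i [:: i; j; k] r) 0 c.

(* Two (ordered) arrangements have the same intersection lattice: exactly
   the same triples of lines are concurrent (for distinct lines this
   determines all incidences between lines and intersection points). *)
Definition same_lattice (n : nat) (L L' : 'I_n -> 'rV[CC]_3) : Prop :=
  forall i j k, (\det (rows3 L i j k) == 0) = (\det (rows3 L' i j k) == 0).

(* Projective equivalence (action of PGL_3 on the lines, each linear form
   being defined up to a nonzero scalar). *)
Definition proj_equiv (n : nat) (L L' : 'I_n -> 'rV[CC]_3) : Prop :=
  exists2 g : 'M[CC]_3, g \in unitmx &
    exists2 c : 'I_n -> CC, (forall i, c i != 0) &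
      forall i, L' i = c i *: (L i *m g).

(* Rigid: the realization space (arrangements with the same intersection
   lattice, modulo PGL_3) is zero-dimensional, i.e. consists of finitely
   many points. *)
Definition rigid (n : nat) (L : 'I_n -> 'rV[CC]_3) : Prop :=
  exists m (S : 'I_m -> ('I_n -> 'rV[CC]_3)),
    forall L', line_arrangement L' -> same_lattice L L' ->
      exists j, proj_equiv (S j) L'.

(* n_k : the number of points of P^2 where exactly k lines meet (for k >= 2
   such a point is determined by the set of lines through it, so we count
   these sets of lines). *)
Definition mult_set (n : nat) (L : 'I_n -> 'rV[CC]_3) (p : 'cV[CC]_3) : {set 'I_n} :=
  [set i | on_line (L i) p].

Definition nk (n : nat) (L : 'I_n -> 'rV[CC]_3) (k : nat) : nat :=
  #|[set S : {set 'I_n} | (#|S| == k) &&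
       `[< exists p : 'cV[CC]_3, p != 0 /\ S = mult_set L p >] ]|.

Definition arr_poly (n : nat) (L : 'I_n -> 'rV[CC]_3) : {mpoly CC[3]} :=
  \prod_(i < n) \sum_(j < 3) (L i 0 j)%:MP * 'X_j.

Definition jac_syzygy (f : {mpoly CC[3]}) (a : 'I_3 -> {mpoly CC[3]}) : Prop :=
  \sum_(i < 3) a i * mderiv i f = 0.

(* C : f = 0 is free with exponents (d1, d2), d1 <= d2: the Milnor algebra has
   a (minimal graded) free resolution
     0 -> S(1-d-d1) (+) S(1-d-d2) -> S^3(1-d) -> S -> M(f) -> 0,
   i.e. the module of Jacobian syzygies is freely generated by two
   homogeneous syzygies r1, r2 of degrees d1 and d2. *)
Definition free_with_exponents (f : {mpoly CC[3]}) (d1 d2 : nat) : Prop :=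
  leq d1 d2 /\
  exists r1 r2 : 'I_3 -> {mpoly CC[3]},
    [/\ (forall i, r1 i \is [in CC[3], d1.-homog]) /\ jac_syzygy f r1,
        (forall i, r2 i \is [in CC[3], d2.-homog]) /\ jac_syzygy f r2,
        (forall a, jac_syzygy f a ->
           exists u v : {mpoly CC[3]}, forall i, a i = u * r1 i + v * r2 i) &
        (forall u v : {mpoly CC[3]}, (forall i, u * r1 i + v * r2 i = 0) ->
           u = 0 /\ v = 0)].

Definition evalp (f : {mpoly CC[3]}) (p : 'cV[CC]_3) : CC := f.@[fun j => p j 0].

Definition rcoord (p : 'cV[CC]_3) (j : 'I_3) (b : bool) : RR :=
  if b then complex.Im (p j 0) else complex.Re (p j 0).

Definition cont1 (s : RR -> 'cV[CC]_3) : Prop :=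
  forall x (e : RR), 0 < e -> exists2 dl : RR, 0 < dl &
    forall y, `|y - x| < dl -> forall j b, `|rcoord (s y) j b - rcoord (s x) j b| < e.

Definition cont2 (s : RR * RR -> 'cV[CC]_3) : Prop :=
  forall x (e : RR), 0 < e -> exists2 dl : RR, 0 < dl &
    forall y, `|y.1 - x.1| < dl -> `|y.2 - x.2| < dl ->
      forall j b, `|rcoord (s y) j b - rcoord (s x) j b| < e.

Definition clamp (t : RR) : RR := Num.min (Num.max t 0) 1.

(* Standard 2-simplex = {(s,t) | s,t >= 0, s + t <= 1} (the point
   (s,t) corresponds to (1-s-t) e0 + s e1 + t e2); retraction R^2 -> Delta^2. *)
Definition retr2 (x : RR * RR) : RR * RR :=
  let s := Num.max x.1 0 in let t := Num.max x.2 0 in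
  let m := Num.max 1 (s + t) in (s / m, t / m).

(* Singular 1-simplices in F: continuous maps Delta^1 -> F, represented by
   their (unique) extension sigma = sigma o clamp to R. *)
Definition simplex1 (f : {mpoly CC[3]}) (s : RR -> 'cV[CC]_3) : Prop :=
  [/\ cont1 s, (forall t, s t = s (clamp t)) & (forall t, evalp f (s t) = 1)].

Definition simplex2 (f : {mpoly CC[3]}) (s : RR * RR -> 'cV[CC]_3) : Prop :=
  [/\ cont2 s, (forall x, s x = s (retr2 x)) & (forall x, evalp f (s x) = 1)].

Definition face0 (s : RR * RR -> 'cV[CC]_3) : RR -> 'cV[CC]_3 :=
  fun u => s (1 - clamp u, clamp u).
Definition face1 (s : RR * RR -> 'cV[CC]_3) : RR -> 'cV[CC]_3 :=
  fun u => s (0, clamp u).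
Definition face2 (s : RR * RR -> 'cV[CC]_3) : RR -> 'cV[CC]_3 :=
  fun u => s (clamp u, 0).

(* singular 1-cochains with complex coefficients (only the values on
   genuine singular 1-simplices matter) *)
Definition cochain1 := (RR -> 'cV[CC]_3) -> CC.

Definition cocycle1 (f : {mpoly CC[3]}) (phi : cochain1) : Prop :=
  forall s, simplex2 f s -> phi (face0 s) - phi (face1 s) + phi (face2 s) = 0.

Definition cohomologous (f : {mpoly CC[3]}) (phi phi' : cochain1) : Prop :=
  exists psi : 'cV[CC]_3 -> CC,
    forall s, simplex1 f s -> phi s - phi' s = psi (s 1) - psi (s 0).

Definition zeta (d : nat) : CC :=
  Complex (cos (2 * PI / d%:R)) (sin (2 * PI / d%:R)).

Definition monodromy_pullback (d : nat) (phi : cochain1) : cochain1 :=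
  fun s => phi (fun t => zeta d *: s t).

Definition lincomb (m : nat) (a : 'I_m -> CC) (c : 'I_m -> cochain1) : cochain1 :=
  fun s => \sum_(i < m) a i * c i s.

(* The Alexander polynomial of C : f = 0 (degree d) equals P:
   P = det(t Id - h^* | H^1(F, C)), computed in a basis ([c_i]) of
   H^1(F, C) = Z^1 / B^1, where M is the matrix of h^* in that basis
   (h^*[c_i] = sum_j M i j [c_j]). *)
Definition alexander_poly_is (f : {mpoly CC[3]}) (d : nat) (P : {poly CC}) : Prop :=
  exists m (c : 'I_m -> cochain1) (M : 'M[CC]_m),
    [/\ (forall i, cocycle1 f (c i)),
        (forall phi, cocycle1 f phi -> exists a, cohomologous f phi (lincomb a c)),
        (forall a, cohomologous f (lincomb a c) (fun _ => 0) -> forall i, a i = 0),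
        (forall i, cohomologous f (monodromy_pullback d (c i))
                                  (lincomb (fun j => M i j) c)) &
        char_poly M = P].

(* Main.v *)
From Stdlib Require Import ZArith Ring_theory Ring_polynom.
From Stdlib Require Import Rdefinitions Rtrigo_def Rtrigo1 Rpower R_sqrt Ratan Ranalysis Raxioms RIneq.
From Coquelicot Require Compactness.
Require Import Defs.
From HB Require Import structures.
From mathcomp Require Import all_boot all_order all_algebra.
From mathcomp Require Import complex mpoly boolp Rstruct.
From mathcomp Require Import ring lra.

(** The arrangement is stable under the Hessian group and defined over the Eisenstein
integers, so all its incidences can be computed exactly.

Rigidity: after moving four of the lines to x, y, z, x + y + z, the incidences force
the twelve lines of the Hesse arrangement to be the standard ones for some primitive
cube root of unity, and every other line joins two intersection points of these.

Freeness: the defining polynomial is x y z g(x^3, y^3, z^3); two explicit syzygies of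
degrees 25 and 31 form with the Euler field a determinant proportional to it.  Since
linear forms are prime, Cramer's rule then expresses every syzygy in these two
(Saito's criterion).

Alexander polynomial: take the line at infinity to be z = 0, on which all
multiplicities are 2, 4 or 8, hence prime to 57.  By a Lefschetz type argument, a
cocycle on the Milnor fibre is exact as soon as it is exact over one generic line
x = x0.  Over a line far from the origin, rotations of the plane and of the clusters
of nearly parallel lines show that h^* c - c is exact for every cocycle c: each
point at infinity of multiplicity m yields a primitive compatible with h^m, hence
with h.  A cocycle may therefore be averaged over the deck group; subtracting winding
numbers around the 56 affine lines leaves an invariant cocycle without periods, which
is exact over x = x0 by sweeping half planes.  Hence the winding numbers form a basis of
the first cohomology, on which the monodromy is the identity. *)

Set Implicit Arguments.
Unset Strict Implicit.
Unset Printing Implicit Defensive.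

Import Order.TTheory GRing.Theory Num.Theory.
Local Open Scope ring_scope.
Bind Scope ring_scope with Rdefinitions.RbaseSymbolsImpl.R.
Local Arguments cos _%_ring_scope.
Local Arguments sin _%_ring_scope.
Local Arguments exp _%_ring_scope.
Local Arguments ln _%_ring_scope.
Local Arguments atan _%_ring_scope.
Local Arguments clamp _%_ring_scope.

Local Notation re := (@complex.Re RR).
Local Notation im := (@complex.Im RR).
Local Notation P3 := {mpoly CC[3]}.

Definition cR (f : RR * RR -> RR) : Prop :=
  forall x (e : RR), 0 < e -> exists2 dl : RR, 0 < dl &
    forall y, `|y.1 - x.1| < dl -> `|y.2 - x.2| < dl -> `|f y - f x| < e.

Lemma cR_cst c : cR (fun _ => c).
Proof. by move=> x e e0; exists 1 => // y _ _; rewrite subrr normr0. Qed.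

Lemma cR_fst : cR fst.
Proof. by move=> x e e0; exists e. Qed.

Lemma cR_snd : cR snd.
Proof. by move=> x e e0; exists e. Qed.

Lemma cR_comp (g : RR -> RR) f :
  cR f -> (forall x, continuity_pt g (f x)) -> cR (fun x => g (f x)).
Proof.
move=> cf cg x e e0.
have [al [al0 Hal]] := cg x e (elimT RltP e0).
have [dl dl0 Hdl] := cf x al (introT RltP al0).
exists dl => // y h1 h2; case: (eqVneq (f y) (f x)) => [->|ne].
  by rewrite subrr normr0.
have := Hal (f y); rewrite /= /Rlimit.R_met /= /Rfunctions.Rdist /D_x /no_cond => H.
have h3 : Rbasic_fun.Rabs (Rminus (f y) (f x)) = `|f y - f x| by rewrite !RealsE.
have h4 : Rbasic_fun.Rabs (Rminus (g (f y)) (g (f x))) = `|g (f y) - g (f x)| by rewrite !RealsE.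
rewrite h3 h4 in H; apply/RltP/H; split; last exact/RltP/Hdl.
by split => //; apply/eqP; rewrite eq_sym.
Qed.

Lemma cR_add f g : cR f -> cR g -> cR (fun x => f x + g x).
Proof.
move=> cf cg x e e0; have e2 : 0 < e / 2 by lra.
have [d1 d10 H1] := cf x _ e2; have [d2 d20 H2] := cg x _ e2.
exists (Num.min d1 d2); first by rewrite lt_min d10.
move=> y; rewrite !lt_min => /andP[a1 a2] /andP[b1 b2].
have := H1 y a1 b1; have := H2 y a2 b2.
by rewrite opprD addrACA; have := ler_normD (f y - f x) (g y - g x); lra.
Qed.

Lemma cR_opp f : cR f -> cR (fun x => - f x).
Proof. by move=> cf x e /(cf x)[d d0 H]; exists d => // y *; rewrite -opprD normrN; exact: H. Qed.

Lemma cR_sub f g : cR f -> cR g -> cR (fun x => f x - g x).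
Proof. by move=> cf cg; apply: cR_add => //; exact: cR_opp. Qed.

Lemma cR_sqr f : cR f -> cR (fun x => f x * f x).
Proof.
move=> cf; apply: (@cR_comp (fun y => y * y)) => // x.
by apply: continuity_pt_mult; apply: derivable_continuous_pt; apply: derivable_pt_id.
Qed.

Lemma eq_cR f g : f =1 g -> cR f -> cR g.
Proof. by move/funext => ->. Qed.

Lemma cR_scale c f : cR f -> cR (fun x => c * f x).
Proof.
move=> cf; apply: (@cR_comp (fun y => c * y)) => // x.
by apply: continuity_pt_mult; apply: derivable_continuous_pt;
  [exact: derivable_pt_const | exact: derivable_pt_id].
Qed.

Lemma cR_mul f g : cR f -> cR g -> cR (fun x => f x * g x).
Proof.
move=> cf cg.
apply: (@eq_cR (fun x => 4^-1 * ((f x + g x) * (f x + g x) - (f x - g x) * (f x - g x)))).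
  by move=> x; field.
apply: cR_scale; apply: cR_sub; apply: cR_sqr; [exact: cR_add | exact: cR_sub].
Qed.

Lemma cR_inv f : (forall x, f x != 0) -> cR f -> cR (fun x => (f x)^-1).
Proof.
move=> nz cf; apply: (@eq_cR (fun x => Rinv (f x))) => [x|]; first by rewrite RinvE.
apply: cR_comp => // x.
apply: (continuity_pt_inv (fun y => y)); first exact: derivable_continuous_pt (derivable_pt_id _).
exact/eqP.
Qed.

Lemma cR_abs f : cR f -> cR (fun x => `|f x|).
Proof.
move=> cf x e /(cf x)[d d0 H]; exists d => // y *.
by apply: le_lt_trans (ler_dist_dist _ _) (H y _ _).
Qed.

Lemma cR_max f g : cR f -> cR g -> cR (fun x => Num.max (f x) (g x)).
Proof.
move=> cf cg; apply: (@eq_cR (fun x => 2^-1 * (f x + g x + `|f x - g x|))) => [x|].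
  by rewrite maxr_absE mulrC.
by apply: cR_scale; apply: cR_add; [apply: cR_add | apply: cR_abs; apply: cR_sub].
Qed.

Lemma cR_min f g : cR f -> cR g -> cR (fun x => Num.min (f x) (g x)).
Proof.
move=> cf cg; apply: (@eq_cR (fun x => 2^-1 * (f x + g x - `|f x - g x|))) => [x|].
  by rewrite minr_absE mulrC.
by apply: cR_scale; apply: cR_sub; [apply: cR_add | apply: cR_abs; apply: cR_sub].
Qed.

Lemma cR_clamp f : cR f -> cR (fun x => clamp (f x)).
Proof. by move=> cf; apply: cR_min (cR_cst 1); apply: cR_max => //; exact: cR_cst. Qed.

Lemma cR_reparam f u v : cR f -> cR u -> cR v -> cR (fun x => f (u x, v x)).
Proof.
move=> cf cu cv x e e0; have [d d0 Hf] := cf (u x, v x) e e0.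
have [d1 d10 H1] := cu x d d0; have [d2 d20 H2] := cv x d d0.
exists (Num.min d1 d2); first by rewrite lt_min d10.
move=> y; rewrite !lt_min => /andP[a1 a2] /andP[b1 b2].
by apply: Hf; [exact: H1 | exact: H2].
Qed.

Lemma cR_cos f : cR f -> cR (fun x => cos (f x)).
Proof. by move=> cf; apply: cR_comp => // x; exact: continuity_cos. Qed.

Lemma cR_sin f : cR f -> cR (fun x => sin (f x)).
Proof. by move=> cf; apply: cR_comp => // x; exact: continuity_sin. Qed.

Lemma cR_exp f : cR f -> cR (fun x => exp (f x)).
Proof.
by move=> cf; apply: cR_comp => // x; exact: derivable_continuous_pt (derivable_pt_exp _).
Qed.

Lemma cR_ln f : (forall x, 0 < f x) -> cR f -> cR (fun x => ln (f x)).
Proof.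
move=> f0 cf; apply: cR_comp => // x; apply: derivable_continuous_pt.
by exists (Rinv (f x)); apply: derivable_pt_lim_ln; exact/RltP.
Qed.

Lemma cR_sqrt f : (forall x, 0 <= f x) -> cR f -> cR (fun x => Num.sqrt (f x)).
Proof.
move=> f0 cf; apply: (@eq_cR (fun x => sqrt (f x))) => [x|]; first by rewrite RsqrtE.
by apply: cR_comp => // x; apply: continuity_pt_sqrt; exact/RleP.
Qed.

Lemma cR_atan f : cR f -> cR (fun x => atan (f x)).
Proof.
by move=> cf; apply: cR_comp => // x; exact: derivable_continuous_pt (derivable_pt_atan _).
Qed.

Lemma cR_sum (I : Type) (r : seq I) (f : I -> RR * RR -> RR) :
  (forall i, cR (f i)) -> cR (fun x => \sum_(i <- r) f i x).
Proof.
move=> cf; elim: r => [|i r IH].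
  by apply: eq_cR (cR_cst 0) => x; rewrite big_nil.
by apply: eq_cR (cR_add (cf i) IH) => x; rewrite big_cons.
Qed.

Lemma unit_induction (P : RR -> Prop) :
  (forall t : RR, 0 <= t <= 1 -> exists2 dl : RR, 0 < dl & forall s s' : RR, 0 <= s <= 1 ->
     0 <= s' <= 1 -> `|s - t| < dl -> `|s' - t| < dl -> P s -> P s') ->
  P 0 -> P 1.
Proof.
move=> loc P0.
pose E (t : RR) := 0 <= t <= 1 /\ P t.
have bE : bound E by exists 1 => t [/andP[_ h] _]; exact/RleP.
have nE : exists t, E t by exists 0; split=> //; rewrite lexx ler01.
have [m [ub lub]] := completeness E bE nE.
have m0 : 0 <= m by apply/RleP; apply: ub; split=> //; rewrite lexx ler01.
have m1 : m <= 1 by apply/RleP; apply: lub => t [/andP[_ h] _]; exact/RleP.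
have m01 : 0 <= m <= 1 by rewrite m0.
have [dl dl0 H] := loc m m01.
have [s [Es sm]] : exists s, E s /\ m - dl < s.
  apply: contrapT => h; pose c := m - dl; have : Rle m c.
    apply: lub => t Et; apply/RleP; rewrite leNgt; apply/negP => ht.
    by apply: h; exists t.
  by move/RleP; rewrite /c; lra.
have sm' : s <= m by apply/RleP; exact: ub.
have Hs := H s _ Es.1 _ _ _ Es.2.
have [s' Es'] : exists s', s' = Num.min (m + dl / 2) 1 by eexists.
have s'le1 : s' <= 1 by rewrite Es' ge_min lexx orbT.
have s'ge0 : 0 <= s' by rewrite Es' le_min ler01 andbT; lra.
have s'm : m <= s' by rewrite Es' le_min m1 andbT; lra.
have s'm2 : s' <= m + dl / 2 by rewrite Es' ge_min lexx.
have Ps' : P s'.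
  apply: Hs; first by rewrite s'ge0.
  - by rewrite ltr_norml; apply/andP; split; lra.
  - by rewrite ltr_norml; apply/andP; split; lra.
have : s' <= m by apply/RleP; apply: ub; split=> //; rewrite s'ge0.
by move: Ps'; rewrite Es'; case: (leP (m + dl / 2) 1) => // h1 _ h2; exfalso; lra.
Qed.

Definition unitsq (x : RR * RR) := (0 <= x.1 <= 1) && (0 <= x.2 <= 1).

Lemma unitsq_uniform (good : RR * RR -> RR * RR -> Prop) :
  (forall x, exists2 dl : RR, 0 < dl & forall y y' : RR * RR, unitsq y -> unitsq y' ->
     `|y.1 - x.1| < dl -> `|y.2 - x.2| < dl ->
     `|y'.1 - x.1| < dl -> `|y'.2 - x.2| < dl -> good y y') ->
  exists2 dl : RR, 0 < dl & forall y y' : RR * RR, unitsq y -> unitsq y' ->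
     `|y'.1 - y.1| < dl -> `|y'.2 - y.2| < dl -> good y y'.
Proof.
move=> loc.
have /choice[d Hd] : forall x : RR * RR, exists dl : RR, 0 < dl /\
    forall y y', unitsq y -> unitsq y' -> `|y.1 - x.1| < dl -> `|y.2 - x.2| < dl ->
     `|y'.1 - x.1| < dl -> `|y'.2 - x.2| < dl -> good y y'.
  by move=> x; have [dl ? ?] := loc x; exists dl.
pose hd u v : RR := d (u, v) / 2.
have hd0 u v : 0 < hd u v by rewrite divr_gt0 //; case: (Hd (u, v)).
have dpos u v : Rlt 0 (hd u v) by exact/RltP.
have [e He] := Compactness.compactness_value_2d 0 1 0 1
  (fun u v => RIneq.mkposreal _ (dpos u v)).
exists (RIneq.pos e); first by apply/RltP; exact: RIneq.cond_pos.
move=> y y' uy uy' h1 h2; apply: contrapT => ng.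
have [/andP[a1 a2] /andP[b1 b2]] := andP uy.
apply: (He y.1 y.2); [by split; apply/RleP | by split; apply/RleP |].
move=> [u [v [_ [_ [/= c1 [c2 c3]]]]]]; apply: ng.
move: c1 c2 c3; rewrite !RealsE /hd => /RltP c1 /RltP c2 /RleP c3.
have [d0 Hg] := Hd (u, v).
have k1 := ler_distD y.1 y'.1 u; have k2 := ler_distD y.2 y'.2 v.
apply: Hg => //=; first by lra.
- by lra.
- by lra.
- by lra.
Qed.

Lemma RR_eq (x y : RR) : @eq RR (1 * x) y -> x = y. Proof. by rewrite mul1r. Qed.
Lemma CC_eq (x y : CC) : @eq CC (1 * x) y -> x = y. Proof. by rewrite mul1r. Qed.
Ltac cring := first [apply: RR_eq | apply: CC_eq]; ring.
Ltac cfield := first [apply: RR_eq | apply: CC_eq]; field.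

Lemma reD (z w : CC) : re (z + w) = re z + re w. Proof. by case: z w => ? ? []. Qed.
Lemma imD (z w : CC) : im (z + w) = im z + im w. Proof. by case: z w => ? ? []. Qed.
Lemma reN (z : CC) : re (- z) = - re z. Proof. by case: z. Qed.
Lemma imN (z : CC) : im (- z) = - im z. Proof. by case: z. Qed.
Lemma reB (z w : CC) : re (z - w) = re z - re w. Proof. by rewrite reD reN. Qed.
Lemma imB (z w : CC) : im (z - w) = im z - im w. Proof. by rewrite imD imN. Qed.
Lemma reM (z w : CC) : re (z * w) = re z * re w - im z * im w. Proof. by case: z w => ? ? []. Qed.
Lemma imM (z w : CC) : im (z * w) = re z * im w + im z * re w. Proof. by case: z w => ? ? []. Qed.
Lemma reR (x : RR) : re x%:C%C = x. Proof. by []. Qed.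
Lemma imR (x : RR) : im x%:C%C = 0. Proof. by []. Qed.

Lemma cc_eq (z w : CC) : re z = re w -> im z = im w -> z = w.
Proof. by case: z w => ? ? [? ?] /= -> ->. Qed.

Lemma cc_eq0 (z : CC) : (z == 0) = (re z ^+ 2 + im z ^+ 2 == 0).
Proof.
case: z => x y /=; rewrite eq_complex /=; apply/andP/eqP => [[/eqP-> /eqP->]|h]; first by rewrite expr0n addr0.
have x2 := sqr_ge0 x; have y2 := sqr_ge0 y.
by split; rewrite -sqrf_eq0; apply/eqP; lra.
Qed.

Definition md (z : CC) : RR := Num.sqrt (re z ^+ 2 + im z ^+ 2).

Lemma md_def (z : CC) : md z = Num.sqrt (re z ^+ 2 + im z ^+ 2).
Proof. by []. Qed.

Lemma md_normc (z : CC) : md z = ComplexField.Normc.normc z.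
Proof. by case: z. Qed.

Lemma md_ge0 z : 0 <= md z. Proof. by rewrite md_def sqrtr_ge0. Qed.

Lemma md_sq z : md z ^+ 2 = re z ^+ 2 + im z ^+ 2.
Proof. by rewrite md_def sqr_sqrtr // addr_ge0 // sqr_ge0. Qed.

Lemma md_eq0 z : (md z == 0) = (z == 0).
Proof. by rewrite cc_eq0 -md_sq sqrf_eq0. Qed.

Lemma md_gt0 z : (0 < md z) = (z != 0).
Proof. by rewrite lt_def md_ge0 andbT md_eq0. Qed.

Lemma mdM z w : md (z * w) = md z * md w.
Proof. by rewrite !md_normc ComplexField.Normc.normcM. Qed.

Lemma mdD z w : md (z + w) <= md z + md w.
Proof. by rewrite !md_normc; exact: le_normcD. Qed.

Lemma mdN z : md (- z) = md z.
Proof. by rewrite !md_def reN imN !sqrrN. Qed.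

Lemma mdBC z w : md (z - w) = md (w - z).
Proof. by rewrite -mdN opprB. Qed.

Lemma md0 : md 0 = 0. Proof. by apply/eqP; rewrite md_eq0. Qed.

Lemma mdR (x : RR) : md x%:C%C = `|x|.
Proof. by rewrite md_def reR imR expr0n addr0 sqrtr_sqr. Qed.

Lemma md1 : md 1 = 1. Proof. by rewrite md_normc ComplexField.Normc.normc1. Qed.

Lemma mdX z n : md (z ^+ n) = md z ^+ n.
Proof. by elim: n => [|n IH]; rewrite ?expr0 ?md1 // !exprS mdM IH. Qed.

Lemma mdV z : md z^-1 = (md z)^-1.
Proof. by rewrite !md_normc ComplexField.Normc.normcV. Qed.

Lemma re_le_md z : `|re z| <= md z.
Proof.
by rewrite -(ler_pXn2r (n := 2)) ?nnegrE ?md_ge0 // md_sq real_normK ?num_real // lerDl sqr_ge0.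
Qed.

Definition cC (f : RR * RR -> CC) : Prop :=
  cR (fun x => re (f x)) /\ cR (fun x => im (f x)).

Lemma eq_cC f g : f =1 g -> cC f -> cC g.
Proof. by move/funext => ->. Qed.

Lemma cC_cst c : cC (fun _ => c).
Proof. by split; exact: cR_cst. Qed.

Lemma cC_add f g : cC f -> cC g -> cC (fun x => f x + g x).
Proof.
move=> [f1 f2] [g1 g2]; split.
  by apply: eq_cR (cR_add f1 g1) => x; rewrite reD.
by apply: eq_cR (cR_add f2 g2) => x; rewrite imD.
Qed.

Lemma cC_opp f : cC f -> cC (fun x => - f x).
Proof.
move=> [f1 f2]; split.
  by apply: eq_cR (cR_opp f1) => x; rewrite reN.
by apply: eq_cR (cR_opp f2) => x; rewrite imN.
Qed.

Lemma cC_sub f g : cC f -> cC g -> cC (fun x => f x - g x).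
Proof. by move=> cf cg; apply: cC_add => //; exact: cC_opp. Qed.

Lemma cC_mul f g : cC f -> cC g -> cC (fun x => f x * g x).
Proof.
move=> [f1 f2] [g1 g2]; split.
  by apply: eq_cR (cR_sub (cR_mul f1 g1) (cR_mul f2 g2)) => x; rewrite reM.
by apply: eq_cR (cR_add (cR_mul f1 g2) (cR_mul f2 g1)) => x; rewrite imM.
Qed.

Lemma cC_real f : cR f -> cC (fun x => (f x)%:C%C).
Proof. by move=> cf; split => //; exact: cR_cst. Qed.

Lemma cC_complex f g : cR f -> cR g -> cC (fun x => (f x +i* g x)%C).
Proof. by []. Qed.

Lemma cR_re f : cC f -> cR (fun x => re (f x)). Proof. by case. Qed.
Lemma cR_im f : cC f -> cR (fun x => im (f x)). Proof. by case. Qed.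

Lemma cR_md f : cC f -> cR (fun x => md (f x)).
Proof.
move=> [f1 f2]; apply: (@eq_cR (fun x => Num.sqrt (re (f x) * re (f x) + im (f x) * im (f x)))).
  by move=> x; rewrite md_def !expr2.
apply: cR_sqrt => [x|]; first by rewrite addr_ge0 // -expr2 sqr_ge0.
by apply: cR_add; exact: cR_mul.
Qed.

Lemma cC_inv f : (forall x, f x != 0) -> cC f -> cC (fun x => (f x)^-1).
Proof.
move=> nz cf.
apply: (@eq_cC (fun x => ((re (f x) * (md (f x) * md (f x))^-1) +i*
                         (- im (f x) * (md (f x) * md (f x))^-1))%C)) => [x|].
  apply: (mulfI (nz x)); rewrite divff //.
  have h : md (f x) != 0 by rewrite md_eq0.
  have h2 := md_sq (f x).
  apply: cc_eq; rewrite ?reM ?imM /=; last by cring.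
  transitivity ((re (f x) ^+ 2 + im (f x) ^+ 2) / (md (f x) * md (f x))); first by cring.
  by rewrite -h2 -expr2 divff // expf_neq0.
have cm : cR (fun x => (md (f x) * md (f x))^-1).
  apply: cR_inv => [x|]; first by rewrite mulf_neq0 // md_eq0.
  by apply: cR_mul; exact: cR_md.
by case: cf => f1 f2; apply: cC_complex; apply: cR_mul => //; exact: cR_opp.
Qed.

Lemma cC_prod (I : Type) (r : seq I) (f : I -> RR * RR -> CC) :
  (forall i, cC (f i)) -> cC (fun x => \prod_(i <- r) f i x).
Proof.
move=> cf; elim: r => [|i r IH].
  by apply: eq_cC (cC_cst 1) => x; rewrite big_nil.
by apply: eq_cC (cC_mul (cf i) IH) => x; rewrite big_cons.
Qed.

Lemma cC_sum (I : Type) (r : seq I) (f : I -> RR * RR -> CC) :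
  (forall i, cC (f i)) -> cC (fun x => \sum_(i <- r) f i x).
Proof.
move=> cf; elim: r => [|i r IH].
  by apply: eq_cC (cC_cst 0) => x; rewrite big_nil.
by apply: eq_cC (cC_add (cf i) IH) => x; rewrite big_cons.
Qed.

Lemma cC_reparam f u v : cC f -> cR u -> cR v -> cC (fun x => f (u x, v x)).
Proof. by move=> [f1 f2] cu cv; split; [exact: (cR_reparam f1) | exact: (cR_reparam f2)]. Qed.

Lemma cC_path (f : RR -> CC) u : cC (fun x => f x.1) -> cR u -> cC (fun x => f (u x)).
Proof. by move=> cf cu; apply: (cC_reparam (f := fun x => f x.1) (v := u)). Qed.

Definition cis (x : RR) : CC := (cos x +i* sin x)%C.

Lemma cC_cis f : cR f -> cC (fun x => cis (f x)).
Proof. by move=> cf; apply: cC_complex; [exact: cR_cos | exact: cR_sin]. Qed.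

Lemma cisD x y : cis (x + y) = cis x * cis y.
Proof. by apply: cc_eq; rewrite ?reM ?imM /= ?cos_plus ?sin_plus !RealsE //; cring. Qed.

Lemma cis0 : cis 0 = 1. Proof. by rewrite /cis cos_0 sin_0. Qed.

Lemma md_cis x : md (cis x) = 1.
Proof.
rewrite md_def /= addrC; have := sin2_cos2 x; rewrite /Rsqr !RealsE -!expr2 => ->.
by rewrite sqrtr1.
Qed.

Lemma cis_neq0 x : cis x != 0.
Proof. by rewrite -md_eq0 md_cis oner_eq0. Qed.

Lemma cisN x : cis (- x) = (cis x)^-1.
Proof. by apply: (mulfI (cis_neq0 x)); rewrite divff ?cis_neq0 // -cisD (subrr x) cis0. Qed.

Lemma cisX x n : cis x ^+ n = cis (n%:R * x).
Proof.
elim: n => [|n IH]; first by rewrite mul0r cis0 expr0.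
by rewrite exprS IH -cisD -natr1 mulrDl mul1r addrC.
Qed.

Lemma cis_pi : cis PI = -1.
Proof. by apply: cc_eq; rewrite ?reN ?imN /= ?cos_PI ?sin_PI ?RealsE // oppr0. Qed.

Lemma cis_2pi : cis (2 * PI) = 1.
Proof. by rewrite mulrDl mul1r cisD cis_pi mulrNN mulr1. Qed.

Lemma zetaE d : zeta d = cis (2 * PI / d%:R). Proof. by []. Qed.

Lemma zetaX d : (0 < d)%N -> zeta d ^+ d = 1.
Proof.
move=> d0; rewrite zetaE cisX mulrC divfK ?cis_2pi //.
by rewrite pnatr_eq0 -lt0n.
Qed.

Lemma cis_atan (z : CC) : 0 < re z -> z = (md z)%:C%C * cis (atan (im z / re z)).
Proof.
move=> z0; have zn : re z != 0 by rewrite gt_eqF.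
have E : Num.sqrt (1 + (im z / re z) ^+ 2) = md z / re z.
  rewrite -[RHS]gtr0_norm ?divr_gt0 ?md_gt0 //; last by apply: contraTneq z0 => ->; rewrite ltxx.
  rewrite -sqrtr_sqr; congr (Num.sqrt _).
  by rewrite [in RHS]expr_div_n md_sq expr_div_n mulrDl divff // expf_neq0.
have mn : md z != 0 by rewrite md_eq0; apply: contraTneq z0 => ->; rewrite ltxx.
apply: cc_eq; rewrite ?reM ?imM reR imR /= mul0r ?subr0 ?addr0 ?cos_atan ?sin_atan /Rsqr !RealsE -expr2 E.
  by cfield; rewrite zn.
by cfield; rewrite zn.
Qed.

Lemma polar (z : CC) : exists th, z = (md z)%:C%C * cis th.
Proof.
case: (ltrgtP (re z) 0) => h.
- have h' : 0 < re (- z) by rewrite reN oppr_gt0.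
  exists (atan (im (- z) / re (- z)) + PI).
  by rewrite cisD mulrA -(mdN z) -(cis_atan h') cis_pi mulrN1 opprK.
- by exists (atan (im z / re z)); exact: cis_atan.
have E : md z = `|im z| by rewrite md_def h expr0n add0r sqrtr_sqr.
case: (lerP 0 (im z)) => k.
  exists (PI / 2); rewrite E ger0_norm //.
  have -> : PI / 2 = Rdiv PI (IZR 2) by rewrite RealsE.
  by apply: cc_eq; rewrite ?reM ?imM /= cos_PI2 sin_PI2 ?h !RealsE; cring.
exists (- (PI / 2)); rewrite E ltr0_norm //.
have -> : - (PI / 2) = Ropp (Rdiv PI (IZR 2)) by rewrite !RealsE.
by apply: cc_eq; rewrite ?reM ?imM /= cos_neg sin_neg cos_PI2 sin_PI2 ?h !RealsE; cring.
Qed.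

Lemma clamp01 t : 0 <= clamp t <= 1.
Proof. by rewrite /clamp le_min ler01 andbT le_max lexx orbT ge_min lexx orbT. Qed.

Lemma clamp_id t : 0 <= t <= 1 -> clamp t = t.
Proof. by move=> /andP[t0 t1]; rewrite /clamp max_l // min_l. Qed.

Lemma clampK t : clamp (clamp t) = clamp t.
Proof. by rewrite clamp_id // clamp01. Qed.

Lemma clamp0 : clamp 0 = 0. Proof. by rewrite clamp_id // lexx ler01. Qed.
Lemma clamp1 : clamp 1 = 1. Proof. by rewrite clamp_id // lexx ler01. Qed.

Definition clamp2 (x : RR * RR) : RR * RR := (clamp x.1, clamp x.2).

Lemma clamp2_id x : unitsq x -> clamp2 x = x.
Proof. by case: x => u v /andP[/= h k]; rewrite /clamp2 /= !clamp_id. Qed.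

Lemma unitsq_clamp2 x : unitsq (clamp2 x).
Proof. by rewrite /unitsq /= !clamp01. Qed.

Lemma unitsq_scale (c : RR) x : 0 <= c <= 1 -> unitsq x -> unitsq (c * x.1, c * x.2).
Proof.
move=> /andP[c0 c1] /andP[/andP[h1 h2] /andP[h3 h4]]; apply/andP; split; apply/andP => /=; split.
- exact: mulr_ge0.
- exact: mulr_ile1.
- exact: mulr_ge0.
- exact: mulr_ile1.
Qed.

Lemma cC_clamp2 f : cC f -> cC (fun x => f (clamp2 x)).
Proof.
move=> cf; apply: (cC_reparam cf); apply: cR_clamp; [exact: cR_fst | exact: cR_snd].
Qed.

Lemma cC_md_close g x e : cC g -> 0 < e -> exists2 dl : RR, 0 < dl &
  forall y, `|y.1 - x.1| < dl -> `|y.2 - x.2| < dl -> md (g y - g x) < e.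
Proof.
move=> cg e0; have [dl dl0 H] := cR_md (cC_sub cg (cC_cst (g x))) x e0.
exists dl => // y h1 h2; have := H y h1 h2.
by rewrite subrr md0 subr0 ger0_norm ?md_ge0.
Qed.

Lemma re_div_gt0 (z w : CC) : md (w - z) < md z -> 0 < re (w / z).
Proof.
move=> h; have z0 : z != 0.
  by apply: contraTneq h => ->; rewrite md0 -leNgt md_ge0.
have h1 : md (w / z - 1) < 1.
  have -> : w / z - 1 = (w - z) / z by cfield.
  by rewrite mdM mdV ltr_pdivrMr ?mul1r // md_gt0.
have := le_lt_trans (re_le_md _) h1; rewrite reB /= ltr_norml => /andP[h2 _]; lra.
Qed.

Lemma archi (e : RR) : 0 < e -> exists2 N : nat, (0 < N)%N & N%:R^-1 < e.
Proof.
move=> e0; have [N hN] : exists N : nat, e^-1 < N%:R.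
  by exists (Num.Def.archi_bound e^-1); apply: archi_boundP; rewrite invr_ge0 ltW.
have N0 : 0 < (N%:R : RR) by apply: lt_trans hN; rewrite invr_gt0.
exists N; first by rewrite -(ltr0n RR).
by rewrite -[e]invrK ltf_pV2 ?posrE ?invr_gt0.
Qed.

(* A continuous argument on the square is a finite sum of principal arguments
   of the quotients of consecutive values along the ray from the origin. *)
Lemma arg_lift (g : RR * RR -> CC) : cC g -> (forall x, g x != 0) ->
  exists2 th, cR th & forall x, g (clamp2 x) = (md (g (clamp2 x)))%:C%C * cis (th x).
Proof.
move=> cg nz.
have [x|dl dl0 U] := @unitsq_uniform (fun y y' => md (g y' - g y) < md (g y)).
  pose m := md (g x) / 4.
  have m0 : 0 < m by rewrite divr_gt0 // md_gt0.
  have E : md (g x) = 4 * m by rewrite /m; cfield.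
  have [d d0 H] := cC_md_close x cg m0.
  exists d => // y y' _ _ a1 a2 b1 b2.
  have h1 := H y a1 a2; have h2 := H y' b1 b2.
  have h3 : md (g x) <= md (g x - g y) + md (g y).
    by apply: le_trans (mdD _ _); rewrite subrK.
  have h4 : md (g y' - g y) <= md (g y' - g x) + md (g x - g y).
    by apply: le_trans (mdD _ _); rewrite addrA subrK.
  by rewrite mdBC in h1; lra.
have [N N0 hN] := archi dl0.
have N0' : (N%:R : RR) != 0 by rewrite pnatr_eq0 -lt0n.
pose pt k (x : RR * RR) : RR * RR := (k%:R / N%:R * (clamp2 x).1, k%:R / N%:R * (clamp2 x).2).
pose r k x := g (pt k.+1 x) / g (pt k x).
have r0 k x : (k < N)%N -> 0 < re (r k x).
  move=> kN; apply: re_div_gt0; apply: U.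
  - have kN1 : 0 <= k%:R / N%:R :> RR by rewrite divr_ge0.
    have kN2 : k%:R / N%:R <= 1 :> RR by rewrite ler_pdivrMr ?ltr0n // mul1r ler_nat ltnW.
    by apply: unitsq_scale (unitsq_clamp2 x); rewrite kN1.
  - have kN1 : 0 <= k.+1%:R / N%:R :> RR by rewrite divr_ge0.
    have kN2 : k.+1%:R / N%:R <= 1 :> RR by rewrite ler_pdivrMr ?ltr0n // mul1r ler_nat.
    by apply: unitsq_scale (unitsq_clamp2 x); rewrite kN1.
  - have /andP[/andP[a1 a2] /andP[b1 b2]] := unitsq_clamp2 x.
    rewrite /= -mulrBl -mulrBl -natrB // subSnn mul1r ger0_norm ?mulr_ge0 ?invr_ge0 //.
    by apply: le_lt_trans hN; rewrite ger_pMr // invr_gt0 ltr0n.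
  - have /andP[/andP[a1 a2] /andP[b1 b2]] := unitsq_clamp2 x.
    rewrite /= -mulrBl -mulrBl -natrB // subSnn mul1r ger0_norm ?mulr_ge0 ?invr_ge0 //.
    by apply: le_lt_trans hN; rewrite ger_pMr // invr_gt0 ltr0n.
have cpt k : cC (fun x => g (pt k x)).
  apply: (cC_reparam cg); apply: cR_scale; apply: cR_clamp; [exact: cR_fst | exact: cR_snd].
have cr k : cC (r k).
  by apply: cC_mul => //; apply: cC_inv.
have [t0 Ht0] := polar (g (0, 0)).
pose th x := t0 + \sum_(k < N) atan (im (r k x) / re (r k x)).
exists th.
  apply: cR_add; first exact: cR_cst.
  apply: cR_sum => k; apply: cR_atan; apply: cR_mul; first exact: cR_im.
  by apply: cR_inv; [move=> x; rewrite gt_eqF // r0 | exact: cR_re].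
move=> x.
have step k : (k <= N)%N -> g (pt k x) =
    (md (g (pt k x)))%:C%C * cis (t0 + \sum_(0 <= j < k) atan (im (r j x) / re (r j x))).
  elim: k => [_|k IH kN].
    by rewrite big_geq // addr0 /pt mul0r !mul0r -Ht0.
  have E : g (pt k.+1 x) = r k x * g (pt k x) by rewrite /r divfK.
  rewrite E mdM rmorphM /= {1}(cis_atan (r0 k x kN)) {1}(IH (ltnW kN)) big_nat_recr //= addrA [in RHS]cisD.
  cring.
have -> : clamp2 x = pt N x by rewrite /pt divff // !mul1r; case: (clamp2 x).
by rewrite {1}(step N (leqnn N)) /th big_mkord.
Qed.

Lemma root_lift d (q : RR * RR -> CC) (t0 : CC) : (0 < d)%N ->
  cC q -> (forall x, q x != 0) -> t0 ^+ d * q (0, 0) = 1 ->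
  exists t, [/\ cC t, t (0, 0) = t0 & forall x, t x ^+ d * q (clamp2 x) = 1].
Proof.
move=> d0 cq nz ht0; have [th cth Hth] := arg_lift cq nz.
have dn : (d%:R : RR) != 0 by rewrite pnatr_eq0 -lt0n.
pose m x := md (q (clamp2 x)).
have m0 x : 0 < m x by rewrite md_gt0.
pose t x : CC := (exp (- ln (m x) / d%:R))%:C%C * cis (- th x / d%:R).
have expX (y : RR) k : exp y ^+ k = exp (k%:R * y).
  elim: k => [|k IH]; first by rewrite expr0 mul0r exp_0.
  by rewrite exprS IH -natr1 mulrDl mul1r addrC; have := exp_plus y (k%:R * y); rewrite !RealsE => ->.
have tq x : t x ^+ d * q (clamp2 x) = 1.
  rewrite /t exprMn -rmorphXn /= expX cisX ![d%:R * _]mulrC !divfK // Hth -/(m x).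
  rewrite mulrACA -cisD addNr cis0 mulr1 -rmorphM /= exp_Ropp RealsE exp_ln; last exact/RltP.
  by rewrite mulVf // gt_eqF.
have ct : cC t.
  apply: cC_mul.
    apply: cC_real; apply: cR_exp; apply: cR_mul (cR_cst _); apply: cR_opp; apply: cR_ln => //.
    by apply: cR_md; exact: cC_clamp2.
  by apply: cC_cis; apply: cR_mul (cR_cst _); apply: cR_opp.
have c00 : clamp2 (0, 0) = (0, 0) by rewrite /clamp2 /= clamp0.
have t00 : t (0, 0) != 0.
  by apply: contra_eq_neq (tq (0, 0)) => ->; rewrite expr0n gtn_eqF // mul0r eq_sym oner_eq0.
exists (fun x => t x * (t0 / t (0, 0))); split.
- by apply: cC_mul => //; exact: cC_cst.
- by rewrite mulrC divfK.
move=> x; rewrite exprMn mulrAC tq mul1r.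
have tqd := tq (0, 0); rewrite c00 in tqd.
have q0 := nz (0, 0); apply: (mulIf q0).
by rewrite expr_div_n mul1r mulrAC ht0 -tqd mulrAC divff ?mul1r // expf_neq0.
Qed.

Lemma unity_root_discrete d : (0 < d)%N -> exists2 e : RR, 0 < e &
  forall u : CC, u ^+ d = 1 -> md (u - 1) < e -> u = 1.
Proof.
move=> d0; exists (d%:R * d%:R)^-1; first by rewrite invr_gt0 mulr_gt0 // ltr0n.
move=> u ud hu; have d0' : 0 < (d%:R : RR) by rewrite ltr0n.
have mu : md u = 1.
  have := mdX u d; rewrite ud md1 => /esym /eqP; rewrite pexprn_eq1 ?md_ge0 //.
  by rewrite gtn_eqF //= => /eqP.
have hk k : md (u ^+ k - 1) <= k%:R * md (u - 1).
  elim: k => [|k IH]; first by rewrite expr0 subrr md0 mul0r.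
  have -> : u ^+ k.+1 - 1 = u * (u ^+ k - 1) + (u - 1) by rewrite exprS; cring.
  apply: le_trans (mdD _ _) _; rewrite mdM mu mul1r -natr1 mulrDl mul1r; lra.
have := subrX1 u d; rewrite ud subrr => /esym/eqP; rewrite mulf_eq0 subr_eq0 => /orP[/eqP//|].
move=> /eqP S0; exfalso.
have : md (\sum_(i < d) (u ^+ i - 1)) < d%:R.
  apply: (@le_lt_trans _ _ (\sum_(i < d) (d%:R * md (u - 1)))).
    apply: (big_ind2 (fun x y => md x <= y)); first by rewrite md0.
      by move=> x1 x2 y1 y2 h1 h2; apply: le_trans (mdD _ _) (lerD h1 h2).
    move=> i _; apply: le_trans (hk i) _; apply: ler_wpM2r; first exact: md_ge0.
    by rewrite ler_nat ltnW.
  rewrite sumr_const card_ord -[ltLHS]mulr_natl mulrA -ltr_pdivlMl ?mulr_gt0 //.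
  by apply: lt_le_trans hu _; rewrite ler_peMr ?invr_ge0 ?ler1n // mulr_ge0.
rewrite sumrB S0 sub0r mdN sumr_const card_ord.
have -> : (1 *+ d : CC) = (d%:R : RR)%:C%C by rewrite rmorph_nat.
by rewrite mdR ger0_norm // ltxx.
Qed.

Lemma root_unique d (w : RR -> CC) : (0 < d)%N -> cC (fun x => w x.1) ->
  (forall t, 0 <= t <= 1 -> w t ^+ d = 1) -> w 0 = 1 -> forall t, 0 <= t <= 1 -> w t = 1.
Proof.
move=> d0 cw wd w0 T hT.
have [e e0 He] := unity_root_discrete d0.
pose P s := w (T * clamp s) = 1.
suff : P 1 by rewrite /P clamp1 mulr1.
apply: unit_induction; last by rewrite /P clamp0 mulr0.
have inT s : 0 <= T * clamp s <= 1.
  have /andP[? ?] := clamp01 s; have /andP[? ?] := hT.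
  by rewrite mulr_ge0 //= mulr_ile1.
have cw' : cC (fun x => w (T * clamp x.1)).
  by apply: (cC_path cw); apply: cR_scale; apply: cR_clamp; exact: cR_fst.
move=> t _; have e2 : 0 < e / 2 by lra.
have [dl dl0 H] := cC_md_close (t, 0) cw' e2.
exists dl => // s s' _ _ h1 h2 hs; rewrite /P.
have k1 : md (w (T * clamp s) - w (T * clamp t)) < e / 2 by apply: (H (s, 0)); rewrite //= subrr normr0.
have k2 : md (w (T * clamp s') - w (T * clamp t)) < e / 2 by apply: (H (s', 0)); rewrite //= subrr normr0.
apply: He; first by rewrite wd.
rewrite hs in k1.
have := mdD (w (T * clamp s') - w (T * clamp t)) (w (T * clamp t) - 1).
by rewrite addrA subrK; rewrite mdBC in k1; lra.
Qed.

Lemma convex_gt0 (A B c : RR) : 0 < A -> 0 < B -> 0 <= c <= 1 -> 0 < (1 - c) * A + c * B.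
Proof.
move=> A0 B0 /andP[c0 c1]; case: (eqVneq c 0) => [->|cn]; first by rewrite subr0 mul1r mul0r addr0.
by rewrite ltr_wpDl ?mulr_gt0 ?mulr_ge0 ?(ltW A0) ?subr_ge0 // lt_def cn.
Qed.

(** * Paths and primitives on the Milnor fibre *)

Section Faces.
Variable T : Type.
Definition gface0 (s : RR * RR -> T) : RR -> T := fun u => s (1 - clamp u, clamp u).
Definition gface1 (s : RR * RR -> T) : RR -> T := fun u => s (0, clamp u).
Definition gface2 (s : RR * RR -> T) : RR -> T := fun u => s (clamp u, 0).
End Faces.

Lemma retr2_in x : let r := retr2 x in [/\ 0 <= r.1, 0 <= r.2 & r.1 + r.2 <= 1].
Proof.
rewrite /retr2 /=; set s := Num.max x.1 _; set t := Num.max x.2 _; set m := Num.max 1 _.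
have s0 : 0 <= s by rewrite /s le_max lexx orbT.
have t0 : 0 <= t by rewrite /t le_max lexx orbT.
have m1 : 1 <= m by rewrite /m le_max lexx.
have m0 : 0 < m by lra.
split; rewrite ?divr_ge0 ?(ltW m0) //.
by rewrite -mulrDl ler_pdivrMr // mul1r le_max lexx orbT.
Qed.

Lemma retr2_id x : 0 <= x.1 -> 0 <= x.2 -> x.1 + x.2 <= 1 -> retr2 x = x.
Proof.
case: x => s t /= s0 t0 st; rewrite /retr2 /= (max_l s0) (max_l t0) max_l //.
by rewrite !divr1.
Qed.

Lemma cR_retr2 : cR (fun x => (retr2 x).1) /\ cR (fun x => (retr2 x).2).
Proof.
have c1 : cR (fun x => Num.max x.1 0) by apply: cR_max (cR_cst 0); exact: cR_fst.
have c2 : cR (fun x => Num.max x.2 0) by apply: cR_max (cR_cst 0); exact: cR_snd.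
have cm : cR (fun x => (Num.max 1 (Num.max x.1 0 + Num.max x.2 0))^-1).
  apply: cR_inv => [x|]; last by apply: cR_max (cR_cst 1) _; exact: cR_add.
  by rewrite gt_eqF // lt_max ltr01.
by split; exact: cR_mul.
Qed.

Definition pt := (CC * CC * CC)%type.

Definition cB (f : RR * RR -> CC * CC) := cC (fun x => (f x).1) /\ cC (fun x => (f x).2).
Definition cP (f : RR * RR -> pt) := cB (fun x => (f x).1) /\ cC (fun x => (f x).2).

Lemma cB_reparam f u v : cB f -> cR u -> cR v -> cB (fun x => f (u x, v x)).
Proof. by move=> [f1 f2] cu cv; split; [exact: (cC_reparam f1) | exact: (cC_reparam f2)]. Qed.

Lemma cP_reparam f u v : cP f -> cR u -> cR v -> cP (fun x => f (u x, v x)).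
Proof. by move=> [f1 f2] cu cv; split; [exact: (cB_reparam f1) | exact: (cC_reparam f2)]. Qed.

Lemma cP_path (f : RR -> pt) u : cP (fun x => f x.1) -> cR u -> cP (fun x => f (u x)).
Proof. by move=> cf cu; apply: (cP_reparam (f := fun x => f x.1) (v := u)). Qed.

Lemma cP_cst q : cP (fun _ => q).
Proof. by split; [split|]; exact: cC_cst. Qed.

(* The affine part of the arrangement consists of the lines y = a i x + b i;
   the remaining line of the arrangement is the line at infinity.  The Milnor
   fibre, in the coordinates (x : y : 1) scaled by t, is t^(n+1) Q(x,y) = 1. *)
Section Model.
Variables (n : nat) (a b : 'I_n -> CC).

Definition lam i (p : CC * CC) : CC := p.2 - a i * p.1 - b i.
Definition affQ p : CC := \prod_(i < n) lam i p.
Definition inB p := forall i, lam i p != 0.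
Definition inF (q : pt) := q.2 ^+ n.+1 * affQ q.1 = 1.

Lemma affQ_neq0 p : inB p -> affQ p != 0.
Proof. by move=> h; apply/prodf_neq0 => i _. Qed.

Lemma inF_inB q : inF q -> inB q.1.
Proof.
move=> h i; apply: contra_eq_neq h => h0.
by rewrite /affQ (bigD1 i) //= h0 mul0r mulr0 eq_sym oner_neq0.
Qed.

Lemma inF_neq0 q : inF q -> q.2 != 0.
Proof. by move=> h; apply: contra_eq_neq h => ->; rewrite expr0n mul0r eq_sym oner_neq0. Qed.

Lemma cC_lam i f : cB f -> cC (fun x => lam i (f x)).
Proof.
move=> [f1 f2]; apply: cC_sub (cC_cst _); apply: cC_sub => //.
by apply: cC_mul => //; exact: cC_cst.
Qed.

Lemma cC_affQ f : cB f -> cC (fun x => affQ (f x)).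
Proof. by move=> cf; apply: cC_prod => i; exact: cC_lam. Qed.

Definition path (s : RR -> pt) := cP (fun x => s x.1) /\ forall t, inF (s t).

Definition splx1 (s : RR -> pt) := path s /\ forall t, s t = s (clamp t).
Definition splx2 (s : RR * RR -> pt) :=
  [/\ cP s, (forall x, s x = s (retr2 x)) & forall x, inF (s x)].

Lemma path_reparam s u : path s -> cR (fun x => u x.1) -> path (fun t => s (u t)).
Proof. by move=> [cs Fs] cu; split=> // ; exact: (cP_path cs). Qed.

Lemma path_clamp s : path s -> path (fun t => s (clamp t)).
Proof. by move=> ps; apply: path_reparam => //; apply: cR_clamp; exact: cR_fst. Qed.

Lemma lift_square (f : RR * RR -> CC * CC) t0 : cB f -> (forall x, inB (f x)) ->
  inF (f (0, 0), t0) -> exists H : RR * RR -> pt,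
    [/\ cP H, (forall x, inF (H x)), (forall x, (H x).1 = f (clamp2 x)) & (H (0, 0)).2 = t0].
Proof.
move=> cf Bf F0.
have [t [ct t00 ht]] := @root_lift n.+1 (fun x => affQ (f x)) t0 isT (cC_affQ cf)
  (fun x => affQ_neq0 (Bf x)) F0.
exists (fun x => (f (clamp2 x), t x)); split=> //.
split=> //; apply: (cB_reparam cf); apply: cR_clamp; [exact: cR_fst | exact: cR_snd].
Qed.

Lemma lift_unique s s' : path s -> path s' ->
  (forall t, 0 <= t <= 1 -> (s t).1 = (s' t).1) -> s 0 = s' 0 ->
  forall t, 0 <= t <= 1 -> s t = s' t.
Proof.
move=> [[_ cs] Fs] [[_ cs'] Fs'] e e0 t ht.
pose w t := (s t).2 / (s' t).2.
have nz u : (s' u).2 != 0 by exact: inF_neq0.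
suff : w t = 1.
  move/(congr1 (fun z => z * (s' t).2)); rewrite /w divfK // mul1r => h.
  by rewrite (surjective_pairing (s t)) (surjective_pairing (s' t)) h e.
apply: (@root_unique n.+1) => // [|u hu|].
- by apply: cC_mul => //; apply: cC_inv => // x; exact: inF_neq0.
- have h := Fs u; have h' := Fs' u.
  have qn : affQ (s' u).1 != 0 by apply: affQ_neq0; exact: inF_inB.
  have E : (s u).2 ^+ n.+1 = (s' u).2 ^+ n.+1.
    by apply: (mulIf qn); rewrite [RHS]h' -[in LHS](e u hu) h.
  by rewrite /w expr_div_n E divff // expf_neq0 // inF_neq0.
by rewrite /w e0 divff // inF_neq0.
Qed.

Definition deck (m : nat) (q : pt) : pt := (q.1, zeta n.+1 ^+ m * q.2).

Lemma deck_inF m q : inF q -> inF (deck m q).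
Proof.
by rewrite /inF /= exprMn exprAC zetaX // expr1n mul1r.
Qed.

Lemma path_deck m s : path s -> path (fun t => deck m (s t)).
Proof.
move=> [[c1 c2] Fs]; split=> [|t]; last exact: deck_inF.
by split=> //; apply: cC_mul => //; exact: cC_cst.
Qed.

Section Cocycle.
Variable phi : (RR -> pt) -> CC.
Hypothesis phi_cocycle : forall s, splx2 s -> phi (gface0 s) - phi (gface1 s) + phi (gface2 s) = 0.

Definition hol (s : RR -> pt) : CC := phi (fun t => s (clamp t)).

Lemma hol_eq s s' : (forall t, 0 <= t <= 1 -> s t = s' t) -> hol s = hol s'.
Proof. by move=> h; congr phi; apply: funext => t; apply: h; exact: clamp01. Qed.

Lemma hol_triangle (s : RR * RR -> pt) : cP s -> (forall x, inF (s x)) ->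
  hol (fun u => s (1 - u, u)) + hol (fun u => s (u, 0)) = hol (fun u => s (0, u)).
Proof.
move=> cs Fs.
have [c1 c2] := cR_retr2.
have S : splx2 (fun x => s (retr2 x)).
  split=> //.
    apply: (@cP_reparam s (fun x => (retr2 x).1) (fun x => (retr2 x).2)) => //.
  by move=> x; have [? ? ?] := retr2_in x; rewrite (retr2_id (x := retr2 x)).
have := phi_cocycle S; rewrite /gface0 /gface1 /gface2.
have cl u : 0 <= clamp u /\ clamp u <= 1 by apply/andP; exact: clamp01.
have E0 u : retr2 (1 - clamp u, clamp u) = (1 - clamp u, clamp u).
  by have [? ?] := cl u; rewrite retr2_id //=; lra.
have E1 u : retr2 (0, clamp u) = (0, clamp u).
  by have [? ?] := cl u; rewrite retr2_id //=; lra.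
have E2 u : retr2 (clamp u, 0) = (clamp u, 0).
  by have [? ?] := cl u; rewrite retr2_id //=; lra.
under eq_fun do rewrite E0.
under [in X in _ - X]eq_fun do rewrite E1.
under [in X in _ + X]eq_fun do rewrite E2.
by rewrite addrAC => /subr0_eq.
Qed.

Lemma hol_cst q : inF q -> hol (fun _ => q) = 0.
Proof.
move=> Fq; have := @hol_triangle (fun _ => q) (cP_cst q) (fun _ => Fq).
by move/(canRL (addrK _)); rewrite subrr.
Qed.

Lemma hol_square (H : RR * RR -> pt) : cP H -> (forall x, inF (H x)) ->
  hol (fun u => H (u, 0)) + hol (fun u => H (1, u)) =
  hol (fun u => H (0, u)) + hol (fun u => H (u, 1)).
Proof.
move=> cH FH.
have cs : cR (fun x => x.1 + x.2) by apply: cR_add; [exact: cR_fst | exact: cR_snd].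
have h1 := @hol_triangle (fun x => H (x.1 + x.2, x.2)) (cP_reparam cH cs cR_snd) (fun x => FH _).
have h2 := @hol_triangle (fun x => H (x.2, x.1 + x.2)) (cP_reparam cH cR_snd cs) (fun x => FH _).
move: h1 h2 => /=.
under eq_fun do rewrite subrK.
under [in X in _ + X]eq_fun do rewrite addr0.
under [in X in _ = X]eq_fun do rewrite add0r.
move=> h1.
under eq_fun do rewrite subrK.
under [in X in _ + X]eq_fun do rewrite addr0.
under [in X in _ = X]eq_fun do rewrite add0r.
move=> h2; rewrite [LHS]addrC h1 -h2; exact: addrC.
Qed.

Definition seg (s : RR -> pt) (u v : RR) : RR -> pt := fun t => s (u + (v - u) * t).

Lemma path_seg s u v : path s -> path (seg s u v).
Proof.
move=> ps; apply: (@path_reparam s (fun t => u + (v - u) * t)) => //.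
by apply: cR_add (cR_cst _) _; apply: cR_scale; exact: cR_fst.
Qed.

Lemma hol_seg s u v w : path s -> hol (seg s u v) + hol (seg s v w) = hol (seg s u w).
Proof.
move=> [cs Fs].
have c : cR (fun x => u + (v - u) * x.1 + (w - u) * x.2).
  apply: cR_add; last by apply: cR_scale; exact: cR_snd.
  by apply: cR_add (cR_cst _) _; apply: cR_scale; exact: cR_fst.
have := @hol_triangle (fun x => s (u + (v - u) * x.1 + (w - u) * x.2)) (cP_path cs c) (fun x => Fs _).
rewrite addrC /=; set A := hol _; set B := hol _; set C := hol _.
have -> : A = hol (seg s u v) by apply: hol_eq => t _; rewrite /seg mulr0 addr0.
have -> : B = hol (seg s v w).
  apply: hol_eq => t _; rewrite /seg; congr (s _); ring.
by have -> : C = hol (seg s u w) by apply: hol_eq => t _; rewrite /seg mulr0 addr0.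
Qed.

Lemma seg01 s : seg s 0 1 = s.
Proof. by apply: funext => t; rewrite /seg subr0 mul1r add0r. Qed.

(* psi is a primitive of phi on the part of the Milnor fibre lying over W. *)
Definition flat (W : CC * CC -> Prop) (psi : pt -> CC) :=
  forall s, path s -> (forall t, 0 <= t <= 1 -> W (s t).1) -> hol s = psi (s 1) - psi (s 0).

Lemma flat_sub (W W' : CC * CC -> Prop) psi : (forall p, W p -> W' p) -> flat W' psi -> flat W psi.
Proof. by move=> h f s ps Ws; apply: f => // t /Ws /h. Qed.

Lemma flat_local s psi : path s ->
  (forall t, 0 <= t <= 1 -> exists2 dl : RR, 0 < dl & exists2 W, flat W psi &
     forall t' : RR, 0 <= t' <= 1 -> `|t' - t| < dl -> W (s t').1) ->
  hol s = psi (s 1) - psi (s 0).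
Proof.
move=> ps loc.
pose P (t : RR) := hol (seg s 0 t) = psi (s t) - psi (s 0).
suff : P 1 by rewrite /P seg01.
apply: unit_induction; last first.
  rewrite /P subrr -(hol_cst (ps.2 0)); apply: hol_eq => t _.
  by rewrite /seg subrr mul0r addr0.
move=> t ht; have [dl dl0 [W fW hW]] := loc t ht.
exists dl => // u v hu hv ut vt; rewrite /P -(hol_seg 0 u v ps) => ->.
have -> : hol (seg s u v) = psi (s v) - psi (s u).
  have e1 : seg s u v 1 = s v by rewrite /seg mulr1 addrC subrK.
  have e0 : seg s u v 0 = s u by rewrite /seg mulr0 addr0.
  rewrite -{1}e1 -e0; apply: fW (path_seg u v ps) _ => c /andP[c0 c1].
  move/andP: hu => [u0 u1]; move/andP: hv => [v0 v1].
  move: ut vt; rewrite !ltr_norml => /andP[ut1 ut2] /andP[vt1 vt2].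
  have E : u + (v - u) * c = (1 - c) * u + c * v by ring.
  have c01 : 0 <= c <= 1 by rewrite c0.
  have h1 : 0 < (1 - c) * (u - t + dl) + c * (v - t + dl) by apply: convex_gt0 => //; lra.
  have h2 : 0 < (1 - c) * (dl - (u - t)) + c * (dl - (v - t)) by apply: convex_gt0 => //; lra.
  rewrite /seg E; apply: hW.
    by apply/andP; split; nra.
  by rewrite ltr_norml; apply/andP; split; lra.
ring.
Qed.

Definition is_lift (f : RR -> CC * CC) q (s : RR -> pt) :=
  [/\ path s, s 0 = q & forall t, 0 <= t <= 1 -> (s t).1 = f t].

(* Constant if f has no lift starting at q. *)
Definition lift f q : RR -> pt :=
  if pselect (exists s, is_lift f q s) is left h then projT1 (cid h) else fun _ => q.

Lemma lift_is_lift f q s : is_lift f q s -> is_lift f q (lift f q).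
Proof.
move=> h; rewrite /lift; case: pselect => [h'|[]]; last by exists s.
by case: (cid h').
Qed.

Lemma lift_eq f q s : is_lift f q s -> forall t, 0 <= t <= 1 -> lift f q t = s t.
Proof.
move=> h; have [p1 e1 l1] := lift_is_lift h; case: h => p2 e2 l2.
by apply: lift_unique => // [t ht|]; rewrite ?l1 ?l2 ?e1 ?e2.
Qed.

Lemma lift_exists (f : RR -> CC * CC) q : cB (fun x => f (clamp x.1)) ->
  (forall t, 0 <= t <= 1 -> inB (f t)) -> f 0 = q.1 -> inF q -> is_lift f q (lift f q).
Proof.
move=> cf Bf f0 Fq.
have F0 : inF (f (clamp 0), q.2) by rewrite clamp0 f0 -surjective_pairing.
have [H [cH FH H1 H2]] := lift_square cf (fun x => Bf _ (clamp01 x.1)) F0.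
apply: (@lift_is_lift _ _ (fun t => H (t, 0))); split.
- by split=> [|t] //; apply: cP_reparam cR_fst (cR_cst 0).
- by rewrite (surjective_pairing (H _)) H1 H2 /= !clamp0 f0 -surjective_pairing.
by move=> t ht; rewrite H1 /= clampK clamp_id.
Qed.

(* An isotopy of the part W of the base that avoids the lines; continuity along
   curves is all that is needed to lift it. *)
Record motion (W : CC * CC -> Prop) (G : CC * CC -> RR -> CC * CC) : Prop := Motion {
  motion0 : forall p, W p -> G p 0 = p;
  motionB : forall p t, W p -> inB p -> 0 <= t <= 1 -> inB (G p t);
  motionC : forall f : RR -> CC * CC, cB (fun x => f x.1) -> (forall t, inB (f t)) ->
    (forall t, W (f t)) -> cB (fun x => G (f x.1) (clamp x.2)) }.

Section Motion.
Variables (W : CC * CC -> Prop) (G : CC * CC -> RR -> CC * CC).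
Hypothesis mG : motion W G.

Definition mlift q := lift (G q.1) q.
Definition mend q := mlift q 1.

Lemma mlift_is_lift q : inF q -> W q.1 -> is_lift (G q.1) q (mlift q).
Proof.
move=> Fq Wq; apply: lift_exists => // [|t ht|].
- have cq : cB (fun _ => q.1) by split; exact: cC_cst.
  have [c1 c2] := motionC mG (f := fun _ => q.1) cq (fun _ => inF_inB Fq) (fun _ => Wq).
  split; [exact: (cC_reparam c1 (cR_cst 0) cR_fst) | exact: (cC_reparam c2 (cR_cst 0) cR_fst)].
- by apply: (motionB mG) => //; exact: inF_inB.
by apply: (motion0 mG).
Qed.

Lemma mend_inF q : inF q -> W q.1 -> inF (mend q).
Proof. by move=> Fq Wq; have [[_ h] _ _] := mlift_is_lift Fq Wq; exact: h. Qed.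

Lemma mend_base q : inF q -> W q.1 -> (mend q).1 = G q.1 1.
Proof. by move=> Fq Wq; have [_ _ h] := mlift_is_lift Fq Wq; rewrite h // ler01 lexx. Qed.

Lemma motion_square s : path s -> (forall t, 0 <= t <= 1 -> W (s t).1) ->
  exists e, [/\ path e, (forall t, 0 <= t <= 1 -> e t = mend (s t)) &
    hol s + hol (mlift (s 1)) = hol (mlift (s 0)) + hol e].
Proof.
move=> ps Ws; have ps' := path_clamp ps.
have Ws' t : W (s (clamp t)).1 by apply: Ws; exact: clamp01.
have Bs' t : inB (s (clamp t)).1 by apply: inF_inB; exact: ps'.2.
have cG := motionC mG (f := fun t => (s (clamp t)).1) ps'.1.1 Bs' Ws'.
have BG x : inB (G (s (clamp x.1)).1 (clamp x.2)).
  by apply: (motionB mG) => //; exact: clamp01.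
have s00 : G (s (clamp 0)).1 (clamp 0) = (s 0).1.
  by rewrite !clamp0 (motion0 mG) //; have := Ws' 0; rewrite clamp0.
have F0 : inF (G (s (clamp 0)).1 (clamp 0), (s 0).2).
  by rewrite s00 -surjective_pairing; exact: ps.2.
have [H [cH FH H1 H2]] := lift_square cG BG F0.
have pH1 u : path (fun t => H (t, u)).
  by split=> [|t] //; apply: cP_reparam cR_fst (cR_cst u).
have pH2 u : path (fun t => H (u, t)).
  by split=> [|t] //; apply: cP_reparam (cR_cst u) cR_fst.
have H00 : H (0, 0) = s 0.
  by rewrite (surjective_pairing (H _)) H1 H2 /clamp2 /= !clampK s00 -surjective_pairing.
have bot : forall t, 0 <= t <= 1 -> H (t, 0) = s t.
  apply: lift_unique => // t ht; rewrite H1 /= !clamp0 (motion0 mG) ?clampK ?clamp_id //.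
  exact: Ws.
have ver t : 0 <= t <= 1 -> forall u, 0 <= u <= 1 -> mlift (s t) u = H (t, u).
  move=> ht; apply: lift_eq; split=> //; first exact: bot.
  by move=> u hu; rewrite H1 /= !clampK !clamp_id.
have i0 : 0 <= (0 : RR) <= 1 by rewrite lexx ler01.
have i1 : 0 <= (1 : RR) <= 1 by rewrite lexx ler01.
exists (fun t => H (t, 1)); split=> //.
  by move=> t ht; rewrite /mend ver.
have := hol_square cH FH.
rewrite (hol_eq (s := fun u => H (u, 0)) (s' := s)) //.
rewrite -(hol_eq (s := mlift (s 1)) (s' := fun u => H (1, u))); last exact: ver.
by rewrite -(hol_eq (s := mlift (s 0)) (s' := fun u => H (0, u))); last exact: ver.
Qed.

Lemma motion_flat W' psi : flat W' psi -> (forall p, W p -> inB p -> W' (G p 1)) ->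
  flat W (fun q => psi (mend q) - hol (mlift q)).
Proof.
move=> fW hW s ps Ws; have [e [pe he E]] := motion_square ps Ws.
have i0 : 0 <= (0 : RR) <= 1 by rewrite lexx ler01.
have i1 : 0 <= (1 : RR) <= 1 by rewrite lexx ler01.
have := fW e pe; rewrite !he // => h.
have {}h : hol e = psi (mend (s 1)) - psi (mend (s 0)).
  apply: h => t ht; rewrite he // mend_base; first (apply: hW; first exact: Ws).
  - by apply: inF_inB; exact: ps.2.
  - exact: ps.2.
  - exact: Ws.
by move/(canRL (addrK _)): E => ->; rewrite h; ring.
Qed.

Lemma motion_loop m : (forall q, inF q -> W q.1 -> mend q = deck m q) ->
  forall s, path s -> (forall t, 0 <= t <= 1 -> W (s t).1) ->
  hol (fun t => deck m (s t)) - hol s = hol (mlift (s 1)) - hol (mlift (s 0)).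
Proof.
move=> hm s ps Ws; have [e [pe he E]] := motion_square ps Ws.
have -> : hol (fun t => deck m (s t)) = hol e.
  by apply: hol_eq => t ht; rewrite he // hm //; [exact: ps.2 | exact: Ws].
by move/(canRL (addKr _)): E => ->; ring.
Qed.

End Motion.
End Cocycle.
End Model.

Local Notation glam := lam.
Local Notation ginF := inF.

Lemma mdB (z w : CC) : md (z - w) <= md z + md w.
Proof. by rewrite -(mdN w); exact: mdD. Qed.

Lemma md_lerB (z w : CC) : md z - md w <= md (z + w).
Proof. by have := mdB (z + w) w; rewrite addrK; lra. Qed.

Lemma exists_pos_min (I : finType) (f : I -> RR) : (forall i, 0 < f i) ->
  exists2 r : RR, 0 < r & forall i, r <= f i.
Proof.
move=> f0; have s0 : 0 <= \sum_i (f i)^-1 by apply: sumr_ge0 => i _; rewrite invr_ge0 ltW.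
exists (1 + \sum_i (f i)^-1)^-1 => [|i]; first by rewrite invr_gt0; lra.
rewrite -[leRHS]invrK lef_pV2 ?posrE ?invr_gt0 //; last by lra.
rewrite (bigD1 i) //= addrCA lerDl addr_ge0 //.
by apply: sumr_ge0 => j _; rewrite invr_ge0 ltW.
Qed.

Lemma exists_max (I : finType) (f : I -> RR) : exists2 r : RR, 0 < r & forall i, `|f i| < r.
Proof.
have s0 : 0 <= \sum_i `|f i| by exact: sumr_ge0.
exists (1 + \sum_i `|f i|) => [|i]; first by lra.
rewrite (bigD1 i) //=.
have : 0 <= \sum_(j | j != i) `|f j| by exact: sumr_ge0.
lra.
Qed.

Lemma exists_avoid (I : finType) (f : I -> RR) : exists t : RR, forall i, f i != t.
Proof.
have [t _ ht] := exists_max f; exists t => i.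
by apply: contraTneq (ht i) => ->; rewrite -leNgt ler_norm.
Qed.

Definition imJ (z w : CC) : RR := im z * re w - re z * im w.

Lemma imJ_scale (z w : CC) (t : RR) : z = t%:C%C * w -> imJ z w = 0.
Proof. by move=> ->; rewrite /imJ reM imM reR imR; cring. Qed.

Lemma generic_dir (I : finType) (z : I -> CC) : (forall i, z i != 0) ->
  exists2 v : CC, v != 0 & forall i, imJ (z i) v != 0.
Proof.
move=> z0; have [t ht] := exists_avoid (fun i => im (z i) / re (z i)).
exists (1 +i* t)%C; first by rewrite eq_complex /= oner_eq0.
move=> i; rewrite /imJ /= mulr1; apply/negP => /eqP h.
case: (eqVneq (re (z i)) 0) => r0.
  move: h (z0 i); rewrite r0 mul0r subr0 => i0.
  by rewrite cc_eq0 r0 i0 expr0n addr0 eqxx.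
by have := ht i; rewrite (subr0_eq h) mulrAC divff ?mul1r ?eqxx.
Qed.

Section Lefschetz.
Variables (n : nat) (a b : 'I_n -> CC).
Variable phi : (RR -> pt) -> CC.
Local Notation inB := (inB a b).
Local Notation inF := (inF a b).
Local Notation path := (path a b).
Local Notation lam := (lam a b).
Local Notation flat := (flat a b phi).
Local Notation hol := (hol phi).
Local Notation is_lift := (is_lift a b).
Local Notation lift := (lift a b).
Local Notation mlift := (mlift a b).
Local Notation mend := (mend a b).
Hypothesis phi_cocycle : forall s, splx2 a b s -> phi (gface0 s) - phi (gface1 s) + phi (gface2 s) = 0.
Hypothesis lines_distinct : forall i j, i != j -> a i = a j -> b i != b j.

Lemma I0 : 0 <= (0 : RR) <= 1. Proof. by rewrite lexx ler01. Qed.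
Lemma I1 : 0 <= (1 : RR) <= 1. Proof. by rewrite lexx ler01. Qed.

Lemma flat_lift W psi f q s : flat W psi -> is_lift f q s ->
  (forall t, 0 <= t <= 1 -> W (f t)) -> hol s = psi (s 1) - psi q.
Proof.
move=> fW [ps s0 sf] Wf; rewrite -s0; apply: fW => // t ht.
by rewrite sf //; exact: Wf.
Qed.

Lemma lift_inF f q s t : is_lift f q s -> inF (s t).
Proof. by case=> [[_ h] _ _]; exact: h. Qed.

Lemma flat_ext W psi psi' : flat W psi -> (forall q, inF q -> W q.1 -> psi q = psi' q) -> flat W psi'.
Proof.
move=> fW e s ps Ws; rewrite -!e; first exact: fW.
- exact: ps.2.
- exact: Ws I0.
- exact: ps.2.
- exact: Ws I1.
Qed.

Definition lin (p v : CC * CC) (t : RR) : CC * CC := (p.1 + t%:C%C * v.1, p.2 + t%:C%C * v.2).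

Lemma cB_lin p v (u : RR * RR -> RR) : cR u -> cB (fun x => lin p v (u x)).
Proof.
by move=> cu; split; apply: cC_add (cC_cst _) _; apply: cC_mul (cC_cst _); exact: cC_real.
Qed.

Lemma lin0 p v : lin p v 0 = p.
Proof. by rewrite /lin !mul0r !addr0; case: p. Qed.

Lemma lin_lift q v : inF q -> (forall t, 0 <= t <= 1 -> inB (lin q.1 v t)) ->
  is_lift (lin q.1 v) q (lift (lin q.1 v) q).
Proof.
move=> Fq hB; apply: lift_exists => //; last exact: lin0.
by apply: cB_lin; apply: cR_clamp; exact: cR_fst.
Qed.

Definition box (p : CC * CC) (r : RR) (p' : CC * CC) := md (p'.1 - p.1) < r /\ md (p'.2 - p.2) < r.

Lemma inB_box p : inB p -> exists2 r : RR, 0 < r & forall p', box p r p' -> inB p'.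
Proof.
move=> Bp; have [r r0 hr] := exists_pos_min (f := fun i => md (lam i p) / (1 + md (a i)))
  (fun i => divr_gt0 (etrans (md_gt0 _) (Bp i)) (ltr_wpDr (md_ge0 _) ltr01)).
exists r => // p' [h1 h2] i.
have ai : 0 < 1 + md (a i) by have := md_ge0 (a i); lra.
have hi : r * (1 + md (a i)) <= md (lam i p) by rewrite -ler_pdivlMr.
rewrite -md_gt0.
have -> : lam i p' = lam i p + ((p'.2 - p.2) - a i * (p'.1 - p.1)) by rewrite /lam; ring.
apply: lt_le_trans (md_lerB _ _); rewrite subr_gt0; apply: lt_le_trans hi.
apply: le_lt_trans (mdB _ _) _; rewrite mdM.
have : md (a i) * md (p'.1 - p.1) <= md (a i) * r by rewrite ler_wpM2l ?md_ge0 // ltW.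
lra.
Qed.

Definition yv i x : CC := a i * x + b i.
Definition generic x := forall i j, i != j -> yv i x != yv j x.
Definition fib (x : CC) (p : CC * CC) := p.1 = x.

Lemma lamE i p : lam i p = p.2 - yv i p.1.
Proof. by rewrite /lam /yv opprD addrA. Qed.

Variable (x0 : CC) (psi0 : pt -> CC).
Hypothesis x0_generic : generic x0.
Hypothesis flat0 : flat (fib x0) psi0.

Let KK : exists2 K : RR, 0 < K & forall i, md (a i) < K /\ md (b i) < K.
Proof.
have [r r0 hr] := exists_max (fun i => md (a i)); have [s s0 hs] := exists_max (fun i => md (b i)).
exists (r + s) => [|i]; first by lra.
by have := hr i; have := hs i; rewrite !ger0_norm ?md_ge0 //; lra.
Qed.

Definition topr (K : RR) (p : CC * CC) := K * (1 + md p.1) < md p.2.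

Lemma topr_inB K p : 0 < K -> (forall i, md (a i) < K /\ md (b i) < K) -> topr K p -> inB p.
Proof.
move=> K0 hK tp i; rewrite lamE -md_gt0.
have [ha hb] := hK i; have := mdD (a i * p.1) (b i); rewrite mdM -/(yv i p.1) => h1.
have h2 : md (a i) * md p.1 <= K * md p.1 by rewrite ler_wpM2r ?md_ge0 // ltW.
have := md_lerB p.2 (- yv i p.1); rewrite mdN.
by move: tp; rewrite /topr mulrDr mulr1; lra.
Qed.

Definition topG (p : CC * CC) (t : RR) : CC * CC :=
  ((1 - t)%:C%C * p.1 + t%:C%C * x0, (1 + t * md x0)%:C%C * p.2).

Lemma topG_top K p t : 0 < K -> topr K p -> 0 <= t <= 1 -> topr K (topG p t).
Proof.
move=> K0 tp /andP[t0 t1]; rewrite /topr /topG /=.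
have m0 := md_ge0 x0; have m1 := md_ge0 p.1.
rewrite mdM mdR ger0_norm; last by rewrite addr_ge0 ?mulr_ge0.
apply: (@le_lt_trans _ _ (K * (1 + (md p.1 + t * md x0)))).
  rewrite ler_pM2l // lerD2l; apply: le_trans (mdD _ _) _; rewrite !mdM !mdR.
  rewrite !ger0_norm ?subr_ge0 // lerD2r ler_piMl //; lra.
move: tp; rewrite /topr => tp.
have h : 0 < 1 + t * md x0 by have := mulr_ge0 t0 m0; lra.
apply: le_lt_trans (_ : _ <= (1 + t * md x0) * (K * (1 + md p.1))) _; last by rewrite ltr_pM2l.
rewrite mulrCA ler_pM2l //.
have := mulr_ge0 (mulr_ge0 t0 m0) m1; lra.
Qed.

Lemma top_motion K : 0 < K -> (forall i, md (a i) < K /\ md (b i) < K) -> motion a b (topr K) topG.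
Proof.
move=> K0 hK; split.
- by move=> p _; rewrite /topG subr0 mul1r !mul0r !addr0 mul1r; case: p.
- by move=> p t tp _ ht; apply: (topr_inB K0 hK); exact: topG_top.
move=> f [c1 c2] _ _; have cc : cR (fun x => clamp x.2) by apply: cR_clamp; exact: cR_snd.
split.
  apply: cC_add; last by apply: cC_mul (cC_cst _); exact: cC_real.
  by apply: cC_mul => //; apply: cC_real; apply: cR_sub (cR_cst _) _.
by apply: cC_mul => //; apply: cC_real; apply: cR_add (cR_cst _) _; apply: cR_mul (cR_cst _).
Qed.

Let psitop q := psi0 (mend topG q) - hol (mlift topG q).

Lemma flat_top K : 0 < K -> (forall i, md (a i) < K /\ md (b i) < K) -> flat (topr K) psitop.
Proof.
move=> K0 hK; apply: (motion_flat phi_cocycle (top_motion K0 hK) flat0) => p _ _.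
by rewrite /fib /topG /= subrr mul0r add0r mul1r.
Qed.

Lemma psitop_fib K q : 0 < K -> (forall i, md (a i) < K /\ md (b i) < K) -> inF q ->
  topr K q.1 -> q.1.1 = x0 -> psitop q = psi0 q.
Proof.
move=> K0 hK Fq tq qx.
have L := mlift_is_lift (top_motion K0 hK) Fq tq.
rewrite /psitop (flat_lift flat0 L); first by rewrite /mend; ring.
move=> t _; rewrite /fib /topG /= qx -mulrDl -rmorphD /= subrK mul1r //.
Qed.

Definition good x psi := flat (fib x) psi /\
  exists R : RR, forall q, inF q -> q.1.1 = x -> R < md q.1.2 -> psi q = psitop q.

Lemma good_unique x psi psi' q : good x psi -> good x psi' -> inF q -> q.1.1 = x -> psi q = psi' q.
Proof.
move=> [f1 [R1 h1]] [f2 [R2 h2]] Fq qx.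
have z0 i : yv i x - q.1.2 != 0.
  by have := inF_inB Fq i; rewrite lamE qx subr_eq0 eq_sym -subr_eq0.
have [v v0 hv] := generic_dir z0.
pose M := (`|R1| + `|R2| + md q.1.2 + 1) / md v.
have mv : 0 < md v by rewrite md_gt0.
have L := @lin_lift q (0, M%:C%C * v) Fq.
have {}L := L _; have {}L : is_lift (lin q.1 (0, M%:C%C * v)) q (lift (lin q.1 (0, M%:C%C * v)) q).
  apply: L => t ht i; rewrite lamE /lin /= mulr0 addr0 qx; apply/negP => /eqP h.
  have /eqP := hv i; apply; apply: (@imJ_scale _ _ (t * M)).
  by rewrite rmorphM /= -mulrA; move/subr0_eq: h => <-; rewrite addrAC subrr add0r.
set s := lift _ _ in L.
have Ws t : 0 <= t <= 1 -> fib x (lin q.1 (0, M%:C%C * v) t).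
  by move=> _; rewrite /fib /= mulr0 addr0.
have e1 := flat_lift f1 L Ws; have e2 := flat_lift f2 L Ws.
have [ps s0 sl] := L.
have big R : R <= `|R1| + `|R2| -> R < md (s 1).1.2.
  move=> hR; rewrite sl ?I1 // /= mul1r addrC; apply: lt_le_trans (md_lerB _ _).
  by rewrite mdM mdR ger0_norm /M ?divfK ?gt_eqF //; last (apply: divr_ge0); have := md_ge0 q.1.2;
    have := normr_ge0 R1; have := normr_ge0 R2; lra.
have x1 : (s 1).1.1 = x by rewrite sl ?I1 //= mulr0 addr0.
have r1 := ler_norm R1; have r2 := ler_norm R2.
have n1 := normr_ge0 R1; have n2 := normr_ge0 R2.
have k1 : psi (s 1) = psitop (s 1) by apply: h1 => //; [exact: ps.2 | apply: big; lra].
have k2 : psi' (s 1) = psitop (s 1) by apply: h2 => //; [exact: ps.2 | apply: big; lra].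
by move: e1 e2; rewrite k1 k2 => -> /addrI /oppr_inj.
Qed.

Lemma md_sum (I : finType) (f : I -> CC) : md (\sum_i f i) <= \sum_i md (f i).
Proof.
apply: (big_ind2 (fun x y => md x <= y)); first by rewrite md0.
  by move=> x1 x2 y1 y2 h1 h2; apply: le_trans (mdD _ _) (lerD h1 h2).
by move=> i _.
Qed.

Section Isotopy.
Variables (x1 x2 : CC) (rho A dl : RR).
Hypothesis rho0 : 0 < rho.
Hypothesis A0 : 0 < A.
Hypothesis hA : forall i, md (a i) < A.
Hypothesis sep : forall i j, i != j -> 8 * rho <= md (yv i x1 - yv j x1).
Hypothesis hdl : 2 * dl * (n.+1%:R * A) <= rho / 2.
Hypothesis hx2 : md (x2 - x1) < dl.

Definition bump i p : RR := clamp (2 - md (lam i p) / rho).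
(* Near the i-th line the drift equals a i, so that moving the abscissa while
   following the drift preserves the value of the i-th linear form. *)
Definition drift p : CC := \sum_i (bump i p)%:C%C * a i.
Definition isoG (p : CC * CC) (t : RR) : CC * CC :=
  (p.1 + t%:C%C * (x2 - p.1), p.2 + t%:C%C * ((x2 - p.1) * drift p)).

Lemma md_drift p : md (drift p) <= n%:R * A.
Proof.
apply: le_trans (md_sum _) _; rewrite -[n in leRHS]card_ord -sum1_card natr_sum mulr_suml.
apply: ler_sum => i _; rewrite mdM mdR mul1r.
have /andP[b0 b1] := clamp01 (2 - md (lam i p) / rho).
have := ler_wpM2r (md_ge0 (a i)) b1; rewrite mul1r ger0_norm //.
have := hA i; rewrite -/(bump i p); lra.
Qed.

Lemma hdl0 : 0 < dl. Proof. by apply: le_lt_trans hx2; exact: md_ge0. Qed.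

Lemma hAdl : A * dl <= rho / 4.
Proof.
have n1 : 1 <= n.+1%:R :> RR by rewrite ler1n.
have h := mulr_gt0 A0 hdl0.
have : 1 * (A * dl) <= n.+1%:R * (A * dl) by rewrite ler_pM2r.
by move: hdl; rewrite mulrCA -mulrA [2 * (_ * _)]mulrC; nra.
Qed.

Lemma yv_sep i j (p : CC * CC) : md (p.1 - x1) < dl -> i != j -> 8 * rho - rho / 2 <= md (yv i p.1 - yv j p.1).
Proof.
move=> hp ij.
have -> : yv i p.1 - yv j p.1 = (yv i x1 - yv j x1) + (a i - a j) * (p.1 - x1) by rewrite /yv; ring.
apply: le_trans (md_lerB _ _); apply: lerB (sep ij) _.
rewrite mdM; have h1 := mdB (a i) (a j).
have h2 : md (a i - a j) <= 2 * A by have := hA i; have := hA j; lra.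
apply: (@le_trans _ _ (2 * A * dl)); first by rewrite ler_pM ?md_ge0 // ltW.
by have := hAdl; lra.
Qed.

Lemma drift_near i (p : CC * CC) : md (p.1 - x1) < dl -> md (lam i p) < rho -> drift p = a i.
Proof.
move=> hp hi; rewrite /drift (bigD1 i) //= big1 => [|j ji]; last first.
  have h := yv_sep hp ji; have E : lam j p = lam i p - (yv j p.1 - yv i p.1) by rewrite !lamE; ring.
  have h2 : 2 * rho <= md (lam j p).
    rewrite E mdBC; apply: le_trans (md_lerB _ _); rewrite mdN; apply: le_trans (lerB h (ltW hi)).
    by have r0 := rho0; lra.
  rewrite /bump /clamp max_r; first by rewrite min_l ?ler01 // mul0r.
  by rewrite subr_le0 ler_pdivlMr.
rewrite addr0 /bump /clamp min_r ?mul1r // le_max; apply/orP; left.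
by rewrite lerBrDr -lerBrDl ler_pdivrMr //; lra.
Qed.

Lemma md_shift (p : CC * CC) t : md (p.1 - x1) < dl -> 0 <= t <= 1 -> md (t%:C%C * (x2 - p.1)) <= 2 * dl.
Proof.
move=> hp /andP[t0 t1]; rewrite mdM mdR ger0_norm //.
have h : md (x2 - p.1) <= 2 * dl.
  have -> : x2 - p.1 = (x2 - x1) - (p.1 - x1) by ring.
  by have := mdB (x2 - x1) (p.1 - x1); have h2 := hx2; lra.
by apply: le_trans h; rewrite ler_piMl // md_ge0.
Qed.

Lemma isoG_inB (p : CC * CC) t : md (p.1 - x1) < dl -> inB p -> 0 <= t <= 1 -> inB (isoG p t).
Proof.
move=> hp Bp ht i.
have E : lam i (isoG p t) = lam i p + t%:C%C * (x2 - p.1) * (drift p - a i).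
  by rewrite /glam /isoG /=; ring.
case: (ltP (md (lam i p)) rho) => hi; first by rewrite E (drift_near hp hi) subrr mulr0 addr0.
rewrite -md_gt0 E; apply: lt_le_trans (md_lerB _ _); rewrite subr_gt0; apply: lt_le_trans hi.
rewrite mdM; apply: (@le_lt_trans _ _ (2 * dl * (n.+1%:R * A))); last by have := rho0; have := hdl; lra.
apply: ler_pM; rewrite ?md_ge0 //; first exact: md_shift.
apply: le_trans (mdB _ _) _; have := md_drift p; have := hA i; rewrite -natr1 mulrDl mul1r; lra.
Qed.

Lemma isoG_motion : motion a b (fun p : CC * CC => md (p.1 - x1) < dl) isoG.
Proof.
split.
- by move=> p _; rewrite /isoG !mul0r !addr0; case: p.
- by move=> p t hp Bp ht; exact: isoG_inB.
move=> f cf _ _; have [c1 c2] := cf.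
have c1' : cC (fun x => x2 - (f x.1).1) by apply: cC_sub (cC_cst _) _.
have cc : cC (fun x => (clamp x.2)%:C%C) by apply: cC_real; apply: cR_clamp; exact: cR_snd.
split; first by apply: cC_add => //; exact: cC_mul.
apply: cC_add => //; apply: cC_mul => //; apply: cC_mul => //.
apply: cC_sum => i; apply: cC_mul (cC_cst _); apply: cC_real; apply: cR_clamp.
apply: cR_sub (cR_cst _) _; apply: cR_mul (cR_cst _); apply: cR_md; exact: cC_lam.
Qed.

Lemma isotopy_good psi : good x2 psi ->
  exists psi', flat (fun p : CC * CC => md (p.1 - x1) < dl) psi' /\
    forall x, md (x - x1) < dl -> good x psi'.
Proof.
move=> [f2 [R hR]].
pose psi' q := psi (mend isoG q) - hol (mlift isoG q).
have fl : flat (fun p : CC * CC => md (p.1 - x1) < dl) psi'.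
  apply: (motion_flat phi_cocycle isoG_motion f2) => p _ _.
  by rewrite /fib /isoG /= mul1r addrC subrK.
exists psi'; split=> // x hx; split.
  by apply: flat_sub fl => p ->.
have [K K0 hK] := KK.
exists (K * (1 + md x1 + 3 * dl) + rho + `|R|) => q Fq qx hq.
have hq1 : md (q.1.1 - x1) < dl by rewrite qx.
have L := mlift_is_lift isoG_motion Fq hq1.
have dn : 2 * dl * (n%:R * A) <= rho / 2.
  apply: le_trans hdl; rewrite ler_wpM2l //; first by have := hdl0; lra.
  by rewrite ler_pM2r // ler_nat.
have low t : 0 <= t <= 1 -> md q.1.2 - rho <= md (isoG q.1 t).2.
  move=> ht; apply: le_trans (md_lerB _ _); rewrite lerD2l lerN2 mulrA mdM.
  apply: (@le_trans _ _ (2 * dl * (n%:R * A))); last by have := rho0; lra.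
  by apply: ler_pM; rewrite ?md_ge0 //; [exact: md_shift | exact: md_drift].
have Rn := normr_ge0 R.
have hol_top : hol (mlift isoG q) = psitop (mend isoG q) - psitop q.
  apply: (flat_lift (flat_top K0 hK) L) => t ht.
  apply: (@le_lt_trans _ _ (K * (1 + (md x1 + 3 * dl)))); last by have := low t ht; have := rho0; lra.
  rewrite ler_pM2l // lerD2l /isoG /=.
  apply: le_trans (mdD _ _) _; have := md_shift hq1 ht.
  have -> : q.1.1 = x1 + (q.1.1 - x1) by ring.
  have := mdD x1 (q.1.1 - x1); rewrite -[X in md (_ * (x2 - X))](addrC (q.1.1 - x1)) subrK; lra.
rewrite /psi' hol_top hR; first by ring.
- exact: (mend_inF isoG_motion).
- by rewrite (mend_base isoG_motion) //= mul1r addrC subrK.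
rewrite (mend_base isoG_motion) //; apply: lt_le_trans (low 1 I1).
have := ler_norm R; have h1 := md_ge0 x1; have h2 := hdl0.
have : 0 <= K * (1 + md x1 + 3 * dl) by apply: mulr_ge0; lra.
lra.
Qed.

End Isotopy.

Lemma good_local x1 : generic x1 -> exists2 dl : RR, 0 < dl &
  forall x2 psi, md (x2 - x1) < dl -> good x2 psi ->
  exists psi', flat (fun p : CC * CC => md (p.1 - x1) < dl) psi' /\
    forall x, md (x - x1) < dl -> good x psi'.
Proof.
move=> gx1; have [K K0 hK] := KK.
have [[i j] /=|rho rho0 hrho] := @exists_pos_min ('I_n * 'I_n)%type
  (fun ij => if ij.1 == ij.2 then 1 else md (yv ij.1 x1 - yv ij.2 x1) / 8).
  by case: ifP => // /negbT ij; rewrite divr_gt0 // md_gt0 subr_eq0 gx1.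
exists (rho / (4 * (n.+1%:R * K))).
  by rewrite divr_gt0 // !mulr_gt0 // ltr0n.
have n1 : n.+1%:R * K != 0 by rewrite mulf_neq0 ?pnatr_eq0 // gt_eqF.
move=> x2 psi hx2; apply: (isotopy_good rho0 K0 (fun i => (hK i).1) _ _ hx2).
  by move=> i j ij; have := hrho (i, j); rewrite /= (negbTE ij); lra.
rewrite le_eqVlt; apply/orP; left; apply/eqP.
by move: n1; set z := _ * K => n1; field.
Qed.

Definition gd x := exists psi, good x psi.

Lemma gd_segment x v : (forall t : RR, 0 <= t <= 1 -> generic (x + t%:C%C * v)) -> gd x -> gd (x + v).
Proof.
move=> gen gx.
pose P (t : RR) := gd (x + t%:C%C * v).
suff : P 1 by rewrite /P mul1r.
apply: unit_induction; last by rewrite /P mul0r addr0.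
move=> t ht; have [dl dl0 H] := good_local (gen t ht).
have v1 : 0 < md v + 1 by have := md_ge0 v; lra.
exists (dl / (md v + 1)); first by rewrite divr_gt0.
have near (s : RR) : `|s - t| < dl / (md v + 1) -> md (x + s%:C%C * v - (x + t%:C%C * v)) < dl.
  have -> : x + s%:C%C * v - (x + t%:C%C * v) = (s - t)%:C%C * v by rewrite rmorphB /=; ring.
  rewrite mdM mdR ltr_pdivlMr // mulrDr mulr1.
  by have := normr_ge0 (s - t); lra.
move=> s s' _ _ hs hs' [psi gs].
have [psi' [_ h]] := H _ _ (near s hs) gs.
by exists psi'; apply: h; exact: near.
Qed.

Lemma generic_seg x v : (forall i j, i != j -> a i != a j ->
    forall t : RR, 0 <= t <= 1 -> (b j - b i) / (a i - a j) != x + t%:C%C * v) ->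
  forall t : RR, 0 <= t <= 1 -> generic (x + t%:C%C * v).
Proof.
move=> H t ht i j ij; apply/negP => /eqP h.
have E : (a i - a j) * (x + t%:C%C * v) = b j - b i.
  by move: h; rewrite /yv => h; apply: (addIr (b i)); rewrite mulrBl addrAC h; ring.
case: (eqVneq (a i) (a j)) => aij.
  have := lines_distinct ij aij; move: E; rewrite aij subrr mul0r => /esym/subr0_eq ->.
  by rewrite eqxx.
have := H i j ij aij t ht; rewrite -E mulrAC divff ?mul1r ?eqxx //.
by rewrite subr_eq0.
Qed.

Lemma gd_x0 : gd x0.
Proof.
exists psi0; split=> //; have [K K0 hK] := KK.
exists (K * (1 + md x0)) => q Fq qx hq.
by rewrite (psitop_fib K0 hK Fq) // /topr qx.
Qed.

Lemma gd_generic x : generic x -> gd x.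
Proof.
move=> gx.
pose e (ij : 'I_n * 'I_n) := (b ij.2 - b ij.1) / (a ij.1 - a ij.2).
have gen_e y i j : generic y -> i != j -> a i != a j -> e (i, j) != y.
  move=> gy ij aij; apply: contra (gy i j ij) => /eqP <-; apply/eqP.
  by rewrite /yv /e /=; field; rewrite subr_eq0.
pose z (k : 'I_n * 'I_n * bool) : CC :=
  let w := if k.2 then x else x0 in
  if (k.1.1 != k.1.2) && (a k.1.1 != a k.1.2) then e k.1 - w else 1.
have [[[i j] c]|v v0 hv] := @generic_dir _ z.
  rewrite /z /=; case: ifP => [/andP[ij aij]|_]; last exact: oner_neq0.
  by rewrite subr_eq0; case: c; apply: gen_e.
pose f (ij : 'I_n * 'I_n) : RR := imJ (e ij - x) (x0 - x) / - imJ (e ij - x) v.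
have [T hT] := exists_avoid f.
have h1 : gd (x0 + T%:C%C * v).
  apply: gd_segment gd_x0; apply: generic_seg => i j ij aij t ht; apply/negP => /eqP h.
  have := hv ((i, j), false); rewrite /z /= ij aij /=; apply/negP; rewrite negbK; apply/eqP.
  by apply: (@imJ_scale _ _ (t * T)); rewrite /e /= h rmorphM /=; ring.
have -> : x = (x0 + T%:C%C * v) + (x - (x0 + T%:C%C * v)) by ring.
apply: gd_segment h1; apply: generic_seg => i j ij aij t ht; apply/negP => /eqP h.
have hij := hv ((i, j), true); rewrite /z /= ij aij /= in hij.
have E : e (i, j) - x = (1 - t)%:C%C * (x0 - x + T%:C%C * v).
  by rewrite /e /= h rmorphB /=; ring.
have /eqP := hT (i, j); apply; rewrite /f.
have := imJ_scale E.
have -> : imJ (e (i, j) - x) (x0 - x + T%:C%C * v) = imJ (e (i, j) - x) (x0 - x) + T * imJ (e (i, j) - x) v.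
  by rewrite /imJ !(reD, imD, reM, imM, reR, imR); cring.
by move=> h2; apply: (mulIf (x := - imJ (e (i, j) - x) v)); rewrite ?oppr_eq0 // divfK ?oppr_eq0 //; lra.
Qed.

Definition psig (q : pt) : CC :=
  if pselect (gd q.1.1) is left h then projT1 (cid h) q else 0.

Lemma psigE x psi q : good x psi -> inF q -> q.1.1 = x -> psig q = psi q.
Proof.
move=> g Fq qx; rewrite /psig; case: pselect => [h|[]]; last by exists psi; rewrite qx.
by case: (cid h) => psi' /= g'; apply: good_unique g' _ Fq _ => //; rewrite qx.
Qed.

Lemma flat_psig_disc x1 : generic x1 -> exists2 dl : RR, 0 < dl &
  flat (fun p : CC * CC => md (p.1 - x1) < dl) psig.
Proof.
move=> gx1; have [dl dl0 H] := good_local gx1; exists dl => //.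
have [psi g] := gd_generic gx1.
have [|psi' [f' h']] := H x1 psi _ g; first by rewrite subrr md0.
by apply: flat_ext f' _ => q Fq hq; rewrite (psigE (h' _ hq) Fq).
Qed.

Lemma path_close (s : RR -> pt) t (e : RR) : path s -> 0 < e -> exists2 dl : RR, 0 < dl &
  forall t' : RR, `|t' - t| < dl -> md ((s t').1.1 - (s t).1.1) < e /\ md ((s t').1.2 - (s t).1.2) < e.
Proof.
move=> [[[c1 c2] _] _] e0; have [d1 d10 h1] := cC_md_close (t, 0) c1 e0.
have [d2 d20 h2] := cC_md_close (t, 0) c2 e0.
exists (Num.min d1 d2); first by rewrite lt_min d10.
move=> t'; rewrite lt_min => /andP[k1 k2]; split.
  by apply: (h1 (t', 0)); rewrite //= subrr normr0.
by apply: (h2 (t', 0)); rewrite //= subrr normr0.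
Qed.

Lemma flat_psig : flat (fun p => generic p.1) psig.
Proof.
move=> s ps gs; apply: (flat_local phi_cocycle ps) => t ht.
have [dl dl0 fl] := flat_psig_disc (gs t ht).
have [d d0 hd] := path_close t ps dl0.
exists d => //; exists (fun p : CC * CC => md (p.1 - (s t).1.1) < dl) => // t' _ /hd[] //.
Qed.

Lemma isolated x1 : exists2 r : RR, 0 < r & forall x, md (x - x1) < r -> x != x1 -> generic x.
Proof.
have [[i j] /=|r r0 hr] := @exists_pos_min ('I_n * 'I_n)%type (fun ij =>
  if yv ij.1 x1 == yv ij.2 x1 then 1 else md (yv ij.1 x1 - yv ij.2 x1) / (1 + md (a ij.1 - a ij.2))).
  case: ifP => // /negbT ij; apply: divr_gt0; first by rewrite md_gt0 subr_eq0.
  by have := md_ge0 (a i - a j); lra.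
exists r => // x hx xn i j ij.
have E : yv i x - yv j x = yv i x1 - yv j x1 + (a i - a j) * (x - x1) by rewrite /yv; ring.
rewrite -subr_eq0 E; have := hr (i, j) => /=; case: eqVneq => [e _|e].
  rewrite e subrr add0r mulf_neq0 ?subr_eq0 //; apply/negP => /eqP aij.
  have := lines_distinct ij aij; move: e; rewrite /yv aij => /addrI ->.
  by rewrite eqxx.
have m0 := md_ge0 (a i - a j).
rewrite ler_pdivlMr; last by lra.
move=> h; rewrite -md_gt0; apply: lt_le_trans (md_lerB _ _); rewrite subr_gt0.
apply: lt_le_trans h; rewrite mdM.
have : md (a i - a j) * md (x - x1) <= md (a i - a j) * r by rewrite ler_wpM2l // ltW.
by have := r0; lra.
Qed.

Lemma fill p1 : inB p1 -> exists r : RR, exists psi, [/\ 0 < r,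
  (forall p, box p1 r p -> inB p),
  (forall x, md (x - p1.1) < r -> x != p1.1 -> generic x),
  flat (box p1 r) psi &
  forall q, inF q -> box p1 r q.1 -> generic q.1.1 -> psi q = psig q].
Proof.
move=> Bp1; have [r1 r10 h1] := inB_box Bp1; have [r2 r20 h2] := isolated p1.1.
pose r := Num.min r1 r2.
have r0 : 0 < r by rewrite lt_min r10.
have rr1 : r <= r1 by rewrite ge_min lexx.
have rr2 : r <= r2 by rewrite ge_min lexx orbT.
have Bbox p : box p1 r p -> inB p by move=> [k1 k2]; apply: h1; split; lra.
have gbox x : md (x - p1.1) < r -> x != p1.1 -> generic x by move=> k; apply: h2; lra.
case: (pselect (generic p1.1)) => [g1|g1].
  exists r, psig; split=> //; apply: flat_sub flat_psig => p [k1 _].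
  by case: (eqVneq p.1 p1.1) => [->|]; last exact: gbox.
pose ps : CC * CC := (p1.1 + (r / 2)%:C%C, p1.2).
have r20' : 0 < r / 2 by lra.
have box_ps : box p1 r ps.
  split; rewrite /ps /=; last by rewrite subrr md0.
  by rewrite addrC addKr mdR ger0_norm; lra.
have box_lin p p' t : box p1 r p -> box p1 r p' -> 0 <= t <= 1 ->
    box p1 r (lin p (p'.1 - p.1, p'.2 - p.2) t).
  move=> [k1 k2] [k3 k4] ht; have /andP[t0 t1] := ht; split=> /=.
    have -> : p.1 + t%:C%C * (p'.1 - p.1) - p1.1 = (1 - t)%:C%C * (p.1 - p1.1) + t%:C%C * (p'.1 - p1.1).
      by rewrite rmorphB /=; ring.
    apply: le_lt_trans (mdD _ _) _; rewrite !mdM !mdR !ger0_norm ?subr_ge0 // -subr_gt0.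
    have -> : r - ((1 - t) * md (p.1 - p1.1) + t * md (p'.1 - p1.1)) =
      (1 - t) * (r - md (p.1 - p1.1)) + t * (r - md (p'.1 - p1.1)) by cring.
    by apply: convex_gt0; rewrite ?subr_gt0.
  have -> : p.2 + t%:C%C * (p'.2 - p.2) - p1.2 = (1 - t)%:C%C * (p.2 - p1.2) + t%:C%C * (p'.2 - p1.2).
    by rewrite rmorphB /=; ring.
  apply: le_lt_trans (mdD _ _) _; rewrite !mdM !mdR !ger0_norm ?subr_ge0 // -subr_gt0.
  have -> : r - ((1 - t) * md (p.2 - p1.2) + t * md (p'.2 - p1.2)) =
    (1 - t) * (r - md (p.2 - p1.2)) + t * (r - md (p'.2 - p1.2)) by cring.
  by apply: convex_gt0; rewrite ?subr_gt0.
pose G p := lin p (ps.1 - p.1, ps.2 - p.2).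
have mG : motion a b (box p1 r) G.
  split.
  - by move=> p _; exact: lin0.
  - by move=> p t bp _ ht; apply: Bbox; exact: box_lin.
  move=> f [c1 c2] _ _; have cc : cC (fun x => (clamp x.2)%:C%C).
    by apply: cC_real; apply: cR_clamp; exact: cR_snd.
  by split; apply: cC_add => //; apply: cC_mul => //; apply: cC_sub (cC_cst _) _.
have ps_gen : generic ps.1.
  apply: gbox; first by case: box_ps.
  by rewrite /ps /= -subr_eq0 addrC addKr eq_complex /= eqxx andbT gt_eqF.
have G1 p : G p 1 = ps by rewrite /G /lin /= !mul1r ![_ + (_ - _)]addrC !subrK.
pose psi q := psig (mend G q) - hol (mlift G q).
have fpsi : flat (box p1 r) psi.
  by apply: (motion_flat phi_cocycle mG flat_psig) => p _ _; rewrite G1.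
exists r, psi; split=> // q Fq bq gq.
(* if the segment from x to the centre of the disc at ps meets p1.1, detour *)
have direct q' : inF q' -> box p1 r q'.1 ->
    (forall t : RR, 0 <= t <= 1 -> q'.1.1 + t%:C%C * (ps.1 - q'.1.1) != p1.1) -> psi q' = psig q'.
  move=> Fq' bq' hq'; have L := mlift_is_lift mG Fq' bq'.
  have /= := flat_lift flat_psig L; rewrite -/(mend G q') => e.
  rewrite /psi e; first by ring.
  move=> t ht; apply: gbox; last exact: hq'.
  by have [] := box_lin q'.1 ps t bq' box_ps ht.
case: (pselect (forall t : RR, 0 <= t <= 1 -> q.1.1 + t%:C%C * (ps.1 - q.1.1) != p1.1)) => [|hq].
  exact: direct.
have qx : q.1.1 != p1.1 by apply/negP => /eqP e; apply: g1; rewrite -e.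
have [t0 [/andP[t00 t01] ht0]] : exists t0 : RR, 0 <= t0 <= 1 /\ q.1.1 + t0%:C%C * (ps.1 - q.1.1) = p1.1.
  apply: contrapT => h; apply: hq => t ht; apply/negP => /eqP e.
  by apply: h; exists t.
have E0 : (1 - t0)%:C%C * (q.1.1 - p1.1) = (- (t0 * (r / 2)))%:C%C.
  apply/eqP; rewrite -subr_eq0; apply/eqP; transitivity (q.1.1 + t0%:C%C * (ps.1 - q.1.1) - p1.1).
    by rewrite rmorphN rmorphB rmorphM /ps /=; set R2 := (r / 2)%:C%C; ring.
  by rewrite ht0 subrr.
have t0n : 0 < 1 - t0.
  rewrite lt_def subr_ge0 t01 andbT; apply/negP => /eqP h.
  move: E0; rewrite h mul0r => /(congr1 re) /=; have -> : t0 = 1 by lra.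
  by lra.
pose c : RR := t0 * (r / 2) / (1 - t0).
have E1 : q.1.1 - p1.1 = (- c)%:C%C.
  have t0n' : (1 - t0)%:C%C != 0 :> CC by rewrite eq_complex /= eqxx andbT gt_eqF.
  apply: (mulfI t0n'); rewrite E0 -rmorphM; congr _%:C%C; rewrite /c; field.
  by rewrite gt_eqF.
have c_ge0 : 0 <= c by apply: divr_ge0; [apply: mulr_ge0 => //; exact: ltW | exact: ltW].
clearbody c.
have c0 : 0 < c.
  rewrite lt_def c_ge0 andbT; apply/negP => /eqP h; move: qx.
  by rewrite -subr_eq0 E1 h oppr0 eqxx.
have cr : c < r by case: bq => k _; move: k; rewrite E1 mdR normrN ger0_norm.
have Ex : q.1.1 = p1.1 - c%:C%C by rewrite -(subrK p1.1 q.1.1) E1 rmorphN addrC.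
pose v : CC * CC := ((c +i* c)%C, 0).
have Ev (t : RR) : (lin q.1 v t).1 - p1.1 = ((- ((1 - t) * c)) +i* (t * c))%C.
  rewrite /lin /v /= Ex; apply: cc_eq; rewrite !(reD, imD, reN, imN, reM, imM, reR, imR) /=; rewrite ?RealsE; cring.
have boxv t : 0 <= t <= 1 -> box p1 r (lin q.1 v t).
  move=> /andP[k0 k1]; split; last by case: bq => _; rewrite /= mulr0 addr0.
  rewrite Ev; apply: le_lt_trans cr.
  rewrite md_def /= -[leRHS]ger0_norm // -sqrtr_sqr ler_wsqrtr // sqrrN !exprMn -mulrDl.
  by rewrite ler_piMl ?sqr_ge0 //; nra.
have L := lin_lift Fq (fun t ht => Bbox _ (boxv t ht)).
have nev t : 0 <= t <= 1 -> (lin q.1 v t).1 != p1.1.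
  move=> ht; rewrite -subr_eq0 Ev eq_complex /= oppr_eq0 !mulf_eq0 !(gt_eqF c0) !orbF.
  by apply/negP => /andP[/eqP h1' /eqP h2']; move: h1'; rewrite h2'; lra.
have genv t : 0 <= t <= 1 -> generic (lin q.1 v t).1.
  by move=> ht; apply: gbox; [case: (boxv t ht) | exact: nev].
have e1 := flat_lift fpsi L boxv; have e2 := flat_lift flat_psig L genv.
have [pl s0 sl] := L.
have e3 : psi (lift (lin q.1 v) q 1) = psig (lift (lin q.1 v) q 1).
  apply: direct; [exact: pl.2 | by rewrite sl ?I1 //; apply: boxv I1 |].
  move=> t /andP[k0 k1]; rewrite sl ?I1 // -subr_eq0.
  have -> : (lin q.1 v 1).1 + t%:C%C * (ps.1 - (lin q.1 v 1).1) - p1.1 =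
      (1 - t)%:C%C * ((lin q.1 v 1).1 - p1.1) + t%:C%C * (ps.1 - p1.1) by rewrite rmorphB /=; ring.
  have -> : ps.1 - p1.1 = (r / 2)%:C%C by rewrite /ps /= addrC addKr.
  rewrite Ev; apply/negP => /eqP h; have := congr1 re h; have := congr1 im h.
  rewrite !(reD, imD, reM, imM, reR, imR) /= ?RealsE => k2 k3.
  have /eqP : (1 - t) * c = 0 by lra.
  rewrite mulf_eq0 (gt_eqF c0) orbF => /eqP k4.
  have tt : t = 1 by lra.
  by move: k3; rewrite tt; lra.
by move: e1; rewrite e2 e3 => /addrI /oppr_inj.
Qed.

(* The primitive on the fibre x = x0 extends along isotopies of the fibres; the
   extensions are compared by their values far above all lines, where the
   arrangement looks like a product. *)
Theorem lefschetz : exists psi, flat (fun _ => True) psi.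
Proof.
have /choice[R HR] : forall p : CC * CC, exists rp : RR * (pt -> CC), inB p -> [/\ 0 < rp.1,
  (forall p', box p rp.1 p' -> inB p'),
  (forall x, md (x - p.1) < rp.1 -> x != p.1 -> generic x),
  flat (box p rp.1) rp.2 &
  forall q, inF q -> box p rp.1 q.1 -> generic q.1.1 -> rp.2 q = psig q].
  move=> p; case: (pselect (inB p)) => [Bp|nB]; last by exists (0, fun _ => 0).
  by have [r [psi h]] := fill Bp; exists (r, psi).
pose psi q := (R q.1).2 q.
exists psi => s ps _; apply: (flat_local phi_cocycle ps) => t ht.
pose p1 := (s t).1; have Bp1 : inB p1 by apply: inF_inB; exact: ps.2.
have [r0 hB hg hf he] := HR p1 Bp1.
have [dl dl0 hdl] := path_close t ps r0.
exists dl => //; exists (box p1 (R p1).1); last by move=> t' _ /hdl[].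
apply: (flat_ext hf) => q Fq bq; rewrite /psi.
have Bq := inF_inB Fq; have [r0' hB' hg' hf' he'] := HR _ Bq.
have bqq : box q.1 (R q.1).1 q.1 by split; rewrite subrr md0.
case: (pselect (generic q.1.1)) => [gq|ngq]; first by rewrite he // he'.
(* a non generic abscissa: compare with psig at a nearby abscissa *)
have [e e0 [e1 e2]] : exists2 e : RR, 0 < e & e < (R p1).1 - md (q.1.1 - p1.1) /\ e < (R q.1).1.
  set u := _ - _; set w := (R q.1).1.
  have u0 : 0 < u by rewrite subr_gt0; case: bq.
  have m0 : 0 < Num.min u w by rewrite lt_min r0' andbT.
  have m1 : Num.min u w <= u by rewrite ge_min lexx.
  have m2 : Num.min u w <= w by rewrite ge_min lexx orbT.
  by exists (Num.min u w / 2); [lra | split; lra].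
pose v : CC * CC := (e%:C%C, 0).
have box1 t' : 0 <= t' <= 1 -> box p1 (R p1).1 (lin q.1 v t').
  move=> /andP[k0 k1]; split; last by case: bq => _; rewrite /= mulr0 addr0.
  rewrite /lin /= addrAC; apply: le_lt_trans (mdD _ _) _.
  rewrite mdM !mdR !ger0_norm // ?(ltW e0) //; have : t' * e <= e by rewrite ler_piMl // ltW.
  by move: e1; lra.
have box2 t' : 0 <= t' <= 1 -> box q.1 (R q.1).1 (lin q.1 v t').
  move=> /andP[k0 k1]; split; last by rewrite /= mulr0 addr0 subrr md0.
  rewrite /lin /= addrC addKr mdM !mdR !ger0_norm // ?(ltW e0) //.
  by have : t' * e <= e by [rewrite ler_piMl // ltW]; lra.
have L := lin_lift Fq (fun t ht => hB _ (box1 t ht)).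
have := flat_lift hf L box1; have := flat_lift hf' L box2.
have [pl s0 sl] := L.
have gen1 : generic (lift (lin q.1 v) q 1).1.1.
  rewrite sl ?I1 //; apply: hg'; first by case: (box2 1 I1).
  by rewrite /= mul1r -subr_eq0 addrC addKr eq_complex /= eqxx andbT gt_eqF.
have k1 := he _ (pl.2 1) _ gen1; have k2 := he' _ (pl.2 1) _ gen1.
rewrite k1 ?k2; first (by move=> -> /addrI /oppr_inj); rewrite sl ?I1 //.
  exact: box2 I1.
exact: box1 I1.
Qed.

End Lefschetz.

Definition proot (d : nat) (w : CC) : CC :=
  (exp (ln (md w) / d%:R))%:C%C * cis (atan (im w / re w) / d%:R).

Lemma expRX (y : RR) k : exp y ^+ k = exp (k%:R * y).
Proof.
elim: k => [|k IH]; first by rewrite expr0 mul0r exp_0.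
by rewrite exprS IH -natr1 mulrDl mul1r addrC; have := exp_plus y (k%:R * y); rewrite !RealsE => ->.
Qed.

Lemma prootX d w : (0 < d)%N -> 0 < re w -> proot d w ^+ d = w.
Proof.
move=> d0 w0; have dn : (d%:R : RR) != 0 by rewrite pnatr_eq0 -lt0n.
have mw : 0 < md w by rewrite md_gt0; apply: contraTneq w0 => ->; rewrite ltxx.
rewrite /proot exprMn -rmorphXn /= expRX cisX ![d%:R * _]mulrC !divfK //.
by rewrite exp_ln; [rewrite -cis_atan | exact/RltP].
Qed.

Lemma proot1 d : proot d 1 = 1.
Proof.
have l1 : ln 1 = 0 by exact: ln_1.
have e0 : exp 0 = 1 by exact: exp_0.
have a0 : atan 0 = 0 by exact: atan_0.
by rewrite /proot md1 l1 mul0r e0 /= mul0r a0 mul0r cis0 mulr1.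
Qed.

Lemma cC_proot d f : cC f -> (forall x, 0 < re (f x)) -> cC (fun x => proot d (f x)).
Proof.
move=> cf f0; have mf x : 0 < md (f x).
  by rewrite md_gt0; apply: contraTneq (f0 x) => ->; rewrite ltxx.
apply: cC_mul.
  apply: cC_real; apply: cR_exp; apply: cR_mul (cR_cst _); apply: cR_ln => //; exact: cR_md.
apply: cC_cis; apply: cR_mul (cR_cst _); apply: cR_atan; apply: cR_mul; first exact: cR_im.
by apply: cR_inv; [move=> x; rewrite gt_eqF | exact: cR_re].
Qed.

Lemma rot_re_gt0 (A B : CC) x y : 3 * md B < md A ->
  0 < re ((A + cis x * B) / (A + cis y * B)).
Proof.
move=> h; apply: re_div_gt0.
have -> : A + cis x * B - (A + cis y * B) = (cis x - cis y) * B by ring.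
apply: (@le_lt_trans _ _ (2 * md B)).
  rewrite mdM ler_wpM2r ?md_ge0 //; apply: le_trans (mdB _ _) _; rewrite !md_cis; lra.
apply: (@lt_le_trans _ _ (md A - md B)); first by lra.
by apply: le_trans (md_lerB _ _); rewrite mdM md_cis mul1r.
Qed.

Lemma cis_eq1 (x : RR) : 0 <= x -> x < 2 * PI -> cis x = 1 -> x = 0.
Proof.
move=> x0 x1 h; apply/eqP; rewrite eq_le x0 andbT leNgt; apply/negP => xp.
have : 0 < sin (x / 2).
  by apply/RltP; apply: sin_gt_0; apply/RltP; [change (0 < x / 2) | change (x / 2 < PI)]; lra.
have := congr1 re h; have E : x = 2 * (x / 2) by field.
rewrite /= {1}E; have -> : cos (2 * (x / 2)) = 1 - 2 * sin (x / 2) * sin (x / 2).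
  by have := cos_2a_sin (x / 2); rewrite !RealsE.
by move=> h1 h2; have := mulr_gt0 h2 h2; lra.
Qed.

Lemma PI_gt0 : 0 < PI. Proof. by apply/RltP; exact: PI_RGT_0. Qed.

Lemma zeta_prim d : (0 < d)%N -> d.-primitive_root (zeta d).
Proof.
move=> d0; have d0' : 0 < (d%:R : RR) by rewrite ltr0n.
apply/andP; split=> //; apply/forallP => i; rewrite unity_rootE.
case: (eqVneq i.+1 d) => [->|ne]; first by rewrite zetaX // eqxx.
have id : (i.+1 < d)%N by rewrite ltn_neqAle ne ltn_ord.
rewrite eqbF_neg; apply/negP => /eqP; rewrite zetaE cisX => h.
have i0 : 0 < (i.+1%:R : RR) by rewrite ltr0n.
have id' : (i.+1%:R : RR) < d%:R by rewrite ltr_nat.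
have pi0 := PI_gt0.
have E : i.+1%:R * (2 * PI / d%:R) = i.+1%:R / d%:R * (2 * PI) by rewrite ?RealsE; field; rewrite gt_eqF.
have f0 : 0 < i.+1%:R / d%:R :> RR by rewrite divr_gt0.
have f1 : i.+1%:R / d%:R < 1 :> RR by rewrite ltr_pdivrMr // mul1r.
have pp : 0 < 2 * PI by lra.
have : i.+1%:R / d%:R * (2 * PI) = 0.
  apply: cis_eq1; first by rewrite mulr_ge0 ?ltW.
    by rewrite gtr_pMl.
  by rewrite -E.
by move/eqP; rewrite mulf_eq0 !gt_eqF.
Qed.

Section Tools.
Variables (n : nat) (a b : 'I_n -> CC).
Local Notation inB := (inB a b).
Local Notation inF := (inF a b).
Local Notation path := (path a b).
Local Notation lam := (lam a b).
Local Notation is_lift := (is_lift a b).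
Local Notation lift := (lift a b).
Local Notation mlift := (mlift a b).
Local Notation mend := (mend a b).

Lemma loop_lift (f : RR -> CC * CC) q (c : 'I_n -> RR) (g : 'I_n -> RR -> CC) :
  inF q -> f 0 = q.1 -> cB (fun x => f (clamp x.1)) ->
  (forall i, cC (fun x => g i (clamp x.1))) ->
  (forall i t, 0 <= t <= 1 -> lam i (f t) = cis (c i * t) * g i t) ->
  (forall i t, 0 <= t <= 1 -> 0 < re (g i 0 / g i t)) ->
  is_lift f q (fun t => (f (clamp t), q.2 * cis (- (\sum_i c i) / n.+1%:R * clamp t) *
                                     \prod_i proot n.+1 (g i 0 / g i (clamp t)))).
Proof.
move=> Fq f0 cf cg lg rg.
have cl := clamp01; have gn i t : 0 <= t <= 1 -> g i t != 0.
  by move=> ht; apply: contraTneq (rg i t ht) => ->; rewrite invr0 mulr0 ltxx.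
have d0 : (n.+1%:R : RR) != 0 by rewrite pnatr_eq0.
split; last by move=> t ht; rewrite /= clamp_id.
- split.
    split=> //=; apply: cC_mul.
      apply: cC_mul (cC_cst _) _; apply: cC_cis; apply: cR_scale; apply: cR_clamp; exact: cR_fst.
    apply: cC_prod => i; apply: cC_proot => [|x]; last exact: rg.
    apply: cC_mul (cC_cst _) _; apply: cC_inv => // x; exact: gn.
  move=> t; rewrite /ginF /= !exprMn cisX.
  have -> : n.+1%:R * (- (\sum_i c i) / n.+1%:R * clamp t) = - (\sum_i (c i * clamp t)).
    by rewrite -mulr_suml; field; rewrite nat1r.
  have -> : cis (- \sum_i (c i * clamp t)) = (\prod_i cis (c i * clamp t))^-1.
    by rewrite cisN; congr _^-1; apply: (big_morph cis cisD cis0).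
  have -> : (\prod_i proot n.+1 (g i 0 / g i (clamp t))) ^+ n.+1 = \prod_i (g i 0 / g i (clamp t)).
    by rewrite -prodrXl; apply: eq_bigr => i _; rewrite prootX //; exact: rg.
  have -> : affQ a b (f (clamp t)) = \prod_i (cis (c i * clamp t) * g i (clamp t)).
    by apply: eq_bigr => i _; rewrite lg.
  rewrite prodf_div big_split /=.
  have h1 : \prod_i cis (c i * clamp t) != 0 by apply/prodf_neq0 => i _; exact: cis_neq0.
  have h2 : \prod_i g i (clamp t) != 0 by apply/prodf_neq0 => i _; exact: gn.
  have h3 : q.2 ^+ n.+1 * \prod_i g i 0 = 1.
    rewrite -[RHS]Fq /affQ; congr (_ * _); apply: eq_bigr => i _.
    by rewrite -f0 lg ?I0 // mulr0 cis0 mul1r.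
  transitivity (q.2 ^+ n.+1 * \prod_i g i 0); last exact: h3.
  by field; rewrite ?h1 ?h2.
rewrite clamp0 f0 mulr0 cis0 mulr1 big1 => [|i _]; first by rewrite mulr1; case: q {Fq f0}.
by rewrite divff ?proot1 //; exact: gn I0.
Qed.

Lemma loop_lift_end f q c g s : is_lift f q s ->
  inF q -> f 0 = q.1 -> cB (fun x => f (clamp x.1)) ->
  (forall i, cC (fun x => g i (clamp x.1))) ->
  (forall i t, 0 <= t <= 1 -> lam i (f t) = cis (c i * t) * g i t) ->
  (forall i t, 0 <= t <= 1 -> 0 < re (g i 0 / g i t)) -> (forall i, g i 1 = g i 0) ->
  s 1 = (f 1, q.2 * cis (- (\sum_i c i) / n.+1%:R)).
Proof.
move=> L Fq f0 cf cg lg rg g1; have L' := loop_lift Fq f0 cf cg lg rg.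
rewrite -(lift_eq L I1) (lift_eq L' I1) clamp1 mulr1 [X in _ * X]big1 ?mulr1 // => i _.
rewrite g1 divff ?proot1 //.
by apply: contraTneq (rg i 0 I0) => ->; rewrite invr0 mulr0 ltxx.
Qed.

Lemma deckD m k q : deck n m (deck n k q) = deck n (m + k) q.
Proof. by rewrite /deck /= mulrA -exprD. Qed.

Lemma deck_period m k q : m = k %[mod n.+1] -> deck n m q = deck n k q.
Proof.
move=> h; congr (_, _ * _); rewrite -(expr_mod m (zetaX (isT : (0 < n.+1)%N))) h expr_mod //.
exact: zetaX.
Qed.

Lemma deck0 q : deck n 0 q = q.
Proof. by rewrite /deck expr0 mul1r; case: q. Qed.

Lemma zeta_exp m : zeta n.+1 ^+ m = cis (m%:R * (2 * PI / n.+1%:R)).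
Proof. by rewrite zetaE cisX. Qed.

Lemma deck_cis m q (c : RR) : c = 2 * PI * (n.+1%:R - m%:R) ->
  deck n m q = (q.1, q.2 * cis (- c / n.+1%:R)).
Proof.
move=> ->; congr (_, _); rewrite [RHS]mulrC; congr (_ * _); rewrite zeta_exp.
have -> : - (2 * PI * (n.+1%:R - m%:R)) / n.+1%:R = m%:R * (2 * PI / n.+1%:R) + - (2 * PI).
  by field; rewrite nat1r pnatr_eq0.
by rewrite cisD cisN cis_2pi invr1 mulr1.
Qed.

Lemma lift_deck m f q s : is_lift f q s -> is_lift f (deck n m q) (fun t => deck n m (s t)).
Proof. by move=> [ps s0 sl]; split; [exact: path_deck | rewrite s0 | exact: sl]. Qed.

Lemma fibre_deck q q' : inF q -> inF q' -> q.1 = q'.1 -> exists j, q' = deck n j q.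
Proof.
move=> Fq Fq' e; have qn : affQ a b q.1 != 0 by apply: affQ_neq0; exact: inF_inB.
have E : q'.2 ^+ n.+1 = q.2 ^+ n.+1 by apply: (mulIf qn); rewrite Fq [in LHS]e Fq'.
have q0 := inF_neq0 Fq.
have u1 : (q'.2 / q.2) ^+ n.+1 = 1 by rewrite expr_div_n E divff // expf_neq0.
have [j hj] := prim_rootP (zeta_prim (isT : (0 < n.+1)%N)) u1.
by exists j; rewrite /deck e -hj divfK //; case: q' {Fq' E u1 hj} e.
Qed.

End Tools.

(** * The monodromy is trivial *)

Section Rotation.
Variables (n : nat) (a b : 'I_n -> CC).
Variable phi : (RR -> pt) -> CC.
Local Notation inB := (inB a b).
Local Notation inF := (inF a b).
Local Notation path := (path a b).
Local Notation lam := (lam a b).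
Local Notation flat := (flat a b).
Local Notation is_lift := (is_lift a b).
Local Notation lift := (lift a b).
Local Notation mlift := (mlift a b).
Local Notation mend := (mend a b).
Hypothesis phi_cocycle : forall s, splx2 a b s -> phi (gface0 s) - phi (gface1 s) + phi (gface2 s) = 0.
Hypothesis lines_distinct : forall i j, i != j -> a i = a j -> b i != b j.

(* The number of lines of the projective arrangement through the point at infinity of slope s. *)
Definition slope_mult (s : CC) : nat := #|[pred j | a j == s]|.+1.
Hypothesis mult_coprime : forall i, coprime n.+1 (slope_mult (a i)).

Definition twist (s : RR -> pt) : CC := phi (fun t => deck n 1 (s t)) - phi s.

Lemma splx2_deck m s : splx2 a b s -> splx2 a b (fun x => deck n m (s x)).
Proof.
move=> [[c1 c2] r Fs]; split=> [|x|x]; last exact: deck_inF.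
- by split=> //; apply: cC_mul => //; exact: cC_cst.
- by rewrite -r.
Qed.

Lemma twist_cocycle s : splx2 a b s -> twist (gface0 s) - twist (gface1 s) + twist (gface2 s) = 0.
Proof.
move=> hs; have h1 := phi_cocycle hs; have h2 := phi_cocycle (splx2_deck 1 hs).
rewrite -[RHS](subrr 0) -{1}h2 -h1 /twist /gface0 /gface1 /gface2; ring.
Qed.

Definition rot (t : RR) : CC := cis (2 * PI * t).

Lemma rot0 : rot 0 = 1. Proof. by rewrite /rot mulr0 cis0. Qed.
Lemma rot1 : rot 1 = 1. Proof. by rewrite /rot mulr1 cis_2pi. Qed.

Lemma rotV t : rot t * cis (- (2 * PI) * t) = 1.
Proof. by rewrite /rot -cisD -mulrDl subrr mul0r cis0. Qed.

Lemma cC_rot f : cR f -> cC (fun x => rot (f x)).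
Proof. by move=> cf; apply: cC_cis; exact: cR_scale. Qed.

Lemma sum_if_2pi (P : pred 'I_n) : \sum_i (if P i then 0 else 2 * PI) = 2 * PI * (n.+1%:R - #|P|.+1%:R) :> RR.
Proof.
rewrite (bigID P) /= big1 => [|i ->//]; rewrite add0r (eq_bigr (fun _ => 2 * PI)) => [|i /negbTE->//].
have En : n%:R = #|P|%:R + #|[pred i | ~~ P i]|%:R :> RR.
  by rewrite -natrD; congr _%:R; rewrite -[LHS]card_ord -(cardC P).
by rewrite sumr_const -mulr_natr -!natr1 En; ring.
Qed.

Definition Wo (p : CC * CC) := forall i, 3 * md (b i) < md (p.2 - a i * p.1).
(* Far from all lines, rotating the whole plane lifts to the deck transformation. *)
Definition Go (p : CC * CC) (t : RR) : CC * CC := (rot t * p.1, rot t * p.2).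
Definition go (p : CC * CC) i (t : RR) : CC := (p.2 - a i * p.1) + cis (- (2 * PI) * t) * - b i.

Lemma lam_Go p i t : lam i (Go p t) = rot t * go p i t.
Proof.
rewrite /go; move: (cis (- _ * t)) (rotV t) => u h.
transitivity (rot t * (p.2 - a i * p.1) + rot t * u * - b i); last by ring.
by rewrite h /glam /Go /=; ring.
Qed.

Lemma go_re p i t : Wo p -> 0 < re (go p i 0 / go p i t).
Proof. by move=> hp; apply: rot_re_gt0; rewrite mdN; exact: hp. Qed.

Lemma Wo_Go p t : Wo p -> Wo (Go p t).
Proof.
move=> hp i; rewrite /Go /=; have -> : rot t * p.2 - a i * (rot t * p.1) = rot t * (p.2 - a i * p.1) by ring.
by rewrite mdM md_cis mul1r.
Qed.

Lemma neq0_of_re (z w : CC) : 0 < re (z / w) -> w != 0.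
Proof. by apply: contraTneq => ->; rewrite invr0 mulr0 ltxx. Qed.

Lemma Go_motion : motion a b Wo Go.
Proof.
split.
- by move=> p _; rewrite /Go rot0 !mul1r; case: p.
- move=> p t hp _ _ i; rewrite lam_Go mulf_neq0 ?cis_neq0 //; exact: neq0_of_re (go_re i t hp).
move=> f [c1 c2] _ _; have cc : cC (fun x => rot (clamp x.2)).
  by apply: cC_rot; apply: cR_clamp; exact: cR_snd.
by split; exact: cC_mul.
Qed.

Lemma mend_Go q : inF q -> Wo q.1 -> mend Go q = deck n 1 q.
Proof.
move=> Fq hq; have L := mlift_is_lift Go_motion Fq hq.
have cc : cR (fun x => clamp x.1) by apply: cR_clamp; exact: cR_fst.
rewrite /mend (@loop_lift_end _ a b _ q (fun _ => 2 * PI) (go q.1) _ L Fq).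
- rewrite /Go rot1 !mul1r (deck_cis q (c := \sum_(i < n) (2 * PI))); first by case: (q.1).
  by rewrite sumr_const card_ord -mulr_natr -natr1; ring.
- by rewrite /Go rot0 !mul1r; case: (q.1).
- by split; apply: cC_mul (cC_cst _); exact: cC_rot.
- move=> i; apply: cC_add (cC_cst _) _; apply: cC_mul (cC_cst _); apply: cC_cis; exact: cR_scale.
- by move=> i t _; rewrite lam_Go.
- by move=> i t _; exact: go_re.
by move=> i; rewrite /go mulr1 mulr0 cisN cis_2pi cis0 invr1.
Qed.

Section Slope.
Variable s : CC.
Definition Ws (p : CC * CC) := forall i, a i != s ->
  3 * (md (p.2 - s * p.1) + md (b i)) < md ((s - a i) * p.1).
(* Far out along the direction s, rotating the abscissa with y - s x fixed turns
   around all lines except those of slope s; it lifts to a power of the deck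
   transformation prime to its order. *)
Definition Gs (p : CC * CC) (t : RR) : CC * CC := (rot t * p.1, p.2 - s * p.1 + s * (rot t * p.1)).
Definition gs (p : CC * CC) i (t : RR) : CC :=
  if a i == s then lam i p else (s - a i) * p.1 + cis (- (2 * PI) * t) * (p.2 - s * p.1 - b i).
Definition cs i : RR := if a i == s then 0 else 2 * PI.

Lemma lam_Gs p i t : lam i (Gs p t) = cis (cs i * t) * gs p i t.
Proof.
rewrite /cs /gs; case: eqVneq => [e|ne].
  by rewrite mul0r cis0 mul1r /glam /Gs /= -e; ring.
rewrite -/(rot t); move: (cis (- _ * t)) (rotV t) => u h.
transitivity (rot t * ((s - a i) * p.1) + rot t * u * (p.2 - s * p.1 - b i)); last by ring.
by rewrite h /glam /Gs /=; ring.
Qed.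

Lemma gs_re p i t : inB p -> Ws p -> 0 < re (gs p i 0 / gs p i t).
Proof.
rewrite /gs => Bp hp; case: eqVneq => [_|ne]; first by rewrite divff //= ltr01.
apply: rot_re_gt0; apply: le_lt_trans (hp i ne).
rewrite ler_pM2l //; exact: mdB.
Qed.

Lemma Gs_motion : motion a b Ws Gs.
Proof.
split.
- by move=> p _; rewrite /Gs rot0 !mul1r subrK; case: p.
- move=> p t hp Bp _ i; rewrite lam_Gs mulf_neq0 ?cis_neq0 //; exact: neq0_of_re (gs_re i t Bp hp).
move=> f [c1 c2] _ _; have cc : cC (fun x => rot (clamp x.2)).
  by apply: cC_rot; apply: cR_clamp; exact: cR_snd.
split; first exact: cC_mul.
apply: cC_add; last by apply: cC_mul (cC_cst _) _; exact: cC_mul.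
by apply: cC_sub => //; apply: cC_mul (cC_cst _) _.
Qed.

Lemma mend_Gs q : inF q -> Ws q.1 -> mend Gs q = deck n (slope_mult s) q.
Proof.
move=> Fq hq; have L := mlift_is_lift Gs_motion Fq hq; have Bq := inF_inB Fq.
have cc : cR (fun x => clamp x.1) by apply: cR_clamp; exact: cR_fst.
rewrite /mend (@loop_lift_end _ a b _ q cs (gs q.1) _ L Fq).
- rewrite /Gs rot1 !mul1r subrK (deck_cis q (c := \sum_i cs i)); first by case: (q.1).
  exact: sum_if_2pi.
- by rewrite /Gs rot0 !mul1r subrK; case: (q.1).
- split; first by apply: cC_mul (cC_cst _); exact: cC_rot.
  apply: cC_add (cC_cst _) _; apply: cC_mul (cC_cst _) _; apply: cC_mul (cC_cst _); exact: cC_rot.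
- move=> i; rewrite /gs; case: eqP => _; first exact: cC_cst.
  apply: cC_add (cC_cst _) _; apply: cC_mul (cC_cst _); apply: cC_cis; exact: cR_scale.
- by move=> i t _; rewrite lam_Gs.
- by move=> i t _; exact: gs_re.
by move=> i; rewrite /gs mulr1 mulr0 cisN cis_2pi cis0 invr1.
Qed.

Definition kinv : nat := (egcdn (slope_mult s) n.+1).1.

Definition psio q := hol phi (mlift Go q).
Definition psis q := \sum_(i < kinv) hol phi (mlift Gs (deck n (i * slope_mult s) q)).

Lemma flat_psio : flat twist Wo psio.
Proof. by move=> c pc Wc; have := motion_loop phi_cocycle Go_motion mend_Go pc Wc. Qed.

Lemma flat_psis : coprime n.+1 (slope_mult s) -> flat twist Ws psis.
Proof.
move=> cop c pc Wc; have step k : hol phi (fun t => deck n (k * slope_mult s) (c t)) - hol phi c =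
    \sum_(i < k) (hol phi (mlift Gs (deck n (i * slope_mult s) (c 1))) -
                  hol phi (mlift Gs (deck n (i * slope_mult s) (c 0)))).
  elim: k => [|k IH].
    by rewrite big_ord0 (@hol_eq phi _ c) ?subrr // => t _; rewrite mul0n deck0.
  rewrite big_ord_recr /= -IH.
  have := motion_loop phi_cocycle Gs_motion mend_Gs (path_deck (k * slope_mult s) pc) Wc.
  move=> /= <-; rewrite (@hol_eq phi (fun t => deck n (k.+1 * slope_mult s) (c t))
     (fun t => deck n (slope_mult s) (deck n (k * slope_mult s) (c t)))).
    by rewrite addrC addrA subrK.
  by move=> t _; rewrite deckD mulSn.
rewrite /psis -sumrB -step -[LHS]/(hol phi (fun t => deck n 1 (c t)) - hol phi c); congr (_ - _); apply: hol_eq => t _; apply: deck_period.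
rewrite /kinv; case: egcdnP => //= km kn e _.
move: cop; rewrite /coprime gcdnC => /eqP cop.
by rewrite e cop modnMDl.
Qed.

(* psio and psis are primitives along the path from q to deck 1 q given by Go *)
Lemma psi_diff_deck j q : coprime n.+1 (slope_mult s) -> inF q -> Wo q.1 -> Ws q.1 ->
  psio (deck n j q) - psis (deck n j q) = psio q - psis q.
Proof.
move=> cop Fq Wq Wq'; elim: j => [|j IH]; first by rewrite deck0.
rewrite -IH -add1n -deckD; set q' := deck n j q.
have Fq' : inF q' by exact: deck_inF.
have L := mlift_is_lift Go_motion Fq' (Wq : Wo q'.1).
have h1 : forall t, 0 <= t <= 1 -> Wo (Go q'.1 t) by move=> t _; exact: Wo_Go.
have h2 : forall t, 0 <= t <= 1 -> Ws (Go q'.1 t).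
  move=> t _ i ne; rewrite /Go /=; have := Wq' i ne.
  have -> : rot t * q.1.2 - s * (rot t * q.1.1) = rot t * (q.1.2 - s * q.1.1) by ring.
  by rewrite [(s - a i) * (rot t * _)]mulrCA !(mdM (rot t)) md_cis !mul1r.
have e1 := flat_lift flat_psio L h1; have e2 := flat_lift (flat_psis cop) L h2.
rewrite -/(mend Go q') mend_Go // in e1 e2.
have : psio (deck n 1 q') - psio q' = psis (deck n 1 q') - psis q' by rewrite -e1 -e2.
by move/(canRL (subrK _)) => ->; ring.
Qed.

End Slope.

Section Fibre.
Variables (rho : RR) (x0 : CC).
Hypothesis rho0 : 0 < rho.
Hypothesis hb : forall i, 3 * md (b i) < rho.
Hypothesis hx0 : forall i j, a i != a j -> 15 * rho < md ((a i - a j) * x0).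

Lemma far_slope i j (y : CC) : a j != a i -> md (y - a i * x0) < 4 * rho -> 11 * rho < md (y - a j * x0).
Proof.
move=> ne h; have -> : y - a j * x0 = (a i - a j) * x0 + (y - a i * x0) by ring.
rewrite eq_sym in ne; have r0 := rho0.
by apply: lt_le_trans (md_lerB _ _); have := hx0 ne; lra.
Qed.

Lemma near_Ws i p : p.1 = x0 -> md (p.2 - a i * x0) < 4 * rho -> Ws (a i) p.
Proof.
move=> px h j ne; rewrite px; rewrite eq_sym in ne; apply: lt_trans (hx0 ne).
by have := hb j; have r0 := rho0; lra.
Qed.

Lemma far_Wo p : p.1 = x0 -> (forall i, rho < md (p.2 - a i * x0)) -> Wo p.
Proof. by move=> px h i; rewrite px; apply: lt_trans (h i); exact: hb. Qed.

Lemma annulus_Wo i p : p.1 = x0 -> rho < md (p.2 - a i * x0) < 4 * rho -> Wo p.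
Proof.
move=> px /andP[h1 h2]; apply: far_Wo => // j; case: (eqVneq (a j) (a i)) => [->//|ne].
by have r0 := rho0; have := far_slope ne h2; lra.
Qed.

Definition qref (s : CC) : pt :=
  let p := (x0, s * x0 + (2 * rho)%:C%C) in (p, n.+1.-root (affQ a b p)^-1).

Lemma annulus_inB p : Wo p -> inB p.
Proof.
move=> hp i; rewrite -md_gt0 /glam; apply: lt_le_trans (md_lerB _ _).
by rewrite mdN; have := hp i; have := md_ge0 (b i); lra.
Qed.

Lemma qref_ann i : rho < md ((qref (a i)).1.2 - a i * x0) < 4 * rho.
Proof.
have r0 := rho0.
by rewrite /qref /= addrC addKr mdR ger0_norm; [apply/andP; split; lra | lra].
Qed.

Lemma qref_inF i : inF (qref (a i)).
Proof.
rewrite /ginF rootCK //= mulVf //; apply: affQ_neq0; apply: annulus_inB.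
exact: (annulus_Wo _ (qref_ann i)).
Qed.

Lemma psi_diff_const i q : inF q -> q.1.1 = x0 -> rho < md (q.1.2 - a i * x0) < 4 * rho ->
  psio q - psis (a i) q = psio (qref (a i)) - psis (a i) (qref (a i)).
Proof.
move=> Fq qx hq; have [th hth] := polar (q.1.2 - a i * x0).
set r := md _ in hq hth.
pose f (t : RR) : CC * CC :=
  (x0, a i * x0 + ((1 - t) * r + t * (2 * rho))%:C%C * cis ((1 - t) * th)).
have ann t : 0 <= t <= 1 -> rho < md ((f t).2 - a i * x0) < 4 * rho.
  move=> ht; rewrite /f /= addrC addKr mdM md_cis mulr1 mdR.
  have /andP[k1 k2] := hq; have r0 := rho0; have := ht => /andP[t0 t1].
  have h1 : 0 < (1 - t) * (r - rho) + t * (2 * rho - rho) by apply: convex_gt0 => //; lra.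
  have h2 : 0 < (1 - t) * (4 * rho - r) + t * (4 * rho - 2 * rho) by apply: convex_gt0 => //; lra.
  by rewrite ger0_norm; [apply/andP; split; lra | lra].
have f0 : f 0 = q.1.
  rewrite /f subr0 !mul1r mul0r addr0 -hth addrC subrK -qx.
  by case: (q.1).
have cf : cB (fun x => f (clamp x.1)).
  have cc : cR (fun x => clamp x.1) by apply: cR_clamp; exact: cR_fst.
  have c1 : cR (fun x => 1 - clamp x.1) by apply: cR_sub (cR_cst _) _.
  split; first exact: cC_cst.
  apply: cC_add (cC_cst _) _; apply: cC_mul.
    by apply: cC_real; apply: cR_add; apply: cR_mul (cR_cst _).
  by apply: cC_cis; apply: cR_mul (cR_cst _).
have hWo t : 0 <= t <= 1 -> Wo (f t) by move=> ht; apply: (annulus_Wo (i := i)) => //; exact: ann.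
have hWs t : 0 <= t <= 1 -> Ws (a i) (f t).
  by move=> ht; apply: near_Ws => //; have /andP[] := ann t ht.
have L := lift_exists cf (fun t ht => annulus_inB (hWo t ht)) f0 Fq.
have e1 := flat_lift flat_psio L hWo; have e2 := flat_lift (flat_psis (mult_coprime i)) L hWs.
set q1 := lift f q 1 in e1 e2.
have Fq1 : inF q1 by exact: (lift_inF _ L).
have b1 : q1.1 = (qref (a i)).1.
  have [_ _ h] := L; rewrite /q1 h ?I1 // /f /qref /=.
  by rewrite subrr !mul0r add0r mul1r cis0 mulr1.
have [j hj] := fibre_deck Fq1 (qref_inF i) b1.
rewrite hj psi_diff_deck //; last first.
- by rewrite b1; apply: near_Ws => //; have /andP[] := qref_ann i.
- by rewrite b1; exact: (annulus_Wo _ (qref_ann i)).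
have : psio q1 - psio q = psis (a i) q1 - psis (a i) q by rewrite -e1 -e2.
by move/(canRL (subrK _)) => ->; ring.
Qed.

Definition psifib (q : pt) : CC :=
  if [pick i | md (q.1.2 - a i * x0) < 2 * rho] is Some i
  then psis (a i) q + (psio (qref (a i)) - psis (a i) (qref (a i))) else psio q.

Lemma flat_psifib : flat twist (fib x0) psifib.
Proof.
move=> c pc Wc; apply: (flat_local twist_cocycle pc) => t ht; have r0 := rho0.
case: (pselect (exists i, md ((c t).1.2 - a i * x0) < 4 * rho)) => [[i hi]|hn].
  have e0 : 0 < 4 * rho - md ((c t).1.2 - a i * x0) by lra.
  have [dl dl0 hd] := path_close t pc e0.
  exists dl => //; exists (fun p => p.1 = x0 /\ md (p.2 - a i * x0) < 4 * rho).
    apply: (@flat_ext _ a b twist _ (fun q => psis (a i) q + (psio (qref (a i)) - psis (a i) (qref (a i))))).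
      move=> c' pc' Wc'; have := flat_psis (mult_coprime i) pc'.
      rewrite opprD addrACA subrr addr0; apply=> u hu.
      by have [? ?] := Wc' u hu; exact: near_Ws.
    move=> q Fq [qx hq]; rewrite /psifib; case: pickP => [j hj|hno].
      suff -> : a j = a i by [].
      apply/eqP/negPn/negP => ne; have h4 : md (q.1.2 - a j * x0) < 4 * rho by lra.
      by rewrite eq_sym in ne; have := far_slope ne h4; lra.
    have hq' : rho < md (q.1.2 - a i * x0) < 4 * rho.
      have h2 : 2 * rho <= md (q.1.2 - a i * x0) by rewrite leNgt; apply/negbT; exact: hno i.
      by rewrite hq andbT; lra.
    have h := psi_diff_const Fq qx hq'.
    by rewrite -h [LHS]addrC subrK.
  move=> t' ht' hc; split; first exact: Wc.
  have [_ h2] := hd t' hc.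
  have := mdD ((c t').1.2 - (c t).1.2) ((c t).1.2 - a i * x0).
  by rewrite addrA subrK; lra.
have far i : 4 * rho <= md ((c t).1.2 - a i * x0).
  by rewrite leNgt; apply/negP => h; apply: hn; exists i.
have [dl dl0 hd] := path_close t pc rho0.
exists dl => //; exists (fun p => p.1 = x0 /\ forall i, 2 * rho < md (p.2 - a i * x0)).
  apply: (@flat_ext _ a b twist _ psio).
    apply: flat_sub flat_psio => p [px h]; apply: far_Wo => // i; have := h i; lra.
  move=> q Fq [qx hq]; rewrite /psifib; case: pickP => [j|//].
  by have := hq j; rewrite ltNge => /negP h1 /ltW.
move=> t' ht' hc; split; first exact: Wc.
move=> i; have [_ h2] := hd t' hc; have h3 := far i.
have := mdD ((c t).1.2 - (c t').1.2) ((c t').1.2 - a i * x0).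
by rewrite addrA subrK (mdBC (c t).1.2 (c t').1.2); have r0' := rho0; lra.
Qed.

End Fibre.

Lemma exists_far_generic : exists rho x0, [/\ 0 < rho, (forall i, 3 * md (b i) < rho),
  (forall i j, a i != a j -> 15 * rho < md ((a i - a j) * x0)) & generic a b x0].
Proof.
have [rho rho0 hrho] := exists_max (fun i => 3 * md (b i)).
have [T1 T10 hT1] := exists_max (fun ij : 'I_n * 'I_n => 15 * rho / md (a ij.1 - a ij.2)).
have [T2 T20 hT2] := exists_max (fun ij : 'I_n * 'I_n => md ((b ij.2 - b ij.1) / (a ij.1 - a ij.2))).
have T0 : 0 < T1 + T2 by lra.
exists rho, (T1 + T2)%:C%C; split=> //.
- by move=> i; apply: le_lt_trans (ler_norm _) (hrho i).
- move=> i j ne; rewrite mdM mdR ger0_norm ?ltW // [ltRHS]mulrC -ltr_pdivrMr ?md_gt0 ?subr_eq0 //.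
  by have := le_lt_trans (ler_norm _) (hT1 (i, j)) => /=; lra.
move=> i j ij; apply/negP => /eqP h.
case: (eqVneq (a i) (a j)) => aij.
  by have := lines_distinct ij aij; move: h; rewrite /yv aij => /addrI ->; rewrite eqxx.
have E : (b j - b i) / (a i - a j) = (T1 + T2)%:C%C.
  apply: (mulIf (x := a i - a j)); rewrite ?subr_eq0 // divfK ?subr_eq0 //.
  by move: h; rewrite /yv => h; apply: (addIr (b i)); rewrite subrK mulrC mulrBl addrAC h; ring.
have := le_lt_trans (ler_norm _) (hT2 (i, j)).
by rewrite /= E mdR ger0_norm ?ltW //; lra.
Qed.

Theorem twist_exact : exists psi, flat twist (fun _ => True) psi.
Proof.
have [rho [x0 [rho0 hb hx0 gx0]]] := exists_far_generic.
exact: (lefschetz twist_cocycle lines_distinct gx0 (flat_psifib rho0 hb hx0)).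
Qed.

End Rotation.

Definition is_arg (g : RR -> CC) (th : RR -> RR) :=
  cR (fun x => th x.1) /\ forall t, 0 <= t <= 1 -> g t = (md (g t))%:C%C * cis (th t).

Lemma arg_unique g th th' : (forall t, 0 <= t <= 1 -> g t != 0) -> is_arg g th -> is_arg g th' ->
  th 1 - th 0 = th' 1 - th' 0.
Proof.
move=> gn [c1 h1] [c2 h2].
pose dl t := (th t - th' t) - (th 0 - th' 0).
suff : dl 1 = 0 by rewrite /dl; lra.
have cdl : cR (fun x => dl x.1) by apply: cR_sub (cR_cst _); exact: cR_sub.
have e1 t : 0 <= t <= 1 -> cis (th t) = cis (th' t).
  move=> ht; have mg : (md (g t))%:C%C != 0 :> CC by rewrite eq_complex /= eqxx andbT md_eq0 gn.
  by apply: (mulfI mg); rewrite -h1 // -h2.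
have cdl1 t : 0 <= t <= 1 -> cis (dl t) = 1.
  by move=> ht; rewrite /dl !cisD !cisN !cisD !cisN e1 // (e1 0 I0) divff ?cis_neq0 // divff ?cis_neq0 // invr1 mulr1.
have e0 : 0 < (`|dl 1| + 1)^-1 by rewrite invr_gt0; have := normr_ge0 (dl 1); lra.
have [N N0 hN] := archi e0.
have Nr : 0 < (N%:R : RR) by rewrite ltr0n.
have small : `|dl 1 / N%:R| < 1.
  rewrite normrM [ `|N%:R^-1|]ger0_norm ?invr_ge0 // -ltr_pdivlMr ?invr_gt0 // invrK mul1r.
  move: hN; rewrite ltf_pV2 ?posrE //; last by have := normr_ge0 (dl 1); lra.
  lra.
have w1 : cis (dl 1 / N%:R) = 1.
  apply: (@root_unique N (fun t => cis (dl t / N%:R))) => //; last exact: I1.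
  - by apply: cC_cis; apply: cR_mul (cR_cst _).
  - by move=> t ht; rewrite cisX mulrC divfK ?gt_eqF // cdl1.
  - by rewrite /dl subrr mul0r cis0.
have E2 : PI / 2 = Rdiv PI (IZR 2) by rewrite RealsE.
have pi2 : 1 < PI / 2 by rewrite E2; apply/RltP; exact: PI2_1.
have h0 : dl 1 / N%:R = 0.
  move: small; rewrite ltr_norml => /andP[k1 k2].
  case: (lerP 0 (dl 1 / N%:R)) => k; first by apply: cis_eq1 => //; lra.
  apply/eqP; rewrite -oppr_eq0; apply/eqP; apply: cis_eq1; [lra|lra|].
  by rewrite cisN w1 invr1.
by move/eqP: h0; rewrite mulf_eq0 invr_eq0 (gt_eqF Nr) orbF => /eqP.
Qed.

Definition winding (g : RR -> CC) : RR :=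
  if pselect (exists th, is_arg g th) is left h then projT1 (cid h) 1 - projT1 (cid h) 0 else 0.

Lemma windingE g th : (forall t, 0 <= t <= 1 -> g t != 0) -> is_arg g th -> winding g = th 1 - th 0.
Proof.
move=> gn h; rewrite /winding; case: pselect => [h'|[]]; last by exists th.
by case: (cid h') => th' /= k; exact: arg_unique k h.
Qed.

Lemma winding_loop (g : RR -> CC) (c : RR) (k : RR -> CC) : cC (fun x => k (clamp x.1)) ->
  (forall t, 0 <= t <= 1 -> g t = cis (c * t) * k t) ->
  (forall t, 0 <= t <= 1 -> 0 < re (k 0 / k t)) -> k 1 = k 0 -> winding g = c.
Proof.
move=> ck gk rk k1.
have kn t : 0 <= t <= 1 -> k t != 0.
  by move=> /rk; apply: contraTneq => ->; rewrite invr0 mulr0 ltxx.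
have [t0 ht0] := polar (k 0).
pose r t := k 0 / k (clamp t).
pose th t := t0 + c * t - atan (im (r t) / re (r t)).
have cr : cC (fun x => r x.1).
  by apply: cC_mul (cC_cst _) _; apply: cC_inv => // x; apply: kn; exact: clamp01.
have rr t : 0 < re (r t) by apply: rk; exact: clamp01.
have hth : is_arg g th.
  split.
    apply: cR_sub; first by apply: cR_add (cR_cst _) _; apply: cR_scale; exact: cR_fst.
    apply: cR_atan; apply: cR_mul; first exact: cR_im.
    by apply: cR_inv; [move=> x; rewrite gt_eqF | exact: cR_re].
  move=> t ht; rewrite /th cisD cisN cisD.
  have E := cis_atan (rr t).
  have mr : (md (r t))%:C%C != 0 :> CC.
    by rewrite eq_complex /= eqxx andbT gt_eqF // md_gt0; apply: contraTneq (rr t) => ->; rewrite ltxx.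
  have -> : cis (atan (im (r t) / re (r t))) = r t / (md (r t))%:C%C.
    by apply: (mulfI mr); rewrite -E mulrC divfK.
  have k0n := kn 0 I0; have ktn := kn t ht.
  have m0' : (md (k 0))%:C%C != 0 :> CC by rewrite eq_complex /= eqxx andbT md_eq0.
  have mt' : (md (k t))%:C%C != 0 :> CC by rewrite eq_complex /= eqxx andbT md_eq0.
  have -> : cis t0 = k 0 / (md (k 0))%:C%C.
    by apply: (mulfI m0'); rewrite -ht0 mulrC divfK.
  rewrite gk // mdM md_cis mul1r /r clamp_id // mdM mdV rmorphM fmorphV /=.
  by field; rewrite k0n ktn m0' mt'.
have gn t : 0 <= t <= 1 -> g t != 0 by move=> ht; rewrite gk // mulf_neq0 ?cis_neq0 ?kn.
rewrite (windingE gn hth) /th /r clamp1 clamp0 k1; ring.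
Qed.

(** * Invariant cocycles without periods *)

Section Sweep.
Variables (n : nat) (a b : 'I_n -> CC).
Variable phi : (RR -> pt) -> CC.
Local Notation inB := (inB a b).
Local Notation inF := (inF a b).
Local Notation path := (path a b).
Local Notation lam := (lam a b).
Local Notation flat := (flat a b phi).
Local Notation hol := (hol phi).
Local Notation is_lift := (is_lift a b).
Local Notation lift := (lift a b).
Local Notation mlift := (mlift a b).
Local Notation mend := (mend a b).
Local Notation motion := (motion a b).
Hypothesis phi_cocycle : forall s, splx2 a b s -> phi (gface0 s) - phi (gface1 s) + phi (gface2 s) = 0.
Hypothesis phi_deck : forall s, phi (fun t => deck n 1 (s t)) = phi s.

Definition dinv (W : CC * CC -> Prop) (psi : pt -> CC) :=
  forall q, inF q -> W q.1 -> psi (deck n 1 q) = psi q.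

Lemma dinv_iter W psi j q : dinv W psi -> inF q -> W q.1 -> psi (deck n j q) = psi q.
Proof.
move=> d Fq Wq; elim: j => [|j IH]; first by rewrite deck0.
by rewrite -add1n -deckD d //; exact: deck_inF.
Qed.

Lemma motion_dinv W W' G psi : motion W G -> dinv W' psi ->
  (forall p, W p -> inB p -> W' (G p 1)) ->
  dinv W (fun q => psi (mend G q) - hol (mlift G q)).
Proof.
move=> mG d hW q Fq Wq; have L := mlift_is_lift mG Fq Wq; have L' := lift_deck 1 L.
have E t : 0 <= t <= 1 -> mlift G (deck n 1 q) t = deck n 1 (mlift G q t) by exact: lift_eq L' _.
rewrite {1}/mend E ?I1 // -/(mend G q) d; last first.
- by rewrite (mend_base mG) //; apply: hW => //; exact: inF_inB.
- exact: (mend_inF mG).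
congr (_ - _); rewrite (hol_eq _ E); exact: phi_deck.
Qed.

Lemma flat_point p : flat (fun p' => p' = p) (fun _ => 0).
Proof.
move=> s ps Ws; rewrite subr0 -(hol_cst phi_cocycle (ps.2 0)); apply: hol_eq.
have pc : path (fun _ => s 0) by split=> [|t]; [exact: (@cP_cst (s 0)) | exact: ps.2].
by apply: (lift_unique ps pc) => // t ht; rewrite (Ws t ht) (Ws 0 I0).
Qed.

Variables (x0 v : CC) (eps : RR).
Hypothesis v0 : v != 0.
Hypothesis eps0 : 0 < eps.

Definition H (y : CC) : RR := imJ y v.
Definition K (y : CC) : RR := re y * re v + im y * im v.
Definition E1 : CC := ((- im v / md v ^+ 2) +i* (re v / md v ^+ 2))%C.
Definition E2 : CC := ((re v / md v ^+ 2) +i* (im v / md v ^+ 2))%C.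
Definition yi i := yv a b i x0.

Hypothesis gap : forall i j, i != j -> 4 * eps <= `|H (yi i) - H (yi j)|.

Definition circ i (t : RR) : CC * CC := (x0, yi i + cis (PI / 4 + 2 * PI * t) * (eps%:C%C * E1)).

Lemma HD y z : H (y + z) = H y + H z. Proof. by rewrite /H /imJ reD imD; cring. Qed.
Lemma KD y z : K (y + z) = K y + K z. Proof. by rewrite /K reD imD; cring. Qed.
Lemma HZ (t : RR) z : H (t%:C%C * z) = t * H z. Proof. by rewrite /H /imJ reM imM reR imR; cring. Qed.
Lemma KZ (t : RR) z : K (t%:C%C * z) = t * K z. Proof. by rewrite /K reM imM reR imR; cring. Qed.
Lemma HB y z : H (y - z) = H y - H z. Proof. by rewrite /H /imJ reB imB; cring. Qed.
Lemma KB y z : K (y - z) = K y - K z. Proof. by rewrite /K reB imB; cring. Qed.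

Lemma nv0 : re v ^+ 2 + im v ^+ 2 != 0. Proof. by rewrite -cc_eq0. Qed.

Lemma HE1 : H E1 = 1.
Proof. by have nv := nv0; rewrite /H /imJ /E1 md_sq /= ?RealsE; apply: RR_eq; field. Qed.
Lemma KE1 : K E1 = 0.
Proof. by have nv := nv0; rewrite /K /E1 md_sq /= ?RealsE; apply: RR_eq; field. Qed.
Lemma HE2 : H E2 = 0.
Proof. by have nv := nv0; rewrite /H /imJ /E2 md_sq /= ?RealsE; apply: RR_eq; field. Qed.
Lemma KE2 : K E2 = 1.
Proof. by have nv := nv0; rewrite /K /E2 md_sq /= ?RealsE; apply: RR_eq; field. Qed.

Lemma cis_E1 x : cis x * E1 = (cos x)%:C%C * E1 - (sin x)%:C%C * E2.
Proof. by apply: cc_eq; rewrite !(reB, imB, reM, imM) /= ?RealsE; cring. Qed.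

Lemma HK_inj y z : H y = H z -> K y = K z -> y = z.
Proof.
move=> h k; apply/eqP; rewrite -subr_eq0; set w := y - z.
have hw : H w = 0 by rewrite HB h subrr.
have kw : K w = 0 by rewrite KB k subrr.
have nv := nv0.
have e1 : re w * (re v ^+ 2 + im v ^+ 2) = 0.
  transitivity (K w * re v - H w * im v); first by rewrite /K /H /imJ; cring.
  by rewrite hw kw !mul0r subr0.
have e2 : im w * (re v ^+ 2 + im v ^+ 2) = 0.
  transitivity (K w * im v + H w * re v); first by rewrite /K /H /imJ; cring.
  by rewrite hw kw !mul0r addr0.
move/eqP: e1; rewrite mulf_eq0 (negbTE nv) orbF => /eqP e1.
move/eqP: e2; rewrite mulf_eq0 (negbTE nv) orbF => /eqP e2.
by rewrite eq_complex /= e1 e2 eqxx.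
Qed.

Lemma circE i t : (circ i t).2 = yi i + eps%:C%C * (cis (PI / 4 + 2 * PI * t) * E1).
Proof. by rewrite /circ /=; ring. Qed.

Lemma H_circ i t : H (circ i t).2 = H (yi i) + eps * cos (PI / 4 + 2 * PI * t).
Proof. by rewrite circE HD HZ cis_E1 HB !HZ HE1 HE2 mulr1 mulr0 subr0. Qed.

Lemma K_circ i t : K (circ i t).2 = K (yi i) - eps * sin (PI / 4 + 2 * PI * t).
Proof. by rewrite circE KD KZ cis_E1 KB !KZ KE1 KE2 mulr1 mulr0 sub0r mulrN. Qed.

Lemma inB_fib p : p.1 = x0 -> (forall i, p.2 != yi i) -> inB p.
Proof. by move=> px h i; rewrite lamE px subr_eq0; exact: h. Qed.

Lemma fib_inB p i : inB p -> p.1 = x0 -> p.2 != yi i.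
Proof. by move=> h px; have := h i; rewrite lamE px subr_eq0. Qed.

Definition GL (r : RR) (p : CC * CC) (t : RR) : CC * CC :=
  (p.1, p.2 - (t * Num.max 0 (H p.2 - r))%:C%C * E1).

Lemma cR_H f : cC f -> cR (fun x => H (f x)).
Proof.
by move=> [f1 f2]; apply: cR_sub; apply: cR_mul => //; exact: cR_cst.
Qed.

Lemma cR_K f : cC f -> cR (fun x => K (f x)).
Proof.
by move=> [f1 f2]; apply: cR_add; apply: cR_mul => //; exact: cR_cst.
Qed.

Lemma GL_motion W r : (forall p, W p -> p.1 = x0) ->
  (forall p i, W p -> r <= H (yi i) -> H (yi i) < H p.2 -> K p.2 <> K (yi i)) -> motion W (GL r).
Proof.
move=> Wx Wk; split.
- by move=> p _; rewrite /GL !mul0r subr0; case: p.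
- move=> p t Wp Bp /andP[t0 t1]; have px := Wx p Wp; apply: inB_fib => // i.
  rewrite /GL /=; case: (lerP (H p.2) r) => hr.
    by rewrite max_l ?subr_le0 // mulr0 mul0r subr0 fib_inB.
  rewrite max_r ?subr_ge0 ?ltW //; apply/negP => /eqP e.
  have eh := congr1 H e; have ek := congr1 K e.
  rewrite HB HZ HE1 mulr1 in eh; rewrite KB KZ KE1 mulr0 subr0 in ek.
  have d0 : 0 < H p.2 - r by lra.
  have tn : 0 <= t * (H p.2 - r) by rewrite mulr_ge0 // ltW.
  have tn1 : t * (H p.2 - r) <= H p.2 - r by rewrite ler_piMl // ltW.
  case: (eqVneq t 0) => tz; first by have := fib_inB i Bp px; rewrite -e tz !mul0r subr0 eqxx.
  have tp : 0 < t * (H p.2 - r) by rewrite mulr_gt0 // lt_def tz.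
  by apply: (Wk p i) => //; lra.
move=> f [c1 c2] _ _; split=> //; apply: cC_sub => //; apply: cC_mul (cC_cst _).
apply: cC_real; apply: cR_mul; first by apply: cR_clamp; exact: cR_snd.
by apply: cR_max (cR_cst _) _; apply: cR_sub (cR_cst _); exact: cR_H.
Qed.

Lemma GL_end r p : H (GL r p 1).2 <= r.
Proof.
by rewrite /GL /= mul1r HB HZ HE1 mulr1; case: (lerP (H p.2 - r) 0) => h; lra.
Qed.

Definition Om (r : RR) (p : CC * CC) := p.1 = x0 /\ H p.2 < r.

Lemma left_extend W r r0 psi : r < r0 -> (forall p, W p -> p.1 = x0) ->
  (forall p i, W p -> r <= H (yi i) -> H (yi i) < H p.2 -> K p.2 <> K (yi i)) ->
  flat (Om r0) psi -> dinv (Om r0) psi -> exists psi', flat W psi' /\ dinv W psi'.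
Proof.
move=> rr Wx Wk fp dp; have mG := GL_motion Wx Wk.
have hW p : W p -> inB p -> Om r0 (GL r p 1).
  by move=> Wp _; split; [exact: (Wx p) | exact: le_lt_trans (GL_end r p) rr].
exists (fun q => psi (mend (GL r) q) - hol (mlift (GL r) q)); split.
  exact: (motion_flat phi_cocycle mG fp hW).
exact: (motion_dinv mG dp hW).
Qed.

Lemma flat_Om_base r : (forall i, r <= H (yi i)) -> exists psi, flat (Om r) psi /\ dinv (Om r) psi.
Proof.
move=> hr; pose ps : CC * CC := (x0, (r - 1)%:C%C * E1).
pose G p := lin p (ps.1 - p.1, ps.2 - p.2).
have Hps : H ps.2 = r - 1 by rewrite /ps HZ HE1 mulr1.
have OmB p : Om r p -> inB p.
  move=> [px hp]; apply: inB_fib => // i; apply: contraTneq hp => ->; rewrite -leNgt; exact: hr.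
have mG : motion (Om r) G.
  split.
  - by move=> p _; exact: lin0.
  - move=> p t [px hp] _ ht; apply: OmB; split; first by rewrite /G /lin /ps /= px subrr mulr0 addr0.
    rewrite /G /lin HD HZ HB Hps; have /andP[t0 t1] := ht.
    have h : 0 < (1 - t) * (r - H p.2) + t * 1 by apply: convex_gt0 => //; lra.
    by lra.
  move=> f [c1 c2] _ _; have cc : cC (fun x => (clamp x.2)%:C%C).
    by apply: cC_real; apply: cR_clamp; exact: cR_snd.
  by split; apply: cC_add => //; apply: cC_mul => //; apply: cC_sub (cC_cst _) _.
have hW p : Om r p -> inB p -> G p 1 = ps.
  by move=> _ _; rewrite /G /lin !mul1r ![_ + (_ - _)]addrC !subrK -surjective_pairing.
exists (fun q => 0 - hol (mlift G q)); split.
  exact: (motion_flat phi_cocycle mG (flat_point (p := ps)) hW).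
by apply: (motion_dinv (W' := fun p => p = ps) (psi := fun _ => 0) mG _ hW) => q _ _.
Qed.

Lemma cR_near (f : RR -> RR) (t c : RR) : cR (fun x => f x.1) -> c < f t ->
  exists2 dl : RR, 0 < dl & forall t', `|t' - t| < dl -> c < f t'.
Proof.
move=> cf h; have e0 : 0 < f t - c by lra.
have [dl dl0 hd] := cf (t, 0) _ e0; exists dl => // t' ht'.
have := hd (t', 0) ht'; rewrite /= subrr normr0 => /(_ dl0).
by rewrite ltr_norml => /andP[h1 _]; lra.
Qed.

Lemma trig_quarter : 0 < cos (PI / 4) /\ 0 < sin (PI / 4).
Proof.
have p0 := PI_gt0; have E : Rdiv PI (IZR 2) = PI / 2 by rewrite RealsE.
split; apply/RltP.
  apply: cos_gt_0; rewrite E; apply/RltP; last by lra.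
  by change (- (PI / 2) < PI / 4); lra.
by apply: sin_gt_0; apply/RltP; [change (0 < PI / 4) | change (PI / 4 < PI)]; lra.
Qed.

Lemma mdE1 : md E1 = (md v)^-1.
Proof.
have mv : 0 < md v by rewrite md_gt0.
apply/eqP; rewrite -(eqrXn2 (n := 2)) ?invr_ge0 ?md_ge0 //; apply/eqP.
rewrite md_sq /E1 /= ?RealsE exprVn; have mv' : md v != 0 by rewrite gt_eqF.
have -> : (- im v / md v ^+ 2) ^+ 2 + (re v / md v ^+ 2) ^+ 2 = (re v ^+ 2 + im v ^+ 2) / (md v ^+ 2) ^+ 2.
  by cfield.
by rewrite -md_sq; cfield.
Qed.

Lemma H_le z : `|H z| <= md z * md v.
Proof.
rewrite -(ler_pXn2r (n := 2)) ?nnegrE ?mulr_ge0 ?md_ge0 //.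
rewrite real_normK ?num_real // exprMn !md_sq.
have -> : (re z ^+ 2 + im z ^+ 2) * (re v ^+ 2 + im v ^+ 2) = H z ^+ 2 + K z ^+ 2.
  by rewrite /H /K /imJ; cring.
by rewrite lerDl sqr_ge0.
Qed.

Lemma gap_md i j : i != j -> 3 * md (eps%:C%C * E1) < md (yi i - yi j).
Proof.
move=> ij; have mv : 0 < md v by rewrite md_gt0.
have e0 := eps0; rewrite mdM mdR mdE1 ger0_norm ?ltW // mulrA ltr_pdivrMr //.
apply: lt_le_trans (H_le _); rewrite HB; apply: lt_le_trans (gap ij); lra.
Qed.

Definition circ_c (i j : 'I_n) : RR := if j == i then 2 * PI else 0.
Definition circ_g (i j : 'I_n) (t : RR) : CC :=
  if j == i then cis (PI / 4) * (eps%:C%C * E1)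
  else (yi i - yi j) + cis (PI / 4 + 2 * PI * t) * (eps%:C%C * E1).

Lemma lam_circ i j t : lam j (circ i t) = cis (circ_c i j * t) * circ_g i j t.
Proof.
rewrite lamE /circ /circ_c /circ_g /= -/(yi j); case: eqVneq => [->|ne].
  by rewrite addrC addKr cisD; ring.
by rewrite mul0r cis0 mul1r; ring.
Qed.

Lemma E1_neq0 : eps%:C%C * E1 != 0.
Proof.
by rewrite -md_gt0 mdM mdR mdE1 mulr_gt0 ?invr_gt0 ?md_gt0 // normr_gt0 gt_eqF.
Qed.

Lemma circ_re i j t : 0 < re (circ_g i j 0 / circ_g i j t).
Proof.
rewrite /circ_g; case: eqVneq => [_|ne].
  by rewrite divff ?ltr01 // mulf_neq0 ?cis_neq0 ?E1_neq0.
by apply: rot_re_gt0; apply: gap_md; rewrite eq_sym.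
Qed.

Lemma cC_circ_g i j : cC (fun x => circ_g i j (clamp x.1)).
Proof.
rewrite /circ_g; case: eqP => _; first exact: cC_cst.
apply: cC_add (cC_cst _) _; apply: cC_mul (cC_cst _); apply: cC_cis.
by apply: cR_add (cR_cst _) _; apply: cR_scale; apply: cR_clamp; exact: cR_fst.
Qed.

Lemma circ_g1 i j : circ_g i j 1 = circ_g i j 0.
Proof. by rewrite /circ_g mulr1 mulr0 cisD cis_2pi addr0 mulr1. Qed.

Lemma cB_circ i : cB (fun x => circ i (clamp x.1)).
Proof.
split; first exact: cC_cst.
apply: cC_add (cC_cst _) _; apply: cC_mul (cC_cst _); apply: cC_cis.
by apply: cR_add (cR_cst _) _; apply: cR_scale; apply: cR_clamp; exact: cR_fst.
Qed.

Lemma circ_lift i q : inF q -> q.1 = circ i 0 -> is_lift (circ i) q (lift (circ i) q).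
Proof.
move=> Fq e; apply: (lift_is_lift (loop_lift (c := circ_c i) (g := circ_g i) Fq (esym e) _ _ _ _)).
- exact: cB_circ.
- by move=> j; exact: cC_circ_g.
- by move=> j t _; exact: lam_circ.
- by move=> j t _; exact: circ_re.
Qed.

Lemma circ_lift1 i q : inF q -> q.1 = circ i 0 -> lift (circ i) q 1 = deck n n q.
Proof.
move=> Fq e; have L := circ_lift Fq e.
rewrite (loop_lift_end (c := circ_c i) (g := circ_g i) L Fq (esym e) (cB_circ i)).
- rewrite (deck_cis q (c := \sum_j circ_c i j)).
    by congr (_, _); rewrite e /circ mulr1 mulr0 addr0 cisD cis_2pi mulr1.
  by rewrite /circ_c -big_mkcond big_pred1_eq -natr1; ring.
- by move=> j; exact: cC_circ_g.
- by move=> j t _; exact: lam_circ.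
- by move=> j t _; exact: circ_re.
by move=> j; exact: circ_g1.
Qed.

Hypothesis period0 : forall i q, inF q -> q.1 = circ i 0 -> hol (lift (circ i) q) = 0.

Lemma hol_flat W psi s (u w : RR) : flat W psi -> path s ->
  (forall t, 0 <= t <= 1 -> W (s (u + (w - u) * t)).1) -> hol (seg s u w) = psi (s w) - psi (s u).
Proof.
move=> f ps Ws; have := f (seg s u w) (path_seg u w ps) Ws.
by rewrite {2 3}/seg mulr1 mulr0 addr0 [u + _]addrC subrK.
Qed.

Section Step.
Variables (i : 'I_n) (r : RR).
Hypothesis below : forall j, H (yi j) < r -> j != i -> H (yi j) <= H (yi i) - 4 * eps.
Hypothesis ir : H (yi i) + 2 * eps <= r.

Definition W1 (p : CC * CC) := [/\ p.1 = x0, H p.2 < r & ~ (K p.2 = K (yi i) /\ H (yi i) <= H p.2)].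
Definition W2 (p : CC * CC) := [/\ p.1 = x0, H (yi i) < H p.2 & H p.2 < r].

Definition G2 (p : CC * CC) (t : RR) : CC * CC :=
  (p.1, p.2 + (t * (K (yi i) + 1 - K p.2))%:C%C * E2).

Lemma W2_inB p : W2 p -> inB p.
Proof.
move=> [px h1 h2]; apply: inB_fib => // j; apply/negP => /eqP e; rewrite e in h1 h2.
case: (eqVneq j i) => [ji|ji]; first by rewrite ji ltxx in h1.
by have := below h2 ji; have e0 := eps0; lra.
Qed.

Lemma H_G2 p t : H (G2 p t).2 = H p.2.
Proof. by rewrite /G2 HD HZ HE2 mulr0 addr0. Qed.

Lemma K_G2 p t : K (G2 p t).2 = K p.2 + t * (K (yi i) + 1 - K p.2).
Proof. by rewrite /G2 KD KZ KE2 mulr1. Qed.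

Lemma W2_G2 p t : W2 p -> W2 (G2 p t).
Proof. by move=> [px h1 h2]; split; rewrite ?H_G2. Qed.

Lemma G2_motion : motion W2 G2.
Proof.
split.
- by move=> p _; rewrite /G2 !mul0r addr0; case: p.
- by move=> p t Wp _ _; apply: W2_inB; exact: W2_G2.
move=> f [c1 c2] _ _; split=> //; apply: cC_add => //; apply: cC_mul (cC_cst _).
apply: cC_real; apply: cR_mul; first by apply: cR_clamp; exact: cR_snd.
by apply: cR_sub (cR_cst _) _; exact: cR_K.
Qed.

Lemma sweep_step psi0 : flat (Om (H (yi i) - 2 * eps)) psi0 -> dinv (Om (H (yi i) - 2 * eps)) psi0 ->
  exists psi, flat (Om r) psi /\ dinv (Om r) psi.
Proof.
move=> f0 d0; have e0 := eps0; have ir' := ir.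
have [|p [] //|p j [px hp hk] h1 h2|psi1 [f1 d1]] :=
    left_extend (W := W1) (r := H (yi i) - 3 * eps) _ _ _ f0 d0; first by lra.
  case: (eqVneq j i) => [ji|ji]; last by have := below (lt_trans h2 hp) ji; lra.
  by rewrite ji in h2 * => h; apply: hk; split=> //; exact: ltW.
have G2W1 p : W2 p -> inB p -> W1 (G2 p 1).
  by move=> [px h1 h2] _; split=> //; rewrite ?H_G2 // K_G2 => -[]; lra.
pose psi2 q := psi1 (mend G2 q) - hol (mlift G2 q).
have f2 : flat W2 psi2 := motion_flat phi_cocycle G2_motion f1 G2W1.
have d2 : dinv W2 psi2 := motion_dinv G2_motion d1 G2W1.
have up q : inF q -> W2 q.1 -> K (yi i) < K q.1.2 -> psi2 q = psi1 q.
  move=> Fq Wq kq; have L := mlift_is_lift G2_motion Fq Wq.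
  rewrite /psi2 (flat_lift f1 L) => [|t ht]; first by rewrite /mend; ring.
  case: Wq => px h1 h2; split=> //; rewrite ?H_G2 // K_G2 => -[h _].
  have := @convex_gt0 (K q.1.2 - K (yi i)) 1 t; rewrite subr_gt0 => /(_ kq ltr01 ht).
  lra.
have circ0 q : inF q -> q.1 = circ i 0 -> psi2 q = psi1 q.
  move=> Fq e; have L := circ_lift Fq e; have [pl s0 sl] := L.
  set s := lift _ _ in L pl s0 sl.
  have [cq sq] := trig_quarter; have pi0 := PI_gt0.
  have E34 : 0 <= (3 / 4 : RR) <= 1 by lra.
  have a1 t : 0 <= t <= 1 -> W1 (s (0 + (3 / 4 - 0) * t)).1.
    move=> /andP[t0 t1]; set u := 0 + _.
    have hu : u = 3 / 4 * t by rewrite /u; cring.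
    have u01 : 0 <= u <= 1 by lra.
    have pt0 : 0 <= PI * t by rewrite mulr_ge0 // ltW.
    have pt1 : PI * t <= PI by rewrite ger_pMr.
    rewrite sl //; split=> //.
      rewrite H_circ; have := COS_bound (PI / 4 + 2 * PI * u); rewrite ?RealsE => -[_ /RleP h].
      by have : eps * cos (PI / 4 + 2 * PI * u) <= eps * 1; [rewrite ler_pM2l | lra].
    rewrite H_circ K_circ => -[k1 k2].
    have k3 : sin (PI / 4 + 2 * PI * u) = 0.
      have /eqP : eps * sin (PI / 4 + 2 * PI * u) = 0 by lra.
      by rewrite mulf_eq0 (gt_eqF e0) => /eqP.
    have k4 : 0 <= cos (PI / 4 + 2 * PI * u).
      have : 0 <= eps * cos (PI / 4 + 2 * PI * u) by lra.
      by rewrite pmulr_rge0.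
    have k5 : cos (PI / 4 + 2 * PI * u) = 1.
      have := md_cis (PI / 4 + 2 * PI * u); rewrite md_def /= k3 expr0n addr0 sqrtr_sqr.
      by rewrite ger0_norm.
    have := @cis_eq1 (PI / 4 + 2 * PI * u); rewrite /cis k3 k5.
    have E : 2 * PI * u = 3 / 2 * (PI * t) by rewrite hu; cfield.
    rewrite E => h; suff : PI / 4 + 3 / 2 * (PI * t) = 0 by lra.
    by apply: h => //; lra.
  have a2 t : 0 <= t <= 1 -> W2 (s (3 / 4 + (1 - 3 / 4) * t)).1.
    move=> /andP[t0 t1]; set u := 3 / 4 + _.
    have hu : u = 3 / 4 + t / 4 by rewrite /u; cfield.
    have u01 : 0 <= u <= 1 by lra.
    have pt0 : 0 <= PI * t by rewrite mulr_ge0 // ltW.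
    have pt1 : PI * t <= PI by rewrite ger_pMr.
    have E : PI / 4 + 2 * PI * u = (PI * t / 2 - PI / 4) + 2 * PI by rewrite hu; cfield.
    have hc : 0 < cos (PI / 4 + 2 * PI * u).
      have -> : cos (PI / 4 + 2 * PI * u) = cos (PI * t / 2 - PI / 4).
        by rewrite E; have := cisD (PI * t / 2 - PI / 4) (2 * PI); rewrite cis_2pi mulr1 => -[].
      have EE : Rdiv PI (IZR 2) = PI / 2 by rewrite RealsE.
      apply/RltP; apply: cos_gt_0; rewrite EE; apply/RltP.
        by change (- (PI / 2) < PI * t / 2 - PI / 4); lra.
      by lra.
    have ec := mulr_gt0 e0 hc.
    rewrite sl //; split=> //; rewrite H_circ; first by lra.
    have := COS_bound (PI / 4 + 2 * PI * u); rewrite ?RealsE => -[_ /RleP h].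
    by have : eps * cos (PI / 4 + 2 * PI * u) <= eps * 1; [rewrite ler_pM2l | lra].
  have b1 := hol_flat f1 pl a1; have b2 := hol_flat f2 pl a2.
  have b3 := hol_seg phi_cocycle 0 (3 / 4) 1 pl.
  rewrite seg01 (period0 Fq e) b1 b2 in b3.
  have um : psi2 (s (3 / 4)) = psi1 (s (3 / 4)).
    apply: up; [exact: pl.2 | by have := a2 0 I0; rewrite mulr0 addr0 |].
    rewrite sl // K_circ.
    have -> : sin (PI / 4 + 2 * PI * (3 / 4)) = - sin (PI / 4).
      have E : PI / 4 + 2 * PI * (3 / 4) = - (PI / 4) + 2 * PI by cfield.
      rewrite E; have := cisD (- (PI / 4)) (2 * PI); rewrite cis_2pi mulr1 => -[_ ->].
      exact: sin_neg.
    by have := mulr_gt0 e0 sq; lra.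
  have e1 : psi2 (s 1) = psi2 q.
    rewrite /s circ_lift1 // (dinv_iter n d2) //.
    by have := W2_G2 0 (a2 1 I1); rewrite mulr1 addrC subrK sl ?I1 // => _; rewrite e;
       have := a2 1 I1; rewrite mulr1 addrC subrK sl ?I1 // /circ mulr1 mulr0 addr0 cisD cis_2pi mulr1.
  rewrite um e1 s0 in b3.
  by apply/eqP; rewrite -subr_eq0 -[X in _ == X]b3; apply/eqP; ring.
have both q : inF q -> W2 q.1 -> K q.1.2 != K (yi i) -> psi2 q = psi1 q.
  move=> Fq Wq kq; case: (ltrgtP (K q.1.2) (K (yi i))) => hk; last by rewrite hk eqxx in kq.
    have [cq sq] := trig_quarter; have [px h1 h2] := Wq.
    pose c0 := circ i 0.
    have Hc : H c0.2 = H (yi i) + eps * cos (PI / 4) by rewrite H_circ mulr0 addr0.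
    have Kc : K c0.2 = K (yi i) - eps * sin (PI / 4) by rewrite K_circ mulr0 addr0.
    have ec := mulr_gt0 e0 cq; have es := mulr_gt0 e0 sq.
    have ec1 : eps * cos (PI / 4) <= eps * 1.
      by rewrite ler_pM2l //; have := COS_bound (PI / 4); rewrite ?RealsE => -[_ /RleP].
    pose f := lin q.1 (c0.1 - q.1.1, c0.2 - q.1.2).
    have Hf t : H (f t).2 = H q.1.2 + t * (H c0.2 - H q.1.2) by rewrite /f /lin HD HZ HB.
    have Kf t : K (f t).2 = K q.1.2 + t * (K c0.2 - K q.1.2) by rewrite /f /lin KD KZ KB.
    have fx t : (f t).1 = x0 by rewrite /f /lin /c0 /= px subrr mulr0 addr0.
    have f2' t : 0 <= t <= 1 -> W2 (f t).
      move=> ht; split=> //; rewrite Hf Hc.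
        have : 0 < (1 - t) * (H q.1.2 - H (yi i)) + t * (eps * cos (PI / 4)).
          by apply: convex_gt0 => //; lra.
        lra.
      have : 0 < (1 - t) * (r - H q.1.2) + t * (r - H (yi i) - eps * cos (PI / 4)).
        by apply: convex_gt0 => //; lra.
      lra.
    have f1' t : 0 <= t <= 1 -> W1 (f t).
      move=> ht; have [_ _ k] := f2' t ht; split=> // -[]; rewrite Kf Kc => k1 _.
      have : 0 < (1 - t) * (K (yi i) - K q.1.2) + t * (eps * sin (PI / 4)).
        by apply: convex_gt0 => //; lra.
      lra.
    have L := lin_lift Fq (fun t ht => W2_inB (f2' t ht)); rewrite -/f in L.
    have g1 := flat_lift f1 L f1'; have g2 := flat_lift f2 L f2'.
    have [pl s0 sl] := L.
    have c1 : psi2 (lift f q 1) = psi1 (lift f q 1).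
      apply: circ0; first exact: pl.2.
      by rewrite sl ?I1 // /f /lin !mul1r ![_ + (_ - _)]addrC !subrK -surjective_pairing.
    by move: g1; rewrite g2 c1 => /addrI /oppr_inj.
  exact: up.
pose psi q := if (K q.1.2 == K (yi i)) && (H (yi i) <= H q.1.2) then psi2 q else psi1 q.
have p2 q : inF q -> W2 q.1 -> psi2 q = psi q.
  move=> Fq Wq; rewrite /psi; case: ifP => // /negbT; rewrite negb_and => /orP[h|].
    exact: both.
  by case: Wq => _ h _; rewrite (ltW h).
have p1 q : inF q -> W1 q.1 -> psi1 q = psi q.
  by move=> Fq [px h1 h2]; rewrite /psi; case: ifP => // /andP[/eqP k1 k2]; case: h2.
have cov p : Om r p -> inB p -> K p.2 != K (yi i) \/ H p.2 < H (yi i) \/ H (yi i) < H p.2.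
  move=> [px hp] Bp; case: (eqVneq (K p.2) (K (yi i))) => hk; last by left.
  right; case: (ltrgtP (H p.2) (H (yi i))) => hh; [by left | by right |].
  by have := fib_inB i Bp px; rewrite (HK_inj hh hk) eqxx.
exists psi; split.
  move=> s ps Ws; apply: (flat_local phi_cocycle ps) => t ht.
  have [[[_ cy] _] _] := ps.
  have g1 : flat W1 psi by apply: flat_ext f1 p1.
  have g2 : flat W2 psi by apply: flat_ext f2 p2.
  have cH := cR_H cy; have cK := cR_K cy.
  have [hk|[hh|hh]] := cov _ (Ws t ht) (inF_inB (ps.2 t)).
  - have [dl dl0 hd] := @cR_near (fun t => `|K (s t).1.2 - K (yi i)|) t 0 (cR_abs (cR_sub cK (cR_cst _)))
      (etrans (normr_gt0 _) (etrans (f_equal negb (subr_eq0 _ _)) hk)).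
    exists dl => //; exists W1 => // t' ht' h; have [px hp] := Ws t' ht'; split=> // -[k _].
    by have := hd t' h; rewrite k subrr normr0 ltxx.
  - have [dl dl0 hd] := @cR_near (fun t => - H (s t).1.2) t (- H (yi i)) (cR_opp cH) (etrans (ltrN2 _ _) hh).
    exists dl => //; exists W1 => // t' ht' h; have [px hp] := Ws t' ht'; split=> // -[_ k].
    by have := hd t' h; rewrite ltrN2 ltNge k.
  have [dl dl0 hd] := @cR_near (fun t => H (s t).1.2) t (H (yi i)) cH hh.
  exists dl => //; exists W2 => // t' ht' h; have [px hp] := Ws t' ht'; split=> //.
  exact: hd.
move=> q Fq Wq; rewrite /psi /=.
case: ifP => [/andP[/eqP k1 k2]|/negbT hn].
  case: Wq => px hp; apply: (d2) => //; split=> //; rewrite lt_def k2 andbT.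
  apply/negP => /eqP hh; have := fib_inB i (inF_inB Fq) px.
  by rewrite (HK_inj hh k1) eqxx.
case: Wq => px hp; apply: (d1) => //; split=> // -[k1 k2].
by move: hn; rewrite k1 eqxx k2.
Qed.

End Step.

Lemma sweep k r : (forall j, 2 * eps <= `|H (yi j) - r|) -> #|[pred i | H (yi i) < r]| = k ->
  exists psi, flat (Om r) psi /\ dinv (Om r) psi.
Proof.
have e0 := eps0; elim: k r => [|k IH] r sep hk.
  apply: flat_Om_base => i; rewrite leNgt; apply/negP => h.
  by have := card0_eq hk i; rewrite !inE h.
have [i0 hi0] : exists i, H (yi i) < r.
  have : leq 1 #|[pred i | H (yi i) < r]| by rewrite hk.
  by case/card_gt0P => j; rewrite inE => hj; exists j.
pose i := [arg max_(j > i0 | H (yi j) < r) H (yi j)]%O.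
have [hi hmax] : H (yi i) < r /\ forall j, H (yi j) < r -> H (yi j) <= H (yi i).
  by rewrite /i; case: arg_maxP => // j hj hm; split.
have below j : H (yi j) < r -> j != i -> H (yi j) <= H (yi i) - 4 * eps.
  move=> hj ji; have := gap ji; have h := hmax j hj.
  by rewrite ler0_norm ?subr_le0 //; lra.
have ir : H (yi i) + 2 * eps <= r.
  by have := sep i; rewrite ler0_norm; lra.
have [j|//|psi0 [f0 d0]] := IH (H (yi i) - 2 * eps).
- case: (eqVneq j i) => [->|ji]; first by rewrite ger0_norm; lra.
  case: (ltP (H (yi j)) r) => hj; first by have hb := below j hj ji; rewrite ler0_norm; lra.
  by rewrite ger0_norm; lra.
- apply/eqP; rewrite -eqSS -hk; apply/eqP; rewrite [RHS](cardD1 i) inE hi add1n; congr _.+1.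
  apply: eq_card => j; rewrite !inE; case: (eqVneq j i) => [->|ji] /=; first by lra.
  case: (ltP (H (yi j)) r) => hj; first by have := below j hj ji; lra.
  by apply/negbTE; rewrite -leNgt; lra.
exact: sweep_step below ir psi0 f0 d0.
Qed.

Lemma fibre_exact : exists psi, flat (fib x0) psi.
Proof.
have e0 := eps0; have [r r0 hr] := exists_max (fun j => H (yi j)).
have hlt j : H (yi j) < r by apply: le_lt_trans (ler_norm _) (hr j).
have [|psi [f d]] := @sweep #|[pred i | H (yi i) < r + 2 * eps]| (r + 2 * eps) _ erefl.
  by move=> j; have h := hlt j; rewrite ler0_norm; lra.
have [||p i _ h|psi' [f' _]] := left_extend (W := fib x0) (r := r + eps) _ _ _ f d; last by exists psi'.
- lra.
- by [].
by have := hlt i; lra.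
Qed.

End Sweep.

Section Cohomology.
Variables (n : nat) (a b : 'I_n -> CC).
Local Notation inB := (inB a b).
Local Notation inF := (inF a b).
Local Notation path := (path a b).
Local Notation lam := (lam a b).
Local Notation is_lift := (is_lift a b).
Local Notation lift := (lift a b).
Hypothesis lines_distinct : forall i j, i != j -> a i = a j -> b i != b j.

Definition windc i (s : RR -> pt) : CC := (winding (fun t => lam i (s t).1))%:C%C.

Lemma windc_cocycle i s : splx2 a b s -> windc i (gface0 s) - windc i (gface1 s) + windc i (gface2 s) = 0.
Proof.
move=> [[cs _] _ Fs]; have sn x : lam i (s x).1 != 0 by apply: inF_inB; exact: Fs.
have [th cth hth] := arg_lift (cC_lam a b i cs) sn.
have ok u w : 0 <= u <= 1 -> 0 <= w <= 1 ->
    lam i (s (u, w)).1 = (md (lam i (s (u, w)).1))%:C%C * cis (th (u, w)).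
  by move=> hu hw; have := hth (u, w); rewrite clamp2_id // /unitsq /= hu.
have cl := clamp01.
have cl' t : 0 <= 1 - clamp t <= 1 by have /andP[? ?] := cl t; apply/andP; split; lra.
have h0 : is_arg (fun t => lam i (gface0 s t).1) (fun t => th (1 - clamp t, clamp t)).
  split; last by move=> t _; exact: ok.
  have cc : cR (fun x => clamp x.1) by apply: cR_clamp; exact: cR_fst.
  by apply: (cR_reparam cth) => //; apply: cR_sub (cR_cst _) _.
have h1 : is_arg (fun t => lam i (gface1 s t).1) (fun t => th (0, clamp t)).
  split; last by move=> t _; apply: ok => //; exact: I0.
  by apply: (cR_reparam cth); [exact: cR_cst | apply: cR_clamp; exact: cR_fst].
have h2 : is_arg (fun t => lam i (gface2 s t).1) (fun t => th (clamp t, 0)).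
  split; last by move=> t _; apply: ok => //; exact: I0.
  by apply: (cR_reparam cth); [apply: cR_clamp; exact: cR_fst | exact: cR_cst].
rewrite /windc (windingE (fun t _ => sn _) h0) (windingE (fun t _ => sn _) h1) (windingE (fun t _ => sn _) h2).
rewrite clamp0 clamp1 subrr subr0 -rmorphB -rmorphD /=; apply: cc_eq => //=; ring.
Qed.

Lemma generic_frame x0 : generic a b x0 -> exists v : CC, exists2 eps : RR, 0 < eps &
  v != 0 /\ forall i j, i != j -> 4 * eps <= `|H v (yi a b x0 i) - H v (yi a b x0 j)|.
Proof.
move=> gx.
have [[i j] /=|v v0 hv] := @generic_dir ('I_n * 'I_n)%type
  (fun ij => if ij.1 == ij.2 then 1 else yi a b x0 ij.1 - yi a b x0 ij.2).
  by case: ifP => [_|/negbT ij]; [rewrite oner_eq0 | rewrite subr_eq0; exact: gx].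
have [[i j] /=|e e0 he] := @exists_pos_min ('I_n * 'I_n)%type
  (fun ij => if ij.1 == ij.2 then 1 else `|H v (yi a b x0 ij.1) - H v (yi a b x0 ij.2)| / 4).
  have := hv (i, j) => /=; case: ifP => [_|/negbT ij] h //.
  by rewrite divr_gt0 // normr_gt0 -HB.
exists v, e => //; split=> // i j ij.
by have := he (i, j); rewrite /= (negbTE ij); lra.
Qed.

Section Circles.
Variables (x0 v : CC) (eps : RR).
Hypothesis v0 : v != 0.
Hypothesis eps0 : 0 < eps.
Hypothesis gap : forall i j, i != j -> 4 * eps <= `|H v (yi a b x0 i) - H v (yi a b x0 j)|.
Local Notation circ := (circ a b x0 v eps).

Definition qcirc i : pt := (circ i 0, n.+1.-root (affQ a b (circ i 0))^-1).

Lemma qcirc_inF i : inF (qcirc i).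
Proof.
rewrite /ginF rootCK //= mulVf //; apply: affQ_neq0 => j.
rewrite lam_circ mulf_neq0 ?cis_neq0 //.
exact: neq0_of_re (circ_re v0 eps0 gap i j 0).
Qed.

Lemma hol_windc_circ i j q : inF q -> q.1 = circ i 0 ->
  hol (windc j) (lift (circ i) q) = (circ_c i j)%:C%C.
Proof.
move=> Fq e; rewrite /hol /windc; congr _%:C%C.
have L := circ_lift v0 eps0 gap Fq e; have [_ _ sl] := L.
apply: (@winding_loop _ _ (circ_g a b x0 v eps i j)); first exact: cC_circ_g.
- by move=> t ht; rewrite clamp_id // sl // lam_circ.
- by move=> t _; exact: circ_re.
exact: circ_g1.
Qed.

End Circles.

Lemma exists_generic : exists x0, generic a b x0.
Proof. by have [rho [x0 [_ _ _ g]]] := exists_far_generic lines_distinct; exists x0. Qed.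

Lemma windc_indep (al : 'I_n -> CC) psi :
  (forall s, path s -> \sum_i al i * hol (windc i) s = psi (s 1) - psi (s 0)) -> forall i, al i = 0.
Proof.
move=> h i; have [x0 gx] := exists_generic.
have [v [eps eps0 [v0 gap]]] := generic_frame gx.
pose q := qcirc x0 v eps i; have Fq := qcirc_inF v0 eps0 gap i.
have step m : psi (deck n (n + m) q) - psi (deck n m q) = al i * (2 * PI)%:C%C.
  have Fm : inF (deck n m q) by exact: deck_inF.
  have L := circ_lift v0 eps0 gap Fm (erefl (circ a b x0 v eps i 0)).
  have [pl s0 _] := L; have := h _ pl.
  rewrite s0 (circ_lift1 v0 eps0 gap Fm (erefl (circ a b x0 v eps i 0))) deckD => <-.
  rewrite (bigD1 i) //= big1 ?addr0 => [|j ji].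
    by rewrite (hol_windc_circ v0 eps0 gap) // /circ_c eqxx.
  by rewrite (hol_windc_circ v0 eps0 gap) // /circ_c (negbTE ji) mulr0.
have tel k : psi (deck n (k * n) q) - psi q = k%:R * (al i * (2 * PI)%:C%C).
  elim: k => [|k IH]; first by rewrite mul0n deck0 subrr mul0r.
  by rewrite -natr1 mulrDl mul1r -IH -(step (k * n)%nat) mulSn; ring.
have := tel n.+1; rewrite (@deck_period n (n.+1 * n) 0) ?modnMr ?mod0n // deck0 subrr.
  move/esym/eqP; rewrite !mulf_eq0 pnatr_eq0 /= => /orP[/eqP//|].
  by rewrite eq_complex /= eqxx andbT mulf_eq0 pnatr_eq0 /= gt_eqF // PI_gt0.
Qed.

Hypothesis mult_coprime : forall i, coprime n.+1 (slope_mult a (a i)).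

Section Span.
Variable phi : (RR -> pt) -> CC.
Hypothesis phi_cocycle : forall s, splx2 a b s -> phi (gface0 s) - phi (gface1 s) + phi (gface2 s) = 0.

Definition avg (s : RR -> pt) : CC := n.+1%:R^-1 * \sum_(k < n.+1) phi (fun t => deck n k (s t)).

Lemma nz_deg : n.+1%:R != 0 :> CC. Proof. by rewrite pnatr_eq0. Qed.

Lemma avg_cocycle s : splx2 a b s -> avg (gface0 s) - avg (gface1 s) + avg (gface2 s) = 0.
Proof.
move=> hs; rewrite /avg -mulrBr -mulrDr -sumrB -big_split /= big1 ?mulr0 // => k _.
exact: phi_cocycle (splx2_deck k hs).
Qed.

Lemma avg_deck s : avg (fun t => deck n 1 (s t)) = avg s.
Proof.
rewrite /avg; congr (_ * _).
rewrite (eq_bigr (fun k : 'I_n.+1 => phi (fun t => deck n k.+1 (s t)))) => [|k _]; last first.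
  by congr phi; apply: funext => t; rewrite deckD addn1.
rewrite big_ord_recr big_ord_recl /= addrC; congr (phi _ + _).
by apply: funext => t; apply: deck_period; rewrite modnn mod0n.
Qed.

Lemma avg_cohomologous : exists psi, forall s, path s -> hol avg s - hol phi s = psi (s 1) - psi (s 0).
Proof.
have [psi hpsi] := twist_exact phi_cocycle lines_distinct mult_coprime.
have step k s : path s -> hol phi (fun t => deck n k (s t)) - hol phi s =
    \sum_(j < k) (psi (deck n j (s 1)) - psi (deck n j (s 0))).
  move=> ps; elim: k => [|k IH].
    by rewrite big_ord0 (@hol_eq phi _ s) ?subrr // => t _; rewrite deck0.
  rewrite big_ord_recr /= -IH -(hpsi _ (path_deck k ps)) // /hol /twist.
  rewrite (_ : (fun t => deck n 1 (deck n k (s (clamp t)))) = (fun t => deck n k.+1 (s (clamp t)))).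
    by rewrite addrC addrA subrK.
  by apply: funext => t; rewrite deckD add1n.
exists (fun q => n.+1%:R^-1 * \sum_(k < n.+1) \sum_(j < k) psi (deck n j q)) => s ps.
rewrite -mulrBr -sumrB; have -> : hol avg s = n.+1%:R^-1 * \sum_(k < n.+1) hol phi (fun t => deck n k (s t)) by [].
have {1}-> : hol phi s = n.+1%:R^-1 * \sum_(k < n.+1) hol phi s.
  by rewrite sumr_const card_ord -[hol phi s *+ _]mulr_natl mulKf // nz_deg.
rewrite -mulrBr -sumrB; congr (_ * _); apply: eq_bigr => k _.
by rewrite step // sumrB.
Qed.

Theorem windc_span : exists al psi, forall s, path s ->
  hol phi s = \sum_i al i * hol (windc i) s + (psi (s 1) - psi (s 0)).
Proof.
have [psi1 h1] := avg_cohomologous.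
have [x0 gx] := exists_generic.
have [v [eps eps0 [v0 gap]]] := generic_frame gx.
pose circ := circ a b x0 v eps.
pose al i : CC := hol avg (lift (circ i) (qcirc x0 v eps i)) / (2 * PI)%:C%C.
pose phi1 s := avg s - \sum_i al i * windc i s.
have c1 s : splx2 a b s -> phi1 (gface0 s) - phi1 (gface1 s) + phi1 (gface2 s) = 0.
  move=> hs; have e1 := avg_cocycle hs.
  have e2 : \sum_i al i * windc i (gface0 s) - \sum_i al i * windc i (gface1 s)
     + \sum_i al i * windc i (gface2 s) = 0.
    rewrite -sumrB -big_split big1 //= => i _.
    by rewrite -mulrBr -mulrDr windc_cocycle // mulr0.
  rewrite /phi1; move: e1 e2; set A0 := avg _; set A1 := avg _; set A2 := avg _.
  set S0 := \sum_i _; set S1 := \sum_i _; set S2 := \sum_i _ => e1 e2.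
  by transitivity (A0 - A1 + A2 - (S0 - S1 + S2)); [ring | rewrite e1 e2 subrr].
have d1 s : phi1 (fun t => deck n 1 (s t)) = phi1 s by rewrite /phi1 avg_deck.
have dk k s : hol phi1 (fun t => deck n k (s t)) = hol phi1 s.
  elim: k => [|k IH]; first by apply: hol_eq => t _; rewrite deck0.
  rewrite -IH -[RHS](d1 (fun t => deck n k (s (clamp t)))).
  by congr phi1; apply: funext => t; rewrite deckD add1n.
have hol1 s : hol phi1 s = hol avg s - \sum_i al i * hol (windc i) s by [].
have per i q : inF q -> q.1 = circ i 0 -> hol phi1 (lift (circ i) q) = 0.
  move=> Fq e; have F0 := qcirc_inF v0 eps0 gap i.
  have [j ->] := fibre_deck F0 Fq (esym e).
  have L := circ_lift v0 eps0 gap F0 (erefl (circ i 0)).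
  rewrite (hol_eq phi1 (lift_eq (lift_deck j L))) dk hol1 (bigD1 i) //= big1 => [|k ki].
    rewrite addr0 (hol_windc_circ v0 eps0 gap) // /circ_c eqxx divfK ?subrr //.
    by rewrite eq_complex /= eqxx andbT mulf_eq0 pnatr_eq0 /= gt_eqF // PI_gt0.
  by rewrite (hol_windc_circ v0 eps0 gap) // /circ_c (negbTE ki) mulr0.
have [psi0 f0] := fibre_exact c1 d1 v0 eps0 gap per.
have [psi f] := lefschetz c1 lines_distinct gx f0.
exists al, (fun q => psi q - psi1 q) => s ps.
have := f s ps (fun _ _ => Logic.I); rewrite hol1 => e.
have e' := h1 s ps.
have -> : hol phi s = hol avg s - (psi1 (s 1) - psi1 (s 0)) by rewrite -e'; ring.
by move/(canRL (subrK _)): e => ->; ring.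
Qed.

End Span.
End Cohomology.

Definition o0 : 'I_3 := @Ordinal 3 0 isT.
Definition o1 : 'I_3 := @Ordinal 3 1 isT.
Definition o2 : 'I_3 := @Ordinal 3 2 isT.

Lemma sum3 (V : nmodType) (F : 'I_3 -> V) : \sum_i F i = F o0 + F o1 + F o2.
Proof.
rewrite !big_ord_recr big_ord0 /= add0r.
by congr (F _ + F _ + F _); apply: val_inj.
Qed.

Lemma ord3P (P : 'I_3 -> Prop) : P o0 -> P o1 -> P o2 -> forall i, P i.
Proof.
move=> p0 p1 p2 [[|[|[|//]]] h]; [have -> : Ordinal h = o0 by exact: val_inj
  | have -> : Ordinal h = o1 by exact: val_inj | have -> : Ordinal h = o2 by exact: val_inj] => //.
Qed.

Lemma cont2P (s : RR * RR -> 'cV[CC]_3) : cont2 s <-> forall j, cC (fun x => s x j 0).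
Proof.
split=> [h j|h x e e0].
  by split=> x e e0; have [dl dl0 hd] := h x e e0; exists dl => // y k1 k2;
    [exact: (hd y k1 k2 j false) | exact: (hd y k1 k2 j true)].
have /choice[d hd] : forall jb : 'I_3 * bool, exists dl : RR, 0 < dl /\ forall y : RR * RR,
    `|y.1 - x.1| < dl -> `|y.2 - x.2| < dl -> `|rcoord (s y) jb.1 jb.2 - rcoord (s x) jb.1 jb.2| < e.
  move=> [j c]; have [h1 h2] := h j; case: c.
    by have [dl dl0 k] := h2 x e e0; exists dl.
  by have [dl dl0 k] := h1 x e e0; exists dl.
have [r r0 hr] := exists_pos_min (fun jb => (hd jb).1).
exists r => // y k1 k2 j c; have [_ k] := hd (j, c).
by apply: (k y); apply: lt_le_trans (hr (j, c)).
Qed.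

Lemma cont1P (s : RR -> 'cV[CC]_3) : cont1 s <-> forall j, cC (fun x => s x.1 j 0).
Proof.
split=> [h j|h x e e0].
  by split=> x e e0; have [dl dl0 hd] := h x.1 e e0; exists dl => // y k1 k2;
    [exact: (hd y.1 k1 j false) | exact: (hd y.1 k1 j true)].
have [dl dl0 hd] := (cont2P (fun x => s x.1)).2 h (x, 0) e e0.
by exists dl => // y hy; apply: (hd (y, 0)); rewrite //= subrr normr0.
Qed.

Section Transport.
Variables (n : nat) (a b : 'I_n -> CC) (f : {mpoly CC[3]}) (G : 'M[CC]_3).
Hypothesis lines_distinct : forall i j, i != j -> a i = a j -> b i != b j.
Hypothesis mult_coprime : forall i, coprime n.+1 (slope_mult a (a i)).
Hypothesis unitG : G \in unitmx.
Hypothesis evalG : forall w : 'cV[CC]_3,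
  evalp f (G *m w) = w o2 0 * \prod_i (w o1 0 - a i * w o0 0 - b i * w o2 0).

Definition hcoord (q : pt) : 'cV[CC]_3 := \col_j nth 0 [:: q.2 * q.1.1; q.2 * q.1.2; q.2] j.
Definition of_model (q : pt) : 'cV[CC]_3 := G *m hcoord q.
Definition to_model (p : 'cV[CC]_3) : pt :=
  let w := invmx G *m p in (w o0 0 / w o2 0, w o1 0 / w o2 0, w o2 0).

Lemma eval_of_model q : evalp f (of_model q) = q.2 ^+ n.+1 * affQ a b q.1.
Proof.
rewrite evalG !mxE /= exprS -mulrA; congr (_ * _).
have -> : q.2 ^+ n = \prod_(i < n) q.2 by rewrite prodr_const card_ord.
rewrite /affQ -big_split /=.
by apply: eq_bigr => i _; rewrite /lam; ring.
Qed.

Lemma of_modelK q : q.2 != 0 -> to_model (of_model q) = q.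
Proof.
move=> h; rewrite /to_model /of_model mulKmx // !mxE /=.
by case: q h => [[x y] t] /= h; rewrite ![t * _]mulrC !mulfK.
Qed.

Lemma F_neq0 p : evalp f p = 1 -> (invmx G *m p) o2 0 != 0.
Proof.
move=> h; have := evalG (invmx G *m p); rewrite mulKVmx // h => /esym e.
by apply: contra_eq_neq e => ->; rewrite mul0r eq_sym oner_neq0.
Qed.

Lemma to_modelK p : evalp f p = 1 -> of_model (to_model p) = p.
Proof.
move=> h; have := F_neq0 h; rewrite /of_model /to_model -[RHS](mulKVmx unitG).
move: (invmx G *m p) => w w2; congr (_ *m _).
by apply/colP; apply: ord3P; rewrite !mxE //= mulrC divfK.
Qed.

Lemma to_model_inF p : evalp f p = 1 -> inF a b (to_model p).
Proof. by move=> h; rewrite /inF -eval_of_model to_modelK. Qed.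

Lemma cC_of_model (s : RR * RR -> pt) : cP s -> forall j, cC (fun x => of_model (s x) j 0).
Proof.
move=> [[c1 c2] c3] j.
apply: (@eq_cC (fun x => \sum_k G j k * hcoord (s x) k 0)) => [x|]; first by rewrite mxE.
apply: cC_sum => k; apply: cC_mul (cC_cst _) _; move: k; apply: ord3P.
- by apply: eq_cC (cC_mul c3 c1) => x; rewrite mxE.
- by apply: eq_cC (cC_mul c3 c2) => x; rewrite mxE.
by apply: eq_cC c3 => x; rewrite mxE.
Qed.

Lemma cP_to_model (s : RR * RR -> 'cV[CC]_3) : (forall j, cC (fun x => s x j 0)) ->
  (forall x, evalp f (s x) = 1) -> cP (fun x => to_model (s x)).
Proof.
move=> cs Fs.
have cw k : cC (fun x => (invmx G *m s x) k 0).
  apply: (@eq_cC (fun x => \sum_l invmx G k l * s x l 0)) => [x|]; first by rewrite mxE.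
  by apply: cC_sum => l; apply: cC_mul (cC_cst _) _.
have ci : cC (fun x => ((invmx G *m s x) o2 0)^-1) by apply: cC_inv => // x; exact: F_neq0.
by split; [split; exact: cC_mul | exact: cw].
Qed.

Lemma splx1_to s : simplex1 f s -> splx1 a b (fun t => to_model (s t)).
Proof.
move=> [/cont1P cs sc Fs]; split; last by move=> t; rewrite -sc.
split; last by move=> t; exact: to_model_inF.
exact: (cP_to_model (s := fun x => s x.1)).
Qed.

Lemma splx2_to s : simplex2 f s -> splx2 a b (fun t => to_model (s t)).
Proof.
move=> [/cont2P cs sc Fs]; split; first exact: cP_to_model.
- by move=> x; rewrite -sc.
by move=> x; exact: to_model_inF.
Qed.

Lemma splx1_of s : splx1 a b s -> simplex1 f (fun t => of_model (s t)).
Proof.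
move=> [[cs Fs] sc]; split; last by move=> t; rewrite eval_of_model; exact: Fs.
- apply/cont1P => j; exact: (cC_of_model (s := fun x => s x.1)).
by move=> t; rewrite -sc.
Qed.

Lemma splx2_of s : splx2 a b s -> simplex2 f (fun t => of_model (s t)).
Proof.
move=> [cs sc Fs]; split; last by move=> t; rewrite eval_of_model; exact: Fs.
- by apply/cont2P; exact: cC_of_model.
by move=> t; rewrite -sc.
Qed.

Lemma char_poly1 (R : comNzRingType) m : char_poly (1%:M : 'M[R]_m) = ('X - 1) ^+ m.
Proof.
rewrite /char_poly /char_poly_mx map_scalar_mx /= -raddfB /= det_scalar.
by rewrite polyC1.
Qed.

Theorem alexander_trivial_monodromy : alexander_poly_is f n.+1 (('X - 1) ^+ n).
Proof.
pose c i (s : RR -> 'cV[CC]_3) := windc a b i (fun t => to_model (s t)).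
exists n, c, 1%:M; split.
- by move=> i s /splx2_to hs; have := windc_cocycle i hs.
- move=> phi hphi.
  have [s hs|al [psi h]] := windc_span (phi := fun s => phi (fun t => of_model (s t))) lines_distinct mult_coprime.
    exact: hphi (splx2_of hs).
  exists al, (fun p => psi (to_model p)) => s ss.
  have [[ps sc]] := (splx1_to ss, ss) => -[_ _ Fs].
  have := h _ ps; rewrite /hol.
  have E : (fun t => of_model (to_model (s (clamp t)))) = s.
    by apply: funext => t; rewrite to_modelK //; case: ss => _ <-.
  have EA : \sum_i al i * windc a b i (fun t => to_model (s (clamp t))) = lincomb al c s.
    apply: eq_bigr => i _; congr (_ * windc a b i _); apply: funext => t; exact: esym (sc t).
  by rewrite E EA => ->; rewrite addrAC subrr add0r.
- move=> al [psi h]; apply: (windc_indep lines_distinct (psi := fun q => psi (of_model q))) => s ps.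
  have ss : splx1 a b (fun t => s (clamp t)) by split; [exact: path_clamp | move=> t; rewrite clampK].
  have := h _ (splx1_of ss); rewrite subr0 clamp1 clamp0 => <-.
  rewrite /lincomb; apply: eq_bigr => i _; rewrite /c /hol; congr (_ * windc a b i _).
  by apply: funext => t; rewrite of_modelK //; apply: (inF_neq0 (a := a) (b := b)); exact: ps.2.
- move=> i; exists (fun _ => 0) => s ss; rewrite subrr; apply/eqP; rewrite subr_eq0; apply/eqP.
  rewrite /lincomb (bigD1 i) //= mxE eqxx mul1r big1 ?addr0 => [|j ji]; last first.
    by rewrite mxE eq_sym (negbTE ji) mul0r.
  rewrite /monodromy_pullback /c /windc; congr (winding _)%:C%C; apply: funext => t; congr (lam _ _ _ _).
  have z0 : zeta n.+1 != 0 by rewrite zetaE cis_neq0.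
  rewrite /to_model -scalemxAr !mxE.
  by rewrite -!mulf_div divff // !mul1r.
by exact: char_poly1.
Qed.

End Transport.

(** * The 57 lines *)

(* The pair (a, b) stands for a + b w, where w^2 + w + 1 = 0. *)
Definition eis := (Z * Z)%type.
Definition eadd (p q : eis) : eis := (Z.add p.1 q.1, Z.add p.2 q.2).
Definition esub (p q : eis) : eis := (Z.sub p.1 q.1, Z.sub p.2 q.2).
Definition emul (p q : eis) : eis :=
  (Z.sub (Z.mul p.1 q.1) (Z.mul p.2 q.2),
   Z.sub (Z.add (Z.mul p.1 q.2) (Z.mul p.2 q.1)) (Z.mul p.2 q.2)).
Definition eis0 (p : eis) : bool := Z.eqb p.1 Z0 && Z.eqb p.2 Z0.

Definition vec3 (T : Type) := (T * T * T)%type.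
Definition ecross (u v : vec3 eis) : vec3 eis :=
  let: (u0, u1, u2) := u in let: (v0, v1, v2) := v in
  (esub (emul u1 v2) (emul u2 v1), esub (emul u2 v0) (emul u0 v2), esub (emul u0 v1) (emul u1 v0)).
Definition edot (u v : vec3 eis) : eis :=
  let: (u0, u1, u2) := u in let: (v0, v1, v2) := v in
  eadd (eadd (emul u0 v0) (emul u1 v1)) (emul u2 v2).
Definition enull (u : vec3 eis) : bool := let: (u0, u1, u2) := u in [&& eis0 u0, eis0 u1 & eis0 u2].

Section EisEval.
Variable w : CC.
Hypothesis hw : w ^+ 2 + w + 1 = 0.

Definition zC (z : Z) : CC := (IZR z)%:C%C.
Definition ev (p : eis) : CC := zC p.1 + zC p.2 * w.

Lemma zC_add x y : zC (Z.add x y) = zC x + zC y.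
Proof. by rewrite /zC plus_IZR RealsE rmorphD. Qed.
Lemma zC_sub x y : zC (Z.sub x y) = zC x - zC y.
Proof. by rewrite /zC minus_IZR RealsE rmorphB. Qed.
Lemma zC_mul x y : zC (Z.mul x y) = zC x * zC y.
Proof. by rewrite /zC mult_IZR RealsE rmorphM. Qed.

Lemma ev_add p q : ev (eadd p q) = ev p + ev q.
Proof. by rewrite /ev /= !zC_add; ring. Qed.
Lemma ev_sub p q : ev (esub p q) = ev p - ev q.
Proof. by rewrite /ev /= !zC_sub; ring. Qed.
Lemma ev_mul p q : ev (emul p q) = ev p * ev q.
Proof.
rewrite /ev /= !(zC_sub, zC_add, zC_mul); set a := zC p.1; set b := zC p.2; set c := zC q.1; set d := zC q.2.
have -> : (a + b * w) * (c + d * w) = (a * c - b * d) + (a * d + b * c - b * d) * w + b * d * (w ^+ 2 + w + 1) by ring.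
by rewrite hw mulr0 addr0.
Qed.

Lemma im_w : im w != 0.
Proof.
apply/negP => /eqP h; have := congr1 re hw; rewrite expr2 !(reD, reM) h mulr0 subr0 /=.
by have := sqr_ge0 (re w + 1 / 2); nra.
Qed.

Lemma zC_eq0 z : (IZR z == 0) = Z.eqb z Z0.
Proof.
apply/eqP/idP => [h|/Z.eqb_eq -> //]; apply/Z.eqb_eq; exact: eq_IZR_R0.
Qed.

Lemma ev_eq0 p : (ev p == 0) = eis0 p.
Proof.
rewrite /eis0 -!zC_eq0; apply/eqP/andP => [h|[/eqP h1 /eqP h2]]; last by rewrite /ev /zC h1 h2 !rmorph0 mul0r addr0.
have := congr1 im h; rewrite /ev /zC imD imM imR reR /= add0r mul0r addr0 => /eqP.
rewrite mulf_eq0 (negbTE im_w) orbF => /eqP h2; rewrite h2 eqxx; split=> //.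
by have := congr1 re h; rewrite /ev /zC h2 reD reM !reR !imR !mul0r subr0 addr0 => ->.
Qed.

End EisEval.

Section Vectors.
Variable F : fieldType.
Implicit Types u v w : 'rV[F]_3.

Definition mkrow (x y z : F) : 'rV[F]_3 := \row_j nth 0 [:: x; y; z] j.
Definition cross u v : 'rV[F]_3 :=
  mkrow (u 0 o1 * v 0 o2 - u 0 o2 * v 0 o1) (u 0 o2 * v 0 o0 - u 0 o0 * v 0 o2)
        (u 0 o0 * v 0 o1 - u 0 o1 * v 0 o0).
Definition dot u v : F := u 0 o0 * v 0 o0 + u 0 o1 * v 0 o1 + u 0 o2 * v 0 o2.

Lemma mkrow0 x y z : mkrow x y z 0 o0 = x. Proof. by rewrite mxE. Qed.
Lemma mkrow1 x y z : mkrow x y z 0 o1 = y. Proof. by rewrite mxE. Qed.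
Lemma mkrow2 x y z : mkrow x y z 0 o2 = z. Proof. by rewrite mxE. Qed.
Definition mkrowE := (mkrow0, mkrow1, mkrow2).

Lemma row3P u v : u 0 o0 = v 0 o0 -> u 0 o1 = v 0 o1 -> u 0 o2 = v 0 o2 -> u = v.
Proof. by move=> h0 h1 h2; apply/rowP; exact: ord3P. Qed.

Lemma row3_eq0 u : (u == 0) = [&& u 0 o0 == 0, u 0 o1 == 0 & u 0 o2 == 0].
Proof.
apply/eqP/and3P => [->|[/eqP h0 /eqP h1 /eqP h2]]; first by rewrite !mxE.
by apply: row3P; rewrite ?mxE.
Qed.

Lemma cross_scale u v c d : cross (c *: u) (d *: v) = (c * d) *: cross u v.
Proof. by apply: row3P; rewrite /cross !mxE /=; ring. Qed.

Lemma dot_scale u v c d : dot (c *: u) (d *: v) = c * d * dot u v.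
Proof. by rewrite /dot !mxE; ring. Qed.

Lemma cross0_prop u v : u != 0 -> cross u v = 0 -> exists c, v = c *: u.
Proof.
move=> u0 h.
have e0 : u 0 o1 * v 0 o2 = u 0 o2 * v 0 o1.
  by apply/eqP; rewrite -subr_eq0; have := congr1 (fun w => w 0 o0) h; rewrite /cross mkrow0 mxE => ->.
have e1 : u 0 o2 * v 0 o0 = u 0 o0 * v 0 o2.
  by apply/eqP; rewrite -subr_eq0; have := congr1 (fun w => w 0 o1) h; rewrite /cross mkrow1 mxE => ->.
have e2 : u 0 o0 * v 0 o1 = u 0 o1 * v 0 o0.
  by apply/eqP; rewrite -subr_eq0; have := congr1 (fun w => w 0 o2) h; rewrite /cross mkrow2 mxE => ->.
case: (eqVneq (u 0 o0) 0) => n0; last first.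
  by exists (v 0 o0 / u 0 o0); apply: row3P; rewrite mxE; apply: (mulfI n0);
     rewrite mulrA mulrCA divff // mulr1 ?e2 -?e1 // mulrC.
case: (eqVneq (u 0 o1) 0) => n1; last first.
  by exists (v 0 o1 / u 0 o1); apply: row3P; rewrite mxE; apply: (mulfI n1);
     rewrite mulrA mulrCA divff // mulr1 -?e2 ?e0 // mulrC.
case: (eqVneq (u 0 o2) 0) => n2; first by move: u0; rewrite row3_eq0 n0 n1 n2 eqxx.
by exists (v 0 o2 / u 0 o2); apply: row3P; rewrite mxE; apply: (mulfI n2);
   rewrite mulrA mulrCA divff // mulr1 ?e1 -?e0 // mulrC.
Qed.

Lemma orth2_prop x y u : cross x y != 0 -> dot u x = 0 -> dot u y = 0 -> exists c, u = c *: cross x y.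
Proof.
move=> n h1 h2; apply: cross0_prop => //; apply: row3P; rewrite /cross !mkrowE mxE.
- have -> : (x 0 o2 * y 0 o0 - x 0 o0 * y 0 o2) * u 0 o2 - (x 0 o0 * y 0 o1 - x 0 o1 * y 0 o0) * u 0 o1
    = y 0 o0 * dot u x - x 0 o0 * dot u y by rewrite /dot; ring.
  by rewrite h1 h2 !mulr0 subr0.
- have -> : (x 0 o0 * y 0 o1 - x 0 o1 * y 0 o0) * u 0 o0 - (x 0 o1 * y 0 o2 - x 0 o2 * y 0 o1) * u 0 o2
    = y 0 o1 * dot u x - x 0 o1 * dot u y by rewrite /dot; ring.
  by rewrite h1 h2 !mulr0 subr0.
have -> : (x 0 o1 * y 0 o2 - x 0 o2 * y 0 o1) * u 0 o1 - (x 0 o2 * y 0 o0 - x 0 o0 * y 0 o2) * u 0 o0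
  = y 0 o2 * dot u x - x 0 o2 * dot u y by rewrite /dot; ring.
by rewrite h1 h2 !mulr0 subr0.
Qed.

Lemma rank2_cross u v : u != 0 -> (\rank (col_mx u v) == 2%nat) = (cross u v != 0).
Proof.
move=> u0; have ru : \rank u = 1%nat by rewrite rank_rV u0.
have E : \rank (col_mx u v) = \rank (u + v)%MS by rewrite addsmxE.
rewrite E; case: (boolP (v <= u)%MS) => [/sub_rVP[c ->]|h].
  have -> : cross u (c *: u) = 0 by apply: row3P; rewrite /cross !mxE /=; ring.
  rewrite eqxx; apply/negP => /eqP h.
  have : (u + c *: u <= u)%MS by rewrite addsmx_sub submx_refl scalemx_sub.
  by move/mxrankS; rewrite h ru.
have n : cross u v != 0.
  apply: contra h => /eqP h; have [c ->] := cross0_prop u0 h; exact: scalemx_sub.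
rewrite n eqn_leq; apply/andP; split.
  by rewrite -E; exact: rank_leq_row.
have [le eq] := mxrank_leqif_sup (addsmxSl u v).
rewrite ru in le eq.
by rewrite ltn_neqAle le andbT eq addsmx_sub submx_refl.
Qed.

Definition trip u v w := dot u (cross v w).

Lemma det_rows (a b c : 'rV[F]_3) :
  \det (\matrix_(r < 3, k < 3) (nth a [:: a; b; c] r) 0 k) = trip a b c.
Proof.
have l1 : fintype.lift (fintype.lift ord0 ord0 : 'I_2) (0 : 'I_1) = ord0 by exact: val_inj.
have l2 : fintype.lift o0 ord0 = o1 by exact: val_inj.
have l3 (x : 'I_1) : fintype.lift o0 (fintype.lift ord0 x) = o2 by apply: val_inj; rewrite /= (ord1 x).
have l4 : fintype.lift o1 ord0 = o0 by exact: val_inj.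
have l5 (x : 'I_1) : fintype.lift o1 (fintype.lift ord0 x) = o2 by apply: val_inj; rewrite /= (ord1 x).
have l6 : fintype.lift o2 ord0 = o0 by exact: val_inj.
have l7 (x : 'I_1) : fintype.lift o2 (fintype.lift ord0 x) = o1 by apply: val_inj; rewrite /= (ord1 x).
rewrite (expand_det_row _ o0) sum3 /cofactor !(expand_det_row _ ord0) !big_ord_recl !big_ord0.
rewrite /cofactor !det_mx11 !mxE /= !(l1, l2, l3, l4, l5, l6, l7).
by rewrite /trip /dot /cross !mkrowE; ring.
Qed.

Lemma trip_mulmx u v w (g : 'M[F]_3) : trip (u *m g) (v *m g) (w *m g) = trip u v w * \det g.
Proof.
rewrite -!det_rows -det_mulmx; congr (\det _); apply/matrixP => r k; rewrite !mxE.
by case: r => [[|[|[|]]] //] h; rewrite /= mxE; apply: eq_bigr => l _; rewrite !mxE.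
Qed.

Lemma trip_scale u v w a b c : trip (a *: u) (b *: v) (c *: w) = a * b * c * trip u v w.
Proof. by rewrite /trip cross_scale dot_scale mulrA. Qed.

End Vectors.

Lemma rows3E n (L : 'I_n -> 'rV[CC]_3) i j k : \det (rows3 L i j k) = trip (L i) (L j) (L k).
Proof.
rewrite -det_rows; congr (\det _); apply/matrixP => r c; rewrite !mxE.
by case: r => [[|[|[|]]] //].
Qed.

Definition evrow (w : CC) (u : vec3 eis) : 'rV[CC]_3 :=
  let: (u0, u1, u2) := u in mkrow (ev w u0) (ev w u1) (ev w u2).

Section EisVectors.
Variable w : CC.
Hypothesis hw : w ^+ 2 + w + 1 = 0.

Lemma evrow_cross u v : evrow w (ecross u v) = cross (evrow w u) (evrow w v).
Proof.
case: u v => [[u0 u1] u2] [[v0 v1] v2]; apply: row3P; rewrite /cross !mkrowE /=.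
- by rewrite !(ev_sub, ev_mul hw) ?mkrowE.
- by rewrite !(ev_sub, ev_mul hw) ?mkrowE.
by rewrite !(ev_sub, ev_mul hw) ?mkrowE.
Qed.

Lemma ev_dot u v : ev w (edot u v) = dot (evrow w u) (evrow w v).
Proof.
by case: u v => [[u0 u1] u2] [[v0 v1] v2]; rewrite /dot /= !(ev_add, ev_mul hw) !mkrowE.
Qed.

Lemma evrow_eq0 u : (evrow w u == 0) = enull u.
Proof. by case: u => [[u0 u1] u2]; rewrite row3_eq0 /= !mkrowE !(ev_eq0 hw). Qed.

Definition etrip u v x := edot u (ecross v x).

Lemma ev_trip u v x : (trip (evrow w u) (evrow w v) (evrow w x) == 0) = eis0 (etrip u v x).
Proof. by rewrite -(ev_eq0 hw) ev_dot evrow_cross. Qed.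

End EisVectors.

Definition e_zero : eis := (Z0, Z0).
Definition e_one : eis := (Zpos xH, Z0).
Definition e_w : eis := (Z0, Zpos xH).
Definition e_w2 : eis := (Zneg xH, Zneg xH).
Definition e_opp (p : eis) : eis := (Z.opp p.1, Z.opp p.2).
Definition cube_roots : seq eis := [:: e_one; e_w; e_w2].

(* The 12 lines of the Hesse arrangement, then the 9 mirrors of order two of
   the Hessian group, then the 36 lines joining a quadruple point of the Hesse
   arrangement to one of the vertices of its four triangles. *)
Definition lines57 : seq (vec3 eis) :=
  [:: (e_one, e_zero, e_zero); (e_zero, e_one, e_zero); (e_zero, e_zero, e_one)]
  ++ [seq (e_one, x, y) | x <- cube_roots, y <- cube_roots]
  ++ [seq (e_one, e_opp x, e_zero) | x <- cube_roots]
  ++ [seq (e_zero, e_one, e_opp x) | x <- cube_roots]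
  ++ [seq (e_opp x, e_zero, e_one) | x <- cube_roots]
  ++ [seq (e_one, x, e_zero) | x <- cube_roots]
  ++ [seq (e_zero, e_one, x) | x <- cube_roots]
  ++ [seq (x, e_zero, e_one) | x <- cube_roots]
  ++ [seq ((Zpos (xO xH), Z0), e_opp x, e_opp y) | x <- cube_roots, y <- cube_roots]
  ++ [seq (e_opp x, (Zpos (xO xH), Z0), e_opp y) | x <- cube_roots, y <- cube_roots]
  ++ [seq (e_opp x, e_opp y, (Zpos (xO xH), Z0)) | x <- cube_roots, y <- cube_roots].

Definition eline (i : nat) : vec3 eis := nth (e_zero, e_zero, e_zero) lines57 i.

Definition hess (w : CC) (i : 'I_57) : 'rV[CC]_3 := evrow w (eline i).

Definition omega : CC := ((- (1 / 2)) +i* (Num.sqrt 3 / 2))%C.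

Lemma omega_root : omega ^+ 2 + omega + 1 = 0.
Proof.
have h : Num.sqrt 3 ^+ 2 = 3 :> RR by rewrite sqr_sqrtr.
rewrite expr2; apply: cc_eq; rewrite !(reD, imD, reM, imM) /= ?RealsE; last by cfield.
transitivity (3 / 4 - (Num.sqrt 3 ^+ 2) / 4 : RR); first by cfield.
by rewrite h subrr.
Qed.

Definition L57 : 'I_57 -> 'rV[CC]_3 := hess omega.

Definition concur (i j k : nat) : bool := eis0 (etrip (eline i) (eline j) (eline k)).

Lemma all_iota (P : pred nat) m : all P (iota 0 m) -> forall i, (i < m)%nat -> P i.
Proof. by move=> /allP h i im; apply: h; rewrite mem_iota. Qed.

Lemma lines57_nonzero i : (i < 57)%nat -> ~~ enull (eline i).
Proof. by move: i; apply: all_iota; vm_compute. Qed.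

Lemma lines57_distinct i j : (i < 57)%nat -> (j < 57)%nat -> i != j ->
  ~~ enull (ecross (eline i) (eline j)).
Proof.
have h : all (fun i => all (fun j => (i == j) || ~~ enull (ecross (eline i) (eline j))) (iota 0 57)) (iota 0 57).
  by vm_compute.
move=> hi hj /negbTE ne; have := all_iota (all_iota h hi) hj.
by rewrite ne.
Qed.

Lemma L57_arrangement : line_arrangement L57.
Proof.
have n0 i : L57 i != 0 by rewrite (evrow_eq0 omega_root) lines57_nonzero.
split=> // i j ij; apply/eqP; rewrite rank2_cross //.
by rewrite -(evrow_cross omega_root) (evrow_eq0 omega_root) lines57_distinct.
Qed.

Definition mlist (i j : nat) : seq nat := [seq k <- iota 0 57 | concur k i j].
Definition mlists : seq (seq nat) :=
  undup (flatten [seq [seq mlist i j | j <- iota i.+1 (57 - i.+1)] | i <- iota 0 57]).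
Definition mcount (k : nat) : nat := count (fun s => size s == k) mlists.

Lemma mcounts : [seq mcount k | k <- iota 2 56] =
  [:: 252; 108; 72; 0; 0; 0; 21]%nat ++ nseq 49 0%nat.
Proof. by vm_compute. Qed.

Lemma concurE (i j k : 'I_57) : (trip (L57 i) (L57 j) (L57 k) == 0) = concur i j k.
Proof. exact: (ev_trip omega_root). Qed.

Lemma on_lineE (u : 'rV[CC]_3) (p : 'cV[CC]_3) : on_line u p = (dot u p^T == 0).
Proof. by rewrite /on_line mxE sum3 /dot !mxE. Qed.

Lemma dotC (F : fieldType) (u v : 'rV[F]_3) : dot u v = dot v u.
Proof. by rewrite /dot; ring. Qed.

Lemma cross_L57 (i j : 'I_57) : i != j -> cross (L57 i) (L57 j) != 0.
Proof.
by move=> ij; rewrite -(evrow_cross omega_root) (evrow_eq0 omega_root) lines57_distinct.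
Qed.

Lemma mult_set_concur p (i j : 'I_57) : p != 0 -> i != j -> i \in mult_set L57 p -> j \in mult_set L57 p ->
  mult_set L57 p = [set k : 'I_57 | concur k i j].
Proof.
move=> p0 ij; rewrite !inE !on_lineE => /eqP hi /eqP hj.
have pt0 : p^T != 0 by rewrite trmx_eq0.
rewrite dotC in hi; rewrite dotC in hj.
have [c hc] := orth2_prop (cross_L57 ij) hi hj.
have c0 : c != 0 by apply: contraNneq pt0 => e; rewrite hc e scale0r.
apply/setP => k; rewrite !inE on_lineE hc -(scale1r (L57 k)) dot_scale mul1r -concurE.
by rewrite mulf_eq0 (negbTE c0).
Qed.

Definition toset (s : seq nat) : {set 'I_57} := [set k : 'I_57 | val k \in s].

Lemma toset_mlist i j : toset (mlist i j) = [set k : 'I_57 | concur k i j].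
Proof. by apply/setP => k; rewrite !inE mem_filter mem_iota /= ltn_ord andbT. Qed.

Lemma card_toset i j : #|toset (mlist i j)| = size (mlist i j).
Proof.
rewrite toset_mlist /mlist -val_enum_ord filter_map size_map cardE.
by rewrite -[in RHS]filter_predI /=; congr size; rewrite /enum_mem; apply: eq_filter => k; rewrite !inE /= ?andbT.
Qed.

Lemma toset_inj i j i' j' : toset (mlist i j) = toset (mlist i' j') -> mlist i j = mlist i' j'.
Proof.
move=> /setP h; apply: eq_in_filter => k; rewrite mem_iota => /= hk.
by have := h (Ordinal hk); rewrite !toset_mlist !inE.
Qed.

Lemma mem_mlists s : reflect (exists i j, [/\ (i < j)%nat, (j < 57)%nat & s = mlist i j]) (s \in mlists).
Proof.
rewrite mem_undup; apply: (iffP flattenP) => [[l /mapP[i hi ->] /mapP[j hj ->]]|[i [j [ij j57 ->]]]].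
  exists i, j; split=> //; move: hi hj; rewrite !mem_iota => /andP[_ hi] /andP[h1 h2] //.
  by move: h2; rewrite subnKC.
have i57 := ltn_trans ij j57.
exists [seq mlist i j | j <- iota i.+1 (57 - i.+1)].
  by apply/mapP; exists i; rewrite ?mem_iota.
by apply/mapP; exists j => //; rewrite mem_iota ij subnKC.
Qed.

Lemma mlists_uniq : uniq mlists. Proof. exact: undup_uniq. Qed.

#[local] Opaque mlists concur.

Lemma nk_count k : (2 <= k)%nat -> nk L57 k = mcount k.
Proof.
move=> k2; rewrite /mcount -size_filter /nk.
have : uniq [seq s <- mlists | size s == k] := filter_uniq _ mlists_uniq.
have : forall s, (s \in [seq s <- mlists | size s == k]) = (size s == k) && (s \in mlists).
  by move=> s; exact: mem_filter.
move: (filter _ mlists) => fl memfl ufl0.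
have ufl : uniq (map toset fl).
  rewrite map_inj_in_uniq //.
  move=> s s'; rewrite !memfl => /andP[_ /mem_mlists[i [j [_ _ ->]]]] /andP[_ /mem_mlists[i' [j' [_ _ ->]]]].
  exact: toset_inj.
rewrite -(size_map toset fl) -(card_uniqP ufl).
apply: eq_card => S; rewrite in_set; apply/andP/mapP => [[/eqP hS /asboolP[p [p0 Sp]]]|[s]].
  have [i [j [iS jS ij]]] : exists i j, [/\ i \in S, j \in S & (i < j)%nat].
    have : (1 < #|S|)%nat by rewrite hS.
    case/card_gt1P => i [j [iS jS]]; rewrite neq_ltn => /orP[h|h]; first by exists i, j.
    by exists j, i.
  have ij' : i != j by rewrite neq_ltn ij.
  have e : S = toset (mlist i j).
    by rewrite toset_mlist Sp; apply: mult_set_concur => //; rewrite -Sp.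
  exists (mlist i j) => //; rewrite memfl -card_toset -e hS eqxx.
  by apply/mem_mlists; exists i, j; split.
rewrite memfl => /andP[/eqP hs /mem_mlists[i [j [ij j57 es]]]] ->.
pose i' := Ordinal (ltn_trans ij j57); pose j' := Ordinal j57.
have ij' : i' != j' by rewrite neq_ltn ij.
rewrite es card_toset -es hs eqxx; split=> //; apply/asboolP.
exists (cross (L57 i') (L57 j'))^T.
have p0 : (cross (L57 i') (L57 j'))^T != 0 by rewrite trmx_eq0 cross_L57.
split=> //; rewrite es toset_mlist -(mult_set_concur p0 ij') // inE on_lineE trmxK /dot /cross !mkrowE; apply/eqP; ring.
Qed.

Lemma nth_of_map (c : nat -> nat) l p m : [seq c k | k <- iota p m] = l ->
  forall i, (i < m)%nat -> c (p + i)%nat = nth 0%nat l i.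
Proof. by move=> <- i im; rewrite (nth_map 0%nat) ?size_iota // nth_iota. Qed.

Lemma nk_L57_nth m : (m < 56)%nat ->
  nk L57 m.+2 = nth 0%nat ([:: 252; 108; 72; 0; 0; 0; 21]%nat ++ nseq 49 0%nat) m.
Proof. by move=> hm; rewrite nk_count; [have := nth_of_map mcounts hm; rewrite add2n | ]. Qed.

Lemma nk_L57 : [/\ nk L57 2 = 252%nat, nk L57 3 = 108%nat, nk L57 4 = 72%nat, nk L57 8 = 21%nat &
  forall k, (2 <= k)%nat -> k \notin [:: 2; 3; 4; 8]%nat -> nk L57 k = 0%nat].
Proof.
split; rewrite ?nk_L57_nth //.
move=> k k2; case: (leqP k 57) => k57 kn.
  case: k k2 k57 kn => [|[|k]] // _ k57 kn; rewrite nk_L57_nth //.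
  have h : all (fun m => (m.+2 \in [:: 2; 3; 4; 8]%nat) ||
    (nth 0%nat ([:: 252; 108; 72; 0; 0; 0; 21]%nat ++ nseq 49 0%nat) m == 0%nat)) (iota 0 56) by vm_compute.
  by have := all_iota h k57; rewrite (negbTE kn) => /eqP.
apply: eq_card0 => S; rewrite in_set; apply/andP => -[/eqP hS _].
by have := max_card (mem S); rewrite hS card_ord leqNgt k57.
Qed.

(** * Rigidity *)

Definition rowsmx (F : fieldType) (a b c : 'rV[F]_3) : 'M[F]_3 := \matrix_(r < 3, k < 3) (nth a [:: a; b; c] r) 0 k.

Lemma mkrow_mul (F : fieldType) x y z (a b c : 'rV[F]_3) : mkrow x y z *m rowsmx a b c = x *: a + y *: b + z *: c.
Proof. by apply/rowP => k; rewrite mxE sum3 !mkrowE !mxE. Qed.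

Lemma cramer (F : fieldType) (u v p q : 'rV[F]_3) :
  trip q v p *: u + trip u q p *: v + trip u v q *: p = trip u v p *: q.
Proof. by apply: row3P; rewrite !mxE /trip /dot /cross !mkrowE; ring. Qed.

Definition proportional (u s : 'rV[CC]_3) := exists2 c : CC, c != 0 & u = c *: s.

Lemma frame_mx (u v p q : 'rV[CC]_3) (D a b c : CC) :
  trip u v p != 0 -> D != 0 -> a != 0 -> b != 0 -> c != 0 -> a *: u + b *: v + c *: p = D *: q ->
  exists2 g : 'M[CC]_3, g \in unitmx &
  [/\ proportional (u *m invmx g) (mkrow 1 0 0), proportional (v *m invmx g) (mkrow 0 1 0),
      proportional (p *m invmx g) (mkrow 0 0 1) & q *m invmx g = mkrow 1 1 1].
Proof.
move=> T0 D0 a0 b0 c0 E0.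
have E : (a / D) *: u + (b / D) *: v + (c / D) *: p = q.
  apply: (scalerI D0); rewrite -E0 !scalerDr !scalerA.
  by do 3! rewrite (mulrCA D) divff // mulr1.
have [al0 be0 ga0] : [/\ a / D != 0, b / D != 0 & c / D != 0] by rewrite !mulf_neq0 ?invr_neq0.
move: (a / D) (b / D) (c / D) al0 be0 ga0 E => al be ga al0 be0 ga0 E.
pose g := rowsmx (al *: u) (be *: v) (ga *: p).
have ug : g \in unitmx by rewrite unitmxE det_rows trip_scale unitfE !mulf_neq0.
have K x m : x = m *m g -> x *m invmx g = m by move=> ->; exact: mulmxK.
exists g => //; split.
- exists al^-1; rewrite ?invr_neq0 //; apply: K.
  by rewrite -scalemxAl mkrow_mul !scale0r !addr0 !scalerA mulr1 mulVf // scale1r.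
- exists be^-1; rewrite ?invr_neq0 //; apply: K.
  by rewrite -scalemxAl mkrow_mul !scale0r addr0 add0r !scalerA mulr1 mulVf // scale1r.
- exists ga^-1; rewrite ?invr_neq0 //; apply: K.
  by rewrite -scalemxAl mkrow_mul !scale0r !add0r !scalerA mulr1 mulVf // scale1r.
by apply: K; rewrite mkrow_mul !scale1r E.
Qed.

Definition hesse_pairs (k : nat) : seq (nat * nat) :=
  [seq p <- [seq (a, b) | a <- iota 0 12, b <- iota 0 12] | concur k p.1 p.2].
Definition epoint (p : nat * nat) : vec3 eis := ecross (eline p.1) (eline p.2).

Lemma hesse_join k : (12 <= k < 57)%nat -> exists p q : nat * nat,
  [/\ p \in hesse_pairs k, q \in hesse_pairs k & ~~ enull (ecross (epoint p) (epoint q))].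
Proof.
move=> /andP[k12 k57].
have h : all (fun k => has (fun p => has (fun q => ~~ enull (ecross (epoint p) (epoint q))) (hesse_pairs k))
    (hesse_pairs k)) (iota 12 45) by vm_compute.
have /(allP h)/hasP[p hp /hasP[q hq n]] : k \in iota 12 45 by rewrite mem_iota k12.
exact: (ex_intro _ p (ex_intro _ q (And3 hp hq n))).
Qed.

Section Rigid.
Variable L' : 'I_57 -> 'rV[CC]_3.
Hypothesis arrL : line_arrangement L'.
Hypothesis latL : same_lattice L57 L'.

Definition li (i : nat) (h : (i < 57)%nat) : 'I_57 := Ordinal h.
Local Notation "''L' i" := (@li i isT) (at level 8, i at level 2).

Lemma tripL' i j k : (trip (L' i) (L' j) (L' k) == 0) = concur i j k.
Proof. by rewrite -rows3E -latL rows3E concurE. Qed.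

Lemma exists_frame : exists2 g : 'M[CC]_3, g \in unitmx & exists w : 'I_57 -> 'rV[CC]_3,
  [/\ forall i, L' i = w i *m g,
      proportional (w 'L 0) (mkrow 1 0 0), proportional (w 'L 1) (mkrow 0 1 0),
      proportional (w 'L 2) (mkrow 0 0 1) & w 'L 3 = mkrow 1 1 1].
Proof.
have D0 : trip (L' 'L 0) (L' 'L 1) (L' 'L 2) != 0 by rewrite tripL'; vm_compute.
have a0 : trip (L' 'L 3) (L' 'L 1) (L' 'L 2) != 0 by rewrite tripL'; vm_compute.
have b0 : trip (L' 'L 0) (L' 'L 3) (L' 'L 2) != 0 by rewrite tripL'; vm_compute.
have c0 : trip (L' 'L 0) (L' 'L 1) (L' 'L 3) != 0 by rewrite tripL'; vm_compute.
have [g ug [h0 h1 h2 h3]] := frame_mx D0 D0 a0 b0 c0 (cramer _ _ _ _).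
exists g => //; exists (fun i => L' i *m invmx g); split=> [i||||]; [exact: (esym (mulmxKV ug _)) | exact h0 | exact h1 | exact h2 | exact h3].
Qed.

Section Frame.
Variables (g : 'M[CC]_3) (w : 'I_57 -> 'rV[CC]_3).
Hypothesis ug : g \in unitmx.
Hypothesis wg : forall i, L' i = w i *m g.
Hypothesis w0 : proportional (w 'L 0) (mkrow 1 0 0).
Hypothesis w1 : proportional (w 'L 1) (mkrow 0 1 0).
Hypothesis w2 : proportional (w 'L 2) (mkrow 0 0 1).
Hypothesis w3 : w 'L 3 = mkrow 1 1 1.

Lemma w_trip i j k : (trip (w i) (w j) (w k) == 0) = concur i j k.
Proof.
rewrite -tripL' !wg trip_mulmx mulf_eq0.
have : \det g != 0 by rewrite -unitfE -unitmxE.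
by move/negbTE->; rewrite orbF.
Qed.

Lemma w_neq0 i : w i != 0.
Proof. by apply: contraNneq (arrL.1 i) => e; rewrite wg e mul0mx. Qed.

Definition wx i := w i 0 o0.
Definition bb i := w i 0 o1 / wx i.
Definition cc i := w i 0 o2 / wx i.

Lemma trip0 (i j : 'I_57) : (concur 0 i j) = (w i 0 o1 * w j 0 o2 == w i 0 o2 * w j 0 o1).
Proof.
rewrite -(w_trip 'L 0) /=; have [c c0 ->] := w0.
rewrite -(scale1r (w i)) -(scale1r (w j)) trip_scale !mulf_eq0 (negbTE c0) oner_eq0 /=.
by rewrite !scale1r -[RHS]subr_eq0 /trip /dot /cross !mkrowE !mul0r !addr0 mul1r.
Qed.

Lemma trip1 (i j : 'I_57) : (concur 1 i j) = (w i 0 o2 * w j 0 o0 == w i 0 o0 * w j 0 o2).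
Proof.
rewrite -(w_trip 'L 1) /=; have [c c0 ->] := w1.
rewrite -(scale1r (w i)) -(scale1r (w j)) trip_scale !mulf_eq0 (negbTE c0) oner_eq0 /=.
by rewrite !scale1r -[RHS]subr_eq0 /trip /dot /cross !mkrowE !mul0r addr0 add0r mul1r.
Qed.

Lemma trip2 (i j : 'I_57) : (concur 2 i j) = (w i 0 o0 * w j 0 o1 == w i 0 o1 * w j 0 o0).
Proof.
rewrite -(w_trip 'L 2) /=; have [c c0 ->] := w2.
rewrite -(scale1r (w i)) -(scale1r (w j)) trip_scale !mulf_eq0 (negbTE c0) oner_eq0 /=.
by rewrite !scale1r -[RHS]subr_eq0 /trip /dot /cross !mkrowE !mul0r !add0r mul1r.
Qed.

Lemma wx_neq0 (i : 'I_57) : ~~ concur i 1 2 -> wx i != 0.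
Proof.
have [c c0 e1] := w1; have [d d0 e2] := w2.
rewrite -(w_trip i 'L 1 'L 2) e1 e2 -{1}(scale1r (w i)) trip_scale !mulf_eq0.
rewrite (negbTE c0) (negbTE d0) oner_eq0 /= /trip /dot /cross !mkrowE.
by rewrite !(mulr0, mul0r, subr0, addr0, mulr1).
Qed.

Definition w_std i := wx i *: mkrow 1 (bb i) (cc i).

Lemma w_stdE i : wx i != 0 -> w i = w_std i.
Proof.
move=> n; apply: row3P; rewrite /w_std mxE !mkrowE ?mulr1 // /bb /cc mulrC divfK //.
Qed.

Lemma bb_eq (i j : 'I_57) : wx i != 0 -> wx j != 0 -> concur 2 i j = (bb i == bb j).
Proof.
move=> ni nj; have -> : (bb i == bb j) = (bb i * (wx i * wx j) == bb j * (wx i * wx j)).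
  by rewrite (inj_eq (mulIf (mulf_neq0 ni nj))).
by rewrite trip2 /bb (mulrC (wx i) (wx j)) mulrACA mulVf // mulr1 mulrA divfK // eq_sym mulrC; congr (_ == _); rewrite mulrC.
Qed.

Lemma cc_eqw (i j : 'I_57) : wx i != 0 -> wx j != 0 -> concur 1 i j -> cc i = cc j.
Proof.
move=> ni nj; rewrite trip1 -!/(wx _) => /eqP h; rewrite /cc; apply: (mulIf (mulf_neq0 ni nj)).
transitivity (w i 0 o2 * wx j); first by field.
by rewrite h; field.
Qed.

Lemma bc_eq (i j : 'I_57) : wx i != 0 -> wx j != 0 -> concur 0 i j -> bb i * cc j = cc i * bb j.
Proof.
move=> ni nj; rewrite trip0 => /eqP h; rewrite /bb /cc; apply: (mulIf (mulf_neq0 ni nj)).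
by rewrite !(mulrACA _ _ (wx i)) !divfK.
Qed.

(* Incidences with x, y, z and x + y + z determine the twelve Hesse lines up to
   the choice of a primitive cube root of unity t. *)
Lemma hesse_part : exists2 t : CC, t ^+ 2 + t + 1 = 0 &
  forall i : 'I_57, (i < 12)%nat -> proportional (w i) (hess t i).
Proof.
have n3 : wx 'L 3 != 0 by apply: wx_neq0; vm_compute.
have n4 : wx 'L 4 != 0 by apply: wx_neq0; vm_compute.
have n5 : wx 'L 5 != 0 by apply: wx_neq0; vm_compute.
have n6 : wx 'L 6 != 0 by apply: wx_neq0; vm_compute.
have n7 : wx 'L 7 != 0 by apply: wx_neq0; vm_compute.
have n8 : wx 'L 8 != 0 by apply: wx_neq0; vm_compute.
have n9 : wx 'L 9 != 0 by apply: wx_neq0; vm_compute.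
have n10 : wx 'L 10 != 0 by apply: wx_neq0; vm_compute.
have n11 : wx 'L 11 != 0 by apply: wx_neq0; vm_compute.
have b3 : bb 'L 3 = 1 by rewrite /bb /wx w3 !mkrowE divr1.
have c3 : cc 'L 3 = 1 by rewrite /cc /wx w3 !mkrowE divr1.
have b4 : bb 'L 4 = 1 by rewrite -b3; apply/eqP; rewrite -bb_eq //; vm_compute.
have b5 : bb 'L 5 = 1 by rewrite -b3; apply/eqP; rewrite -bb_eq //; vm_compute.
pose t := bb 'L 6; have b6 : bb 'L 6 = t by [].
have b7 : bb 'L 7 = t by rewrite -b6; apply/eqP; rewrite -bb_eq //; vm_compute.
have b8 : bb 'L 8 = t by rewrite -b6; apply/eqP; rewrite -bb_eq //; vm_compute.
have c6 : cc 'L 6 = 1 by rewrite -c3; apply: cc_eqw => //; vm_compute.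
have c9 : cc 'L 9 = 1 by rewrite -c3; apply: cc_eqw => //; vm_compute.
have c7 : cc 'L 7 = t.
  have := @bc_eq 'L 3 'L 7 n3 n7; rewrite b3 c3 !mul1r b7; apply; vm_compute; reflexivity.
have c4 : cc 'L 4 = t by rewrite -c7; apply: cc_eqw => //; vm_compute.
have c10 : cc 'L 10 = t by rewrite -c7; apply: cc_eqw => //; vm_compute.
have b10 : bb 'L 10 = t * t.
  have := @bc_eq 'L 6 'L 10 n6 n10; rewrite b6 c6 c10 mul1r => h; rewrite h //; vm_compute; reflexivity.
have b9 : bb 'L 9 = t * t by rewrite -b10; apply/eqP; rewrite -bb_eq //; vm_compute.
have b11 : bb 'L 11 = t * t by rewrite -b10; apply/eqP; rewrite -bb_eq //; vm_compute.
have c11 : cc 'L 11 = t * t.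
  have := @bc_eq 'L 3 'L 11 n3 n11; rewrite b3 c3 !mul1r b11; apply; vm_compute; reflexivity.
have c5 : cc 'L 5 = t * t by rewrite -c11; apply: cc_eqw => //; vm_compute.
have c8 : cc 'L 8 = t * t by rewrite -c11; apply: cc_eqw => //; vm_compute.
have t3 : t * (t * t) = 1.
  have := @bc_eq 'L 6 'L 5 n6 n5; rewrite b6 c6 b5 c5 mulr1; apply; vm_compute; reflexivity.
have t1 : t != 1.
  by rewrite -b3 -b6 -bb_eq //; vm_compute.
have ht : t ^+ 2 + t + 1 = 0.
  have t1' : t - 1 != 0 by rewrite subr_eq0.
  apply: (mulfI t1'); rewrite mulr0.
  have -> : (t - 1) * (t ^+ 2 + t + 1) = t * (t * t) - 1 by ring.
  by rewrite t3 subrr.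
have z1 : zC (Zpos xH) = 1 by [].
have z0 : zC Z0 = 0 by [].
have zm : zC (Zneg xH) = -1 by rewrite /zC; apply: cc_eq => /=; rewrite ?RealsE ?oppr0.
have E1 : ev t e_one = 1 by rewrite /ev /= z1 z0 mul0r addr0.
have E0 : ev t e_zero = 0 by rewrite /ev /= z0 mul0r addr0.
have Ew : ev t e_w = t by rewrite /ev /= z1 z0 mul1r add0r.
have Ew2 : ev t e_w2 = t * t.
  rewrite /ev /= zm; transitivity (t * t - (t ^+ 2 + t + 1)); first by ring.
  by rewrite ht subr0.
exists t => //.
have std (i : 'I_57) x y : wx i != 0 -> bb i = x -> cc i = y -> proportional (w i) (mkrow 1 x y).
  by move=> n <- <-; exists (wx i) => //; exact: w_stdE.
move=> i hi; rewrite /hess.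
have ei (k : nat) (h : (k < 57)%nat) : (i : nat) = k -> i = li h by move=> e; exact: val_inj.
case: i hi ei => [[|[|[|[|[|[|[|[|[|[|[|[|i]]]]]]]]]]]] hi'] //= _ ei.
- by rewrite (ei 0%nat isT erefl) E1 E0.
- by rewrite (ei 1%nat isT erefl) E1 E0.
- by rewrite (ei 2%nat isT erefl) E1 E0.
- by rewrite (ei 3%nat isT erefl) E1; exact: std.
- by rewrite (ei 4%nat isT erefl) E1 Ew; exact: std.
- by rewrite (ei 5%nat isT erefl) E1 Ew2; exact: std.
- by rewrite (ei 6%nat isT erefl) E1 Ew; exact: std.
- by rewrite (ei 7%nat isT erefl) E1 Ew; exact: std.
- by rewrite (ei 8%nat isT erefl) E1 Ew Ew2; exact: std.
- by rewrite (ei 9%nat isT erefl) E1 Ew2; exact: std.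
- by rewrite (ei 10%nat isT erefl) E1 Ew Ew2; exact: std.
by rewrite (ei 11%nat isT erefl) E1 Ew2; exact: std.
Qed.

Lemma frame_hess : exists2 t : CC, t ^+ 2 + t + 1 = 0 & forall i, proportional (w i) (hess t i).
Proof.
have [t ht hs] := hesse_part; exists t => // k.
case: (ltnP k 12) => [/hs //|k12].
have [|p [q [hp hq n]]] := @hesse_join k; first by rewrite k12 ltn_ord.
have P (r : nat * nat) : r \in hesse_pairs k -> dot (w k) (evrow t (epoint r)) = 0 /\ dot (hess t k) (evrow t (epoint r)) = 0.
  rewrite mem_filter => /andP[h /allpairsP[[a b] [ha hb er]]].
  move: h; rewrite er => h.
  move: ha hb; rewrite !mem_iota !leq0n !add0n => ha hb.
  have a57 : (a < 57)%nat by exact: leq_trans ha _.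
  have b57 : (b < 57)%nat by exact: leq_trans hb _.
  split; last by apply/eqP; rewrite -(ev_dot ht) (ev_eq0 ht).
  have [ca ca0 ea] := hs (li a57) ha; have [cb cb0 eb] := hs (li b57) hb.
  move: h; rewrite -(w_trip k (li a57) (li b57)) ea eb -(scale1r (w k)) trip_scale !mulf_eq0.
  rewrite (negbTE ca0) (negbTE cb0) oner_eq0 /= scale1r => /eqP h.
  by rewrite /epoint (evrow_cross ht).
have nX : cross (evrow t (epoint p)) (evrow t (epoint q)) != 0.
  by rewrite -(evrow_cross ht) (evrow_eq0 ht).
have [[p1 p2] [q1 q2]] := (P p hp, P q hq).
have [c ec] := orth2_prop nX p1 q1; have [d ed] := orth2_prop nX p2 q2.
have c0 : c != 0 by apply: contraNneq (w_neq0 k) => e; rewrite ec e scale0r.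
have d0 : d != 0.
  have : hess t k != 0 by rewrite (evrow_eq0 ht) lines57_nonzero.
  by apply: contraNneq => e; rewrite ed e scale0r.
by exists (c / d); rewrite ?mulf_neq0 ?invr_neq0 // ec ed scalerA divfK.
Qed.

End Frame.
End Rigid.

Lemma L57_rigid : rigid L57.
Proof.
exists 2%nat, (fun j => hess (if j == ord0 then omega else - 1 - omega)) => L' arrL latL.
have [g ug [w [wg w0 w1 w2 w3]]] := exists_frame latL.
have [t ht hs] := frame_hess arrL latL ug wg w0 w1 w2 w3.
have : (t - omega) * (t - (- 1 - omega)) = 0.
  transitivity ((t ^+ 2 + t + 1) - (omega ^+ 2 + omega + 1)); first by ring.
  by rewrite ht omega_root subrr.
move/eqP; rewrite mulf_eq0 !subr_eq0 => tE.
have [j ej] : exists j : 'I_2, t = if j == ord0 then omega else - 1 - omega.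
  by case/orP: tE => /eqP e; [exists ord0 | exists (@Ordinal 2 1 isT)].
exists j; rewrite -ej; exists g => //.
exists (fun i => s2val (cid2 (hs i))) => i; first exact: s2valP (cid2 (hs i)).
by rewrite wg {1}(s2valP' (cid2 (hs i))) scalemxAl.
Qed.

Section Derivations.
Implicit Types (p q : P3) (a b c : 'I_3 -> P3) (u v : 'rV[CC]_3).

(** * Freeness *)

Definition lform v : P3 := \sum_(j < 3) (v 0 j)%:MP * 'X_j.
Definition theta (a : 'I_3 -> P3) p : P3 := \sum_(i < 3) a i * mderiv i p.
Definition det3 (a b c : 'I_3 -> P3) : P3 :=
  a o0 * (b o1 * c o2 - b o2 * c o1) + a o1 * (b o2 * c o0 - b o0 * c o2)
  + a o2 * (b o0 * c o1 - b o1 * c o0).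
Definition euler (i : 'I_3) : P3 := 'X_i.

Lemma subM_subM (R : comRingType) (x y x' y' : R) : x * y - x' * y' = (x - x') * y + x' * (y - y').
Proof. ring. Qed.

Lemma thetaM a p q : theta a (p * q) = theta a p * q + p * theta a q.
Proof.
rewrite /theta mulr_suml mulr_sumr -big_split; apply: eq_bigr => i _ /=.
by rewrite mderivM mulrDr [in RHS](mulrCA p) !mulrA.
Qed.

Lemma mderivXU (i j : 'I_3) : mderiv i ('X_j : P3) = (i == j)%:R.
Proof.
rewrite mderivX mnm1E eq_sym; case: eqP => [->|_]; last by rewrite scale0r.
by have -> : (U_(j) - U_(j) = 0)%MM; [apply/mnmP => k; rewrite !mnmE subnn | rewrite mpolyX0 scale1r].
Qed.

Lemma mderiv_lform i v : mderiv i (lform v) = (v 0 i)%:MP.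
Proof.
rewrite /lform raddf_sum /=.
rewrite (bigD1 i) //= big1 ?addr0 => [|j ji]; rewrite mderivM mderivC mul0r add0r mderivXU.
  by rewrite eqxx mulr1.
by rewrite eq_sym (negbTE ji) mulr0.
Qed.

Lemma theta_lform a v : theta a (lform v) = \sum_(i < 3) a i * (v 0 i)%:MP.
Proof. by apply: eq_bigr => i _; rewrite mderiv_lform. Qed.

Lemma theta_euler v : theta euler (lform v) = lform v.
Proof. by rewrite theta_lform; apply: eq_bigr => i _; rewrite mulrC. Qed.

Lemma theta_euler_prod n (L : 'I_n -> 'rV[CC]_3) (r : seq 'I_n) :
  theta euler (\prod_(i <- r) lform (L i)) = (\prod_(i <- r) lform (L i)) *+ size r.
Proof.
elim: r => [|i r IH]; last by rewrite !big_cons thetaM IH theta_euler /= mulrS mulrnAr.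
rewrite big_nil mulr0n /theta big1 // => i _.
by rewrite -mpolyC1 mderivC mulr0.
Qed.

Lemma lform_eval v (x : 'I_3 -> CC) : (lform v).@[x] = \sum_(j < 3) v 0 j * x j.
Proof. by rewrite /lform raddf_sum; apply: eq_bigr => j _; rewrite /= mevalM mevalC mevalXU. Qed.

(* Substituting away one variable on the line v = 0 is a ring morphism whose
   kernel is the ideal of the linear form, which is therefore prime. *)
Lemma line_morphism v : v != 0 -> exists phi : {rmorphism P3 -> P3},
  forall p, phi p = 0 <-> exists q, p = q * lform v.
Proof.
move=> v0; have [j vj] : exists j, v 0 j != 0.
  by apply/existsP; apply: contraNT v0 => /existsPn h; apply/eqP/rowP => j; rewrite mxE; apply/eqP; rewrite -[_ == _]negbK.
pose c i : P3 := ((i == j)%:R / v 0 j)%:MP.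
pose lq := [tuple 'X_i - c i * lform v | i < 3].
have cE : \sum_i (v 0 i)%:MP * c i = 1.
  rewrite (bigD1 j) //= big1 ?addr0 => [|i ij].
    by rewrite /c eqxx -mpolyCM mulrA mulr1 divff.
  by rewrite /c (negbTE ij) mul0r mpolyC0 mulr0.
exists (comp_mpoly lq : {rmorphism _ -> _}) => p; split=> [|[q ->]]; last first.
  rewrite rmorphM /= [X in _ * X](_ : _ = 0) ?mulr0 // /lform raddf_sum /=.
  transitivity (\sum_i ((v 0 i)%:MP * 'X_i - (v 0 i)%:MP * c i * lform v)).
    by apply: eq_bigr => i _; rewrite rmorphM /= comp_mpolyC comp_mpolyXU -tnth_nth tnth_mktuple mulrBr mulrA.
  by rewrite sumrB -mulr_suml cE mul1r subrr.
suff [q e] : exists q, p - comp_mpoly lq p = q * lform v by move=> h; exists q; rewrite -e h subr0.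
have D (x y : P3) : (exists q, x - comp_mpoly lq x = q * lform v) ->
    (exists q, y - comp_mpoly lq y = q * lform v) ->
    exists q, x * y - comp_mpoly lq (x * y) = q * lform v.
  move=> [q e] [q' e']; exists (q * y + comp_mpoly lq x * q').
  by rewrite rmorphM /= subM_subM e e' mulrDl mulrAC mulrA.
elim/mpolyind: p => [|k m p _ _ [q e]]; first by exists 0; rewrite raddf0 subr0 mul0r.
have [q' e'] : exists q, 'X_[m] - comp_mpoly lq 'X_[m] = q * lform v.
  rewrite mpolyXE_id; apply: (big_ind (fun x : P3 => exists q, x - comp_mpoly lq x = q * lform v)) => [|x y|i _]; [|exact: D|].
    by exists 0; rewrite rmorph1 subrr mul0r.
  elim: (m i) => [|d IH]; first by exists 0; rewrite expr0 rmorph1 subrr mul0r.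
  rewrite exprS; apply: (D _ _ _ IH); exists (c i).
  by rewrite comp_mpolyXU -tnth_nth tnth_mktuple opprB addrC subrK.
exists (k%:MP * q' + q).
by rewrite mulrDl -e -mulrA -e' raddfD /= linearZ /= mul_mpolyC scalerBr opprD addrACA.
Qed.

Lemma lform_dvd_lform u v : (exists q, lform u = q * lform v) -> cross u v = 0.
Proof.
move=> [q e].
have h (x : 'I_3 -> CC) : \sum_(j < 3) v 0 j * x j = 0 -> \sum_(j < 3) u 0 j * x j = 0.
  by move=> hx; rewrite -lform_eval e mevalM lform_eval hx mulr0.
pose pt (k : 'rV[CC]_3) := fun j => (cross v k) 0 j.
have hk k : \sum_(j < 3) u 0 j * pt k j = 0.
  by apply: h; rewrite sum3 /pt /cross !mkrowE; ring.
have := (hk (mkrow 1 0 0), hk (mkrow 0 1 0), hk (mkrow 0 0 1)); rewrite !sum3 /pt /cross !mkrowE => -[[h0 h1] h2].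
apply: row3P; rewrite mkrowE mxE; [rewrite -h0 | rewrite -h1 | rewrite -h2]; ring.
Qed.

Lemma cramer3 (R : comRingType) (d a b c : 'I_3 -> R) (j : 'I_3) :
  d j * (a o0 * (b o1 * c o2 - b o2 * c o1) + a o1 * (b o2 * c o0 - b o0 * c o2)
    + a o2 * (b o0 * c o1 - b o1 * c o0)) =
  (\sum_i a i * d i) * (b (ordS j) * c (ordS (ordS j)) - b (ordS (ordS j)) * c (ordS j))
  + (\sum_i b i * d i) * (c (ordS j) * a (ordS (ordS j)) - c (ordS (ordS j)) * a (ordS j))
  + (\sum_i c i * d i) * (a (ordS j) * b (ordS (ordS j)) - a (ordS (ordS j)) * b (ordS j)).
Proof.
have s0 : ordS o0 = o1 by exact: val_inj.
have s1 : ordS o1 = o2 by exact: val_inj.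
have s2 : ordS o2 = o0 by exact: val_inj.
by rewrite !sum3; move: j; apply: ord3P; rewrite ?(s0, s1, s2); ring.
Qed.

Lemma det3_theta a b c p (j : 'I_3) :
  mderiv j p * det3 a b c =
  theta a p * (b (ordS j) * c (ordS (ordS j)) - b (ordS (ordS j)) * c (ordS j))
  + theta b p * (c (ordS j) * a (ordS (ordS j)) - c (ordS (ordS j)) * a (ordS j))
  + theta c p * (a (ordS j) * b (ordS (ordS j)) - a (ordS (ordS j)) * b (ordS j)).
Proof. exact: (cramer3 (fun i => mderiv i p)). Qed.

Lemma det3_expand a b c d j :
  det3 a b c * d j = det3 d b c * a j + det3 a d c * b j + det3 a b d * c j.
Proof.
rewrite /det3; move: j; apply: ord3P;
move: (a o0) (a o1) (a o2) (b o0) (b o1) (b o2) (c o0) (c o1) (c o2) (d o0) (d o1) (d o2) => *; ring.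
Qed.

Section Saito.
Variables (n : nat) (L : 'I_n.+1 -> 'rV[CC]_3).
Hypothesis arrL : line_arrangement L.
Local Notation f := (arr_poly L).

Lemma lform_neq0 v : v != 0 -> lform v != 0.
Proof.
move=> v0; apply: contraNneq v0 => e; apply/eqP/rowP => j; rewrite mxE.
have := congr1 (fun p => (mderiv j p)@_0%MM) e; rewrite /= mderiv_lform raddf0 mcoeff0.
by rewrite mcoeffC eqxx mulr1.
Qed.

Lemma arr_poly_neq0 : f != 0.
Proof. by apply/prodf_neq0 => i _; apply: lform_neq0; exact: arrL.1. Qed.

Lemma arr_poly_dvd p : (forall i, exists q, p = q * lform (L i)) -> exists q, p = q * f.
Proof.
move=> h; suff : forall r : seq 'I_n.+1, uniq r -> exists q, p = q * \prod_(i <- r) lform (L i).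
  by move=> /(_ (index_enum _) (index_enum_uniq _)).
elim=> [_|i r IH /= /andP[ir ur]]; first by exists p; rewrite big_nil mulr1.
have [q e] := IH ur; have [phi hphi] := line_morphism (arrL.1 i).
have : phi p = 0 by apply/hphi; exact: h.
rewrite e rmorphM rmorph_prod /= => /eqP; rewrite mulf_eq0 => /orP[/eqP/hphi[q' ->]|].
  by exists q'; rewrite big_cons mulrA.
rewrite prodf_seq_eq0 => /hasP[k kr /= /eqP/hphi /lform_dvd_lform h0].
have ki : k != i by apply: contraNneq ir => <-.
by move: (arrL.2 k i ki) => /eqP; rewrite rank2_cross ?h0 ?eqxx //; exact: arrL.1.
Qed.

Lemma syzygy_log a i : jac_syzygy f a -> exists q, theta a (lform (L i)) = q * lform (L i).
Proof.
rewrite /jac_syzygy -/(theta a f) /arr_poly (bigD1 i) //= -/(lform (L i)) thetaM => e.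
have [phi hphi] := line_morphism (arrL.1 i).
have z : phi (lform (L i)) = 0 by apply/hphi; exists 1; rewrite mul1r.
apply/hphi; have := congr1 phi e; rewrite rmorphD !rmorphM z mul0r addr0 rmorph0 /= => /eqP.
rewrite mulf_eq0 => /orP[/eqP //|]; rewrite rmorph_prod => /prodf_eq0[k ki /eqP/hphi /lform_dvd_lform h0].
by move: (arrL.2 k i ki) => /eqP; rewrite rank2_cross ?h0 ?eqxx //; exact: arrL.1.
Qed.

Lemma det3_log a b c : (forall i, exists q, theta a (lform (L i)) = q * lform (L i)) ->
  (forall i, exists q, theta b (lform (L i)) = q * lform (L i)) ->
  (forall i, exists q, theta c (lform (L i)) = q * lform (L i)) -> exists q, det3 a b c = q * f.
Proof.
move=> ha hb hc; apply: arr_poly_dvd => i.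
have [j vj] : exists j, L i 0 j != 0.
  apply/existsP; apply: contraNT (arrL.1 i) => /existsPn h; apply/eqP/rowP => j; rewrite mxE; apply/eqP; rewrite -[_ == _]negbK; exact: h.
have [qa ea] := ha i; have [qb eb] := hb i; have [qc ec] := hc i.
exists ((L i 0 j)^-1%:MP * (
  qa * (b (ordS j) * c (ordS (ordS j)) - b (ordS (ordS j)) * c (ordS j))
  + qb * (c (ordS j) * a (ordS (ordS j)) - c (ordS (ordS j)) * a (ordS j))
  + qc * (a (ordS j) * b (ordS (ordS j)) - a (ordS (ordS j)) * b (ordS j)))).
have -> : det3 a b c = (L i 0 j)^-1%:MP * ((L i 0 j)%:MP * det3 a b c).
  by rewrite mulrA -mpolyCM mulVf // mpolyC1 mul1r.
rewrite -mderiv_lform det3_theta ea eb ec -[RHS]mulrA; congr (_ * _); rewrite !mulrDl.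
by congr (_ + _ + _); rewrite mulrAC.
Qed.

Lemma theta_euler_arr : theta euler f = f *+ n.+1.
Proof. by rewrite theta_euler_prod; congr (_ *+ _); rewrite -[RHS]card_ord cardE enumT. Qed.

Lemma saito (d1 d2 : nat) (r1 r2 : 'I_3 -> P3) (k : CC) : (d1 <= d2)%nat ->
  (forall i, r1 i \is [in CC[3], d1.-homog]) -> (forall i, r2 i \is [in CC[3], d2.-homog]) ->
  jac_syzygy f r1 -> jac_syzygy f r2 -> k != 0 -> det3 euler r1 r2 = k%:MP * f ->
  free_with_exponents f d1 d2.
Proof.
move=> d12 h1 h2 s1 s2 k0 E; split=> //; exists r1, r2.
have f0 := arr_poly_neq0.
have kf0 : k%:MP * f != 0 by rewrite mulf_neq0 // mpolyC_eq0.
split=> // [a sa|u v e].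
  have le i : exists q, theta euler (lform (L i)) = q * lform (L i).
    by exists 1; rewrite theta_euler mul1r.
  have [U eU] := det3_log le (fun i => syzygy_log i sa) (fun i => syzygy_log i s2).
  have [V eV] := det3_log le (fun i => syzygy_log i s1) (fun i => syzygy_log i sa).
  have det0 : det3 a r1 r2 = 0.
    have tf0 : theta euler f != 0.
      by rewrite theta_euler_arr -scaler_nat scaler_eq0 (negbTE f0) pnatr_eq0.
    apply: (mulIf tf0); rewrite mul0r.
    transitivity (\sum_(j < 3) 'X_j * (mderiv j f * det3 a r1 r2)).
      by rewrite mulr_sumr; apply: eq_bigr => j _; rewrite mulrCA [X in _ * X]mulrC.
    by apply: big1 => j _; rewrite det3_theta /theta sa s1 s2 !mul0r !addr0 mulr0.
  exists ((k^-1)%:MP * U), ((k^-1)%:MP * V) => i; apply: (mulfI kf0).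
  rewrite -{1}E det3_expand det0 mul0r add0r eU eV.
  rewrite -(mulr1 (U * f)) -(mulr1 (V * f)) -mpolyC1 -(mulVf k0) mpolyCM.
  move: (k%:MP) (k^-1%:MP) => K K'; move: f => F; clear; ring.
split.
  have : det3 euler r1 r2 * u = 0.
    pose d j := u * r1 j + v * r2 j.
    suff -> : det3 euler r1 r2 * u = det3 euler d r2 by rewrite /det3 /d !e; ring.
    rewrite /det3 /d; ring.
  by rewrite E => /eqP; rewrite mulf_eq0 (negbTE kf0) => /eqP.
have : det3 euler r1 r2 * v = 0.
  pose d j := u * r1 j + v * r2 j.
  suff -> : det3 euler r1 r2 * v = det3 euler r1 d by rewrite /det3 /d !e; ring.
  rewrite /det3 /d; ring.
by rewrite E => /eqP; rewrite mulf_eq0 (negbTE kf0) => /eqP.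
Qed.
End Saito.
End Derivations.

(* A copy of the polynomials with integer coefficients on which identities are
   decided by evaluation: their coefficients are too large for unary numerals. *)
Inductive zpoly : Type :=
| ZVar of 'I_3
| ZCst of Z
| ZAdd of zpoly & zpoly
| ZSub of zpoly & zpoly
| ZMul of zpoly & zpoly.

Fixpoint zval (e : zpoly) : P3 :=
  match e with
  | ZVar i => 'X_i
  | ZCst c => (zC c)%:MP
  | ZAdd a b => zval a + zval b
  | ZSub a b => zval a - zval b
  | ZMul a b => zval a * zval b
  end.

Fixpoint zPE (e : zpoly) : PExpr Z :=
  match e with
  | ZVar i => PEX _ (Pos.of_succ_nat i)
  | ZCst c => PEc c
  | ZAdd a b => PEadd (zPE a) (zPE b)
  | ZSub a b => PEsub (zPE a) (zPE b)
  | ZMul a b => PEmul (zPE a) (zPE b)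

  end.
Lemma zC0 : zC Z0 = 0. Proof. by []. Qed.
Lemma zC1 : zC (Zpos xH) = 1. Proof. by []. Qed.

Lemma mpoly_ring_theory :
  ring_theory (0 : P3) 1 +%R *%R (fun p q => p - q) -%R (@eq P3).
Proof.
exact: (mk_rt _ _ _ _ _ _ _ (@add0r P3) (@addrC P3) (@addrA P3) (@mul1r P3) (@mulrC P3)
  (@mulrA P3) (@mulrDl P3) (fun p q => erefl (p - q)) (@subrr P3)).
Qed.

Lemma zC_morph :
  ring_morph (0 : P3) 1 +%R *%R (fun p q => p - q) -%R (@eq P3)
    Z0 (Zpos xH) Z.add Z.mul Z.sub Z.opp Z.eqb (fun z => (zC z)%:MP).
Proof.
split=> [||x y|x y|x y|x|x y /Z.eqb_eq -> //].
- by rewrite zC0 mpolyC0.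
- by rewrite zC1 mpolyC1.
- by rewrite zC_add mpolyCD.
- by rewrite zC_sub mpolyCB.
- by rewrite zC_mul mpolyCM.
by rewrite -Z.sub_0_l zC_sub zC0 sub0r mpolyCN.
Qed.

Definition zeq0 (e : zpoly) : bool :=
  let norm := norm_subst Z0 (Zpos xH) Z.add Z.mul Z.sub Z.opp Z.eqb
    (triv_div Z0 (Zpos xH) Z.eqb) 0 nil in
  Ring_polynom.Peq Z.eqb (norm (zPE e)) (norm (PEc Z0)).

Lemma zeq0P e : zeq0 e -> zval e = 0.
Proof.
pose arth := Rth_ARth (@RelationClasses.eq_equivalence P3) (Eq_ext _ _ _) mpoly_ring_theory.
move=> h; have := ring_correct (@RelationClasses.eq_equivalence P3) (Eq_ext _ _ _) arth zC_morph
  (pow_N_th _ _ (@RelationClasses.eq_equivalence P3))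
  (triv_div_th (@RelationClasses.eq_equivalence P3) (Eq_ext _ _ _) arth zC_morph)
  0%nat [:: 'X_o0; 'X_o1; 'X_o2] nil (zPE e) (PEc Z0) I h.
rewrite [RHS]/= zC0 mpolyC0 => <-; elim: e {h} => /= [|//|a -> b ->|a -> b ->|a -> b ->] //.
by apply: ord3P.
Qed.

Fixpoint zderiv (i : 'I_3) (e : zpoly) : zpoly :=
  match e with
  | ZVar j => ZCst (if i == j then Zpos xH else Z0)
  | ZCst _ => ZCst Z0
  | ZAdd a b => ZAdd (zderiv i a) (zderiv i b)
  | ZSub a b => ZSub (zderiv i a) (zderiv i b)
  | ZMul a b => ZAdd (ZMul (zderiv i a) b) (ZMul a (zderiv i b))
  end.

Lemma zval_deriv i e : mderiv i (zval e) = zval (zderiv i e).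
Proof.
elim: e => /= [j|c|a <- b <-|a <- b <-|a <- b <-].
- by rewrite mderivXU; case: eqP => _; rewrite ?zC0 ?zC1 ?mpolyC0 ?mpolyC1.
- by rewrite mderivC zC0 mpolyC0.
- by rewrite mderivD.
- by rewrite mderivB.
by rewrite mderivM.
Qed.

Fixpoint zdeg (e : zpoly) : nat :=
  match e with
  | ZVar _ => 1
  | ZCst _ => 0
  | ZAdd a b | ZSub a b => maxn (zdeg a) (zdeg b)
  | ZMul a b => zdeg a + zdeg b
  end.

Fixpoint zhomog (d : nat) (e : zpoly) : bool :=
  match e with
  | ZVar _ => d == 1
  | ZCst c => (d == 0) || Z.eqb c Z0
  | ZAdd a b | ZSub a b => zhomog d a && zhomog d b
  | ZMul a b => [&& (zdeg a <= d)%nat, zhomog (zdeg a) a & zhomog (d - zdeg a) b]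
  end.

Lemma zhomogP d e : zhomog d e -> zval e \is [in CC[3], d.-homog].
Proof.
elim: e d => /= [i|c|a IHa b IHb|a IHa b IHb|a IHa b IHb] d.
- by move=> /eqP ->; rewrite dhomogX /= mdeg1.
- case/orP => [/eqP -> |/Z.eqb_eq ->]; last by rewrite zC0 mpolyC0 dhomog0.
  by rewrite -alg_mpolyC; apply: dhomogZ; exact: dhomog1.
- by case/andP => /IHa ha /IHb hb; apply: dhomogD.
- by case/andP => /IHa ha /IHb hb; apply: dhomogD => //; rewrite dhomogN.
case/and3P => le /IHa ha /IHb hb; rewrite -(subnKC le); exact: dhomogM.
Qed.

Fixpoint zpow (e : zpoly) (n : nat) : zpoly := if n is n.+1 then ZMul e (zpow e n) else ZCst (Zpos xH).

Definition zcube (i : 'I_3) := zpow (ZVar i) 3.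
Definition zE1 := ZAdd (ZAdd (zcube o0) (zcube o1)) (zcube o2).
Definition zE2 := ZAdd (ZAdd (ZMul (zcube o0) (zcube o1)) (ZMul (zcube o1) (zcube o2))) (ZMul (zcube o2) (zcube o0)).
Definition zE3 := ZMul (ZMul (zcube o0) (zcube o1)) (zcube o2).
Definition mono (c : Z) (a b d : nat) := ZMul (ZCst c) (ZMul (zpow zE1 a) (ZMul (zpow zE2 b) (zpow zE3 d))).
Definition zsum := foldr ZAdd (ZCst Z0).

(* The syzygies are sought in the form x_i (A + h B u_i + C u_i^2) with u_i = x_i^3,
   h = (u0 + u1)(u1 + u2)(u2 + u0) and A, B, C symmetric in the u_i; the coefficients
   solve the resulting linear system. *)
Definition pA8 := zsum [:: mono 6272 8 0 0; mono (-143080) 6 1 0; mono (-1873368) 4 2 0;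
  mono 17360406 2 3 0; mono (-52081218) 0 4 0; mono 4436208 5 0 1;
  mono (-25876935) 3 1 1; mono (-6598179) 1 2 1; mono (-34562619) 2 0 2; mono 148798377 0 1 2].
Definition pB8 := zsum [:: mono 3738231 4 0 0; mono (-28796229) 2 1 0; mono 70681653 0 2 0;
  mono 71845137 1 0 1].
Definition pC8 := zsum [:: mono (-7296) 6 0 0; mono (-3578175) 4 1 0; mono 26926344 2 2 0;
  mono (-60584274) 0 3 0; mono (-1540539) 3 0 1; mono (-76166649) 1 1 1;
  mono 195008229 0 0 2].
Definition pA10 := zsum [:: mono 1568 8 1 0; mono (-309288) 6 2 0; mono 1333584 4 3 0;
  mono (-5786802) 2 4 0; mono 39928 7 0 1; mono 3298428 5 1 1;
  mono (-1237194) 3 2 1; mono (-128595600) 1 3 1; mono (-5188428) 4 0 2; mono (-17207316) 2 1 2; mono 164632986 0 2 2; mono 45120726 1 0 3].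
Definition pB10 := zsum [:: mono 394212 6 0 0; mono (-2391606) 4 1 0; mono 7853517 2 2 0;
  mono (-18895842) 3 0 1; mono 174522600 1 1 1; mono 105004431 0 0 2].
Definition pC10 := zsum [:: mono (-396036) 6 1 0; mono 2299266 4 2 0; mono (-6731586) 2 3 0;
  mono 396036 5 0 1; mono 12133476 3 1 1; mono (-149590800) 1 2 1;
  mono (-14432742) 2 0 2; mono 156322386 0 1 2].

Definition zsyz (A B C : zpoly) (i : 'I_3) : zpoly :=
  ZMul (ZVar i) (ZAdd A (ZAdd (ZMul (ZSub (ZMul zE1 zE2) zE3) (ZMul B (zcube i))) (ZMul C (zpow (zcube i) 2)))).
Definition znormform (a b c : Z) : zpoly :=
  ZSub (zpow (ZAdd (ZAdd (ZMul (ZCst a) (zcube o0)) (ZMul (ZCst b) (zcube o1))) (ZMul (ZCst c) (zcube o2))) 3)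
    (ZMul (ZCst (27 * (a * b * c))) zE3).
Definition zprod := foldr ZMul (ZCst (Zpos xH)).
Definition zarr : zpoly := zprod [::
  ZVar o0; ZVar o1; ZVar o2; znormform 1 1 1;
  ZSub (zcube o0) (zcube o1); ZSub (zcube o1) (zcube o2); ZSub (zcube o2) (zcube o0);
  ZAdd (zcube o0) (zcube o1); ZAdd (zcube o1) (zcube o2); ZAdd (zcube o2) (zcube o0);
  znormform 8 (-1) (-1); znormform (-1) 8 (-1); znormform (-1) (-1) 8].

Definition syz25 := zsyz pA8 pB8 pC8.
Definition syz31 := zsyz pA10 pB10 pC10.

Definition ztheta (r : 'I_3 -> zpoly) (e : zpoly) : zpoly :=
  ZAdd (ZAdd (ZMul (r o0) (zderiv o0 e)) (ZMul (r o1) (zderiv o1 e))) (ZMul (r o2) (zderiv o2 e)).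

Lemma syz25_zeq0 : zeq0 (ztheta syz25 zarr). Proof. by vm_compute. Qed.
Lemma syz31_zeq0 : zeq0 (ztheta syz31 zarr). Proof. by vm_compute. Qed.

Definition zdet (a b c : 'I_3 -> zpoly) : zpoly :=
  ZAdd (ZAdd (ZMul (a o0) (ZSub (ZMul (b o1) (c o2)) (ZMul (b o2) (c o1))))
    (ZMul (a o1) (ZSub (ZMul (b o2) (c o0)) (ZMul (b o0) (c o2)))))
    (ZMul (a o2) (ZSub (ZMul (b o0) (c o1)) (ZMul (b o1) (c o0)))).

Lemma det_zeq0 : zeq0 (ZSub (zdet ZVar syz25 syz31) (ZMul (ZCst 5617521) zarr)).
Proof. by vm_compute. Qed.

Lemma syz25_homog i : zhomog 25 (syz25 i).
Proof. by move: i; apply: ord3P; vm_compute. Qed.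
Lemma syz31_homog i : zhomog 31 (syz31 i).
Proof. by move: i; apply: ord3P; vm_compute. Qed.

Definition elf (u : vec3 eis) : P3 := lform (evrow omega u).

Lemma elfE a b c : elf (a, b, c) =
  (ev omega a)%:MP * 'X_o0 + (ev omega b)%:MP * 'X_o1 + (ev omega c)%:MP * 'X_o2.
Proof. by rewrite /elf /lform sum3 /= !mkrowE. Qed.

Lemma arr_poly_L57 : arr_poly L57 = \prod_(u <- lines57) elf u.
Proof. by rewrite (big_nth (e_zero, e_zero, e_zero)) big_mkord. Qed.

Lemma ev_one w : ev w e_one = 1. Proof. by rewrite /ev /= zC0 zC1 mul0r addr0. Qed.
Lemma ev_zero w : ev w e_zero = 0. Proof. by rewrite /ev /= zC0 mul0r addr0. Qed.
Lemma ev_opp w a : ev w (e_opp a) = - ev w a.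
Proof. by rewrite /ev /= -!Z.sub_0_l !zC_sub zC0; ring. Qed.

Lemma prod3_ring (R : comRingType) (w a b : R) : w ^+ 2 + w + 1 = 0 ->
  (a + b) * ((a + w * b) * (a + (- 1 - w) * b)) = a ^+ 3 + b ^+ 3.
Proof.
move=> hw; transitivity (a ^+ 3 + b ^+ 3 - (w ^+ 2 + w + 1) * (b ^+ 2 * (a + b))); first by ring.
by rewrite hw mul0r subr0.
Qed.

Local Notation W := (omega%:MP : P3).

Lemma W_root : W ^+ 2 + W + 1 = 0.
Proof. by rewrite expr2 -mpolyCM -expr2 -mpolyC1 -!mpolyCD omega_root mpolyC0. Qed.

Lemma ev_w w : ev w e_w = w. Proof. by rewrite /ev /= zC0 zC1 mul1r add0r. Qed.
Lemma ev_w2 w : ev w e_w2 = - 1 - w.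
Proof. by rewrite -[RHS]mulr1 /ev /= -[Zneg xH]/(Z.sub Z0 (Zpos xH)) zC_sub zC0 zC1; ring. Qed.

Lemma big_cube_roots (F : eis -> P3) : \prod_(x <- cube_roots) F x = F e_one * (F e_w * F e_w2).
Proof. by rewrite !big_cons big_nil mulr1. Qed.

Lemma prod_cube_roots (a b : P3) : \prod_(x <- cube_roots) (a + (ev omega x)%:MP * b) = a ^+ 3 + b ^+ 3.
Proof.
rewrite big_cube_roots ev_one ev_w ev_w2 mpolyC1 mul1r mpolyCB mpolyCN mpolyC1.
exact: (prod3_ring a b W_root).
Qed.

Definition norm9 (R : comRingType) (a b c : R) : R :=
  (a ^+ 3 + b ^+ 3 + c ^+ 3) ^+ 3 - (1 + 1 + 1) ^+ 3 * (a ^+ 3 * b ^+ 3 * c ^+ 3).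

Definition znorm9 (R : comRingType) (a b c x y z : R) : R :=
  (a * x ^+ 3 + b * y ^+ 3 + c * z ^+ 3) ^+ 3 - (1 + 1 + 1) ^+ 3 * (a * b * c) * (x ^+ 3 * y ^+ 3 * z ^+ 3).

Lemma norm9_znorm9 (R : comRingType) (x y z : R) :
  [/\ norm9 x y z = znorm9 1 1 1 x y z, norm9 ((1 + 1) * x) (- y) (- z) = znorm9 ((1 + 1) ^+ 3) (-1) (-1) x y z,
    norm9 ((1 + 1) * y) (- x) (- z) = znorm9 (-1) ((1 + 1) ^+ 3) (-1) x y z &
    norm9 ((1 + 1) * z) (- x) (- y) = znorm9 (-1) (-1) ((1 + 1) ^+ 3) x y z].
Proof. by rewrite /norm9 /znorm9; split; ring. Qed.

Lemma prod9_ring (R : comRingType) (w a b c : R) : w ^+ 2 + w + 1 = 0 ->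
  ((a + b) ^+ 3 + c ^+ 3) * (((a + w * b) ^+ 3 + c ^+ 3) * ((a + (- 1 - w) * b) ^+ 3 + c ^+ 3)) =
  norm9 a b c.
Proof.
rewrite /norm9 => hw; pose s := a ^+ 3 + b ^+ 3 + c ^+ 3; pose p := 3 * a ^+ 2 * b; pose q := 3 * a * b ^+ 2.
have e v : v ^+ 2 + v + 1 = 0 -> (a + v * b) ^+ 3 + c ^+ 3 = s + v * p + (- 1 - v) * q.
  move=> hv; transitivity (s + v * p + (- 1 - v) * q + (v ^+ 2 + v + 1) * (q + (v - 1) * b ^+ 3)); first by rewrite /s /p /q; ring.
  by rewrite hv mul0r addr0.
have hw' : (- 1 - w) ^+ 2 + (- 1 - w) + 1 = 0 by rewrite -[RHS]hw; ring.
rewrite (e _ hw) (e _ hw').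
transitivity ((s + p + q) * ((s + w * p + (- 1 - w) * q) * (s + (- 1 - w) * p + (- 1 - (- 1 - w)) * q))).
  by congr (_ * _); rewrite /s /p /q; ring.
transitivity (s ^+ 3 + p ^+ 3 + q ^+ 3 - 3 * (s * p * q) - (w ^+ 2 + w + 1) * ((s + p + q) * (p - q) ^+ 2)); first by ring.
by rewrite hw mul0r subr0 /s /p /q; ring.
Qed.

Lemma prod_cube_roots2 (a b c : P3) :
  \prod_(x <- cube_roots) \prod_(y <- cube_roots) (a + (ev omega x)%:MP * b + (ev omega y)%:MP * c) = norm9 a b c.
Proof.
under eq_bigr => x _ do rewrite prod_cube_roots.
rewrite big_cube_roots ev_one ev_w ev_w2 mpolyC1 mul1r mpolyCB mpolyCN mpolyC1.
exact: (prod9_ring a b c W_root).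
Qed.

Lemma zvalC c : zval (ZCst c) = (zC c)%:MP. Proof. by []. Qed.
Lemma zvalD a b : zval (ZAdd a b) = zval a + zval b. Proof. by []. Qed.
Lemma zvalB a b : zval (ZSub a b) = zval a - zval b. Proof. by []. Qed.
Lemma zvalM a b : zval (ZMul a b) = zval a * zval b. Proof. by []. Qed.
Lemma zvalX a n : zval (zpow a n) = zval a ^+ n.
Proof. by elim: n => [|n IH]; [rewrite zvalC zC1 mpolyC1 expr0 | rewrite exprS -IH]. Qed.

Lemma zval_prod1 a : zval (zprod [:: a]) = zval a. Proof. by rewrite zvalM zvalC zC1 mpolyC1 mulr1. Qed.
Lemma zval_prod_cons a s : zval (zprod (a :: s)) = zval a * zval (zprod s). Proof. by []. Qed.
Lemma zval_cube i : zval (zcube i) = 'X_i ^+ 3. Proof. exact: zvalX. Qed.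
#[local] Opaque zcube zprod.

Lemma zC2 : (zC (Zpos 2))%:MP = 1 + 1 :> P3. Proof. by rewrite -[Zpos 2]/(Z.add 1 1) zC_add zC1 mpolyCD mpolyC1. Qed.
Lemma zCN1 : (zC (Zneg 1))%:MP = -1 :> P3. Proof. by rewrite -[Zneg 1]/(Z.sub 0 1) zC_sub zC0 zC1 sub0r mpolyCN mpolyC1. Qed.
Lemma zC8 : (zC (Zpos 8))%:MP = (1 + 1) ^+ 3 :> P3.
Proof. by rewrite -[Zpos 8]/(Z.mul 2 (Z.mul 2 2)) !zC_mul !mpolyCM zC2 !exprS expr0 mulr1. Qed.
Lemma zC3 : (zC (Zpos 3))%:MP = 1 + 1 + 1 :> P3. Proof. by rewrite -[Zpos 3]/(Z.add 2 1) zC_add mpolyCD zC2 zC1 mpolyC1. Qed.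
Lemma zC27 : (zC (Zpos 27))%:MP = (1 + 1 + 1) ^+ 3 :> P3.
Proof. by rewrite -[Zpos 27]/(Z.mul 3 (Z.mul 3 3)) !zC_mul !mpolyCM zC3 !exprS expr0 mulr1. Qed.
Lemma zval_normform x y z : zval (znormform x y z) =
    znorm9 (zC x)%:MP (zC y)%:MP (zC z)%:MP 'X_o0 'X_o1 'X_o2.
Proof.
rewrite /znormform /zE3 zvalB zvalX 2!zvalD 6!zvalM !zval_cube !zvalC !zC_mul !mpolyCM zC27 /znorm9.
reflexivity.
Qed.

Lemma arr_poly_zarr : arr_poly L57 = zval zarr.
Proof.
have ev2 : (ev omega (Zpos 2, Z0))%:MP = 1 + 1 :> P3 by rewrite /ev /= zC0 mul0r addr0 zC2.
have bl1 (h : eis -> vec3 eis) (a b : P3) : (forall x, elf (h x) = a + (ev omega x)%:MP * b) ->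
    \prod_(u <- [seq h x | x <- cube_roots]) elf u = a ^+ 3 + b ^+ 3.
  by move=> hh; rewrite big_map; under eq_bigr => x _ do rewrite hh; exact: prod_cube_roots.
have bl2 (h : eis -> eis -> vec3 eis) (a b c : P3) :
    (forall x y, elf (h x y) = a + (ev omega x)%:MP * b + (ev omega y)%:MP * c) ->
    \prod_(u <- [seq h x y | x <- cube_roots, y <- cube_roots]) elf u = norm9 a b c.
  move=> hh; rewrite big_allpairs_dep; under eq_bigr => x _ do under eq_bigr => y _ do rewrite hh.
  exact: prod_cube_roots2.
have b0 : \prod_(u <- [seq (e_one, x, y) | x <- cube_roots, y <- cube_roots]) elf u = norm9 'X_o0 'X_o1 'X_o2.
  by apply: (bl2 (fun x y => (e_one, x, y))); move=> x y; rewrite elfE ev_one mpolyC1 mul1r.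
have b1 : \prod_(u <- [seq (e_one, e_opp x, e_zero) | x <- cube_roots]) elf u = 'X_o0 ^+ 3 + (- 'X_o1) ^+ 3.
  by apply: (bl1 (fun x => (e_one, e_opp x, e_zero))); move=> x; rewrite elfE ev_one ev_zero ev_opp mpolyC1 mpolyC0 mpolyCN mul1r mul0r addr0 mulrN mulNr.
have b2 : \prod_(u <- [seq (e_zero, e_one, e_opp x) | x <- cube_roots]) elf u = 'X_o1 ^+ 3 + (- 'X_o2) ^+ 3.
  by apply: (bl1 (fun x => (e_zero, e_one, e_opp x))); move=> x; rewrite elfE ev_one ev_zero ev_opp mpolyC1 mpolyC0 mpolyCN mul1r mul0r add0r mulrN mulNr.
have b3 : \prod_(u <- [seq (e_opp x, e_zero, e_one) | x <- cube_roots]) elf u = 'X_o2 ^+ 3 + (- 'X_o0) ^+ 3.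
  by apply: (bl1 (fun x => (e_opp x, e_zero, e_one))); move=> x; rewrite elfE ev_one ev_zero ev_opp mpolyC1 mpolyC0 mpolyCN mul1r mul0r addr0 addrC mulrN mulNr.
have b4 : \prod_(u <- [seq (e_one, x, e_zero) | x <- cube_roots]) elf u = 'X_o0 ^+ 3 + 'X_o1 ^+ 3.
  by apply: (bl1 (fun x => (e_one, x, e_zero))); move=> x; rewrite elfE ev_one ev_zero mpolyC1 mpolyC0 mul1r mul0r addr0.
have b5 : \prod_(u <- [seq (e_zero, e_one, x) | x <- cube_roots]) elf u = 'X_o1 ^+ 3 + 'X_o2 ^+ 3.
  by apply: (bl1 (fun x => (e_zero, e_one, x))); move=> x; rewrite elfE ev_one ev_zero mpolyC1 mpolyC0 mul1r mul0r add0r.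
have b6 : \prod_(u <- [seq (x, e_zero, e_one) | x <- cube_roots]) elf u = 'X_o2 ^+ 3 + 'X_o0 ^+ 3.
  by apply: (bl1 (fun x => (x, e_zero, e_one))); move=> x; rewrite elfE ev_one ev_zero mpolyC1 mpolyC0 mul1r mul0r addr0 addrC.
have b7 : \prod_(u <- [seq ((Zpos 2, Z0), e_opp x, e_opp y) | x <- cube_roots, y <- cube_roots]) elf u = norm9 ((1 + 1) * 'X_o0) (- 'X_o1) (- 'X_o2).
  by apply: (bl2 (fun x y => ((Zpos 2, Z0), e_opp x, e_opp y))); move=> x y; rewrite elfE ev2 !ev_opp !mpolyCN !mulrN !mulNr.
have b8 : \prod_(u <- [seq (e_opp x, (Zpos 2, Z0), e_opp y) | x <- cube_roots, y <- cube_roots]) elf u = norm9 ((1 + 1) * 'X_o1) (- 'X_o0) (- 'X_o2).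
  by apply: (bl2 (fun x y => (e_opp x, (Zpos 2, Z0), e_opp y))); move=> x y; rewrite elfE ev2 !ev_opp !mpolyCN !mulrN !mulNr; congr (_ + _); exact: addrC.
have b9 : \prod_(u <- [seq (e_opp x, e_opp y, (Zpos 2, Z0)) | x <- cube_roots, y <- cube_roots]) elf u = norm9 ((1 + 1) * 'X_o2) (- 'X_o0) (- 'X_o1).
  by apply: (bl2 (fun x y => (e_opp x, e_opp y, (Zpos 2, Z0)))); move=> x y; rewrite elfE ev2 !ev_opp !mpolyCN !mulrN !mulNr addrC addrA.
have cat (s t : seq (vec3 eis)) : \prod_(u <- s ++ t) elf u = \prod_(u <- s) elf u * \prod_(u <- t) elf u by rewrite big_cat.
have cat10 l0 l1 l2 l3 l4 l5 l6 l7 l8 l9 l10 : \prod_(u <- l0 ++ l1 ++ l2 ++ l3 ++ l4 ++ l5 ++ l6 ++ l7 ++ l8 ++ l9 ++ l10) elf u =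
    \prod_(u <- l0) elf u * (\prod_(u <- l1) elf u * (\prod_(u <- l2) elf u * (\prod_(u <- l3) elf u * (\prod_(u <- l4) elf u * (\prod_(u <- l5) elf u * (\prod_(u <- l6) elf u * (\prod_(u <- l7) elf u * (\prod_(u <- l8) elf u * (\prod_(u <- l9) elf u * \prod_(u <- l10) elf u))))))))).
  by rewrite !cat.
rewrite arr_poly_L57 /lines57 cat10 b0 b1 b2 b3 b4 b5 b6 b7 b8 b9.
have b : \prod_(u <- [:: (e_one, e_zero, e_zero); (e_zero, e_one, e_zero); (e_zero, e_zero, e_one)]) elf u =
    'X_o0 * ('X_o1 * 'X_o2).
  rewrite big_cons big_cons big_seq1; congr (_ * (_ * _)); rewrite elfE ev_one ev_zero mpolyC1 mpolyC0.
  - by rewrite mul1r !mul0r !addr0.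
  - by rewrite mul1r !mul0r addr0 add0r.
  by rewrite mul1r !mul0r !add0r.
rewrite b -2!mulrA.
have N (z : P3) : (- z) ^+ 3 = - z ^+ 3 by rewrite exprNn -signr_odd expr1 mulN1r.
have [-> -> -> ->] := norm9_znorm9 ('X_o0 : P3) 'X_o1 'X_o2.
rewrite !N -!zval_cube -{1 2 3}(mpolyC1 3 CC) -[1%:MP]/((zC (Zpos 1))%:MP) -zCN1 -zC8 -!zval_normform.
rewrite /zarr 12!zval_prod_cons zval_prod1.
reflexivity.
Qed.

Lemma zval_theta (r : 'I_3 -> zpoly) e : \sum_(i < 3) zval (r i) * mderiv i (zval e) = zval (ztheta r e).
Proof. by rewrite sum3 !zval_deriv /ztheta 2!zvalD 3!zvalM. Qed.

Lemma zval_det (a b c : 'I_3 -> zpoly) :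
  det3 (fun i => zval (a i)) (fun i => zval (b i)) (fun i => zval (c i)) = zval (zdet a b c).
Proof. by rewrite /det3 /zdet 2!zvalD 3!zvalM 3!zvalB 6!zvalM. Qed.

Lemma L57_free : free_with_exponents (arr_poly L57) 25 31.
Proof.
have k0 : zC 5617521 != 0.
  by apply/eqP => h; have /eqP := congr1 (@complex.Re RR) h; rewrite /= zC_eq0.
apply: (@saito _ _ L57_arrangement _ _ (fun i => zval (syz25 i)) (fun i => zval (syz31 i)) (zC 5617521)) => //.
- by move=> i; apply: zhomogP; exact: syz25_homog.
- by move=> i; apply: zhomogP; exact: syz31_homog.
- by rewrite /jac_syzygy arr_poly_zarr zval_theta; apply: zeq0P; exact: syz25_zeq0.
- by rewrite /jac_syzygy arr_poly_zarr zval_theta; apply: zeq0P; exact: syz31_zeq0.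
rewrite arr_poly_zarr (_ : euler = fun i => zval (ZVar i)) // zval_det -zvalC -zvalM.
by apply/eqP; rewrite -subr_eq0 -zvalB; apply/eqP; apply: zeq0P; exact: det_zeq0.
Qed.

Lemma evalp_arr_poly n (L : 'I_n -> 'rV[CC]_3) p : evalp (arr_poly L) p = \prod_(i < n) (L i *m p) 0 0.
Proof.
rewrite /evalp /arr_poly rmorph_prod; apply: eq_bigr => i _ /=.
rewrite raddf_sum mxE; apply: eq_bigr => j _ /=.
by rewrite mevalM mevalC mevalXU.
Qed.

(** * The Alexander polynomial *)

Section AtInfinity.

Definition linf : 'I_57 := @Ordinal 57 2 isT.
(* In the coordinates x = w0 + w1, y = 3 w1, z = w2 no line but z = 0 contains the
   point at infinity (0 : 1 : 0); kap is the coefficient of w1. *)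
Definition kap (u : vec3 eis) : eis := let: (a, b, _) := u in eadd a (emul (Zpos 3, Z0) b).
Local Notation al k := (L57 k 0 o0).
Local Notation be k := (L57 k 0 o1).
Local Notation ga k := (L57 k 0 o2).
Local Notation kappa k := (ev omega (kap (eline k))).

Lemma zC_three : zC (Zpos 3) = 3.
Proof. by rewrite -[Zpos 3]/(Z.add 1 (Z.add 1 1)) !zC_add -[zC (Zpos 1)]/(1 : CC); ring. Qed.

Lemma kappaE (k : 'I_57) : kappa k = al k + 3 * be k.
Proof.
rewrite /L57 /hess; case: (eline k) => [[u v] w]; rewrite /= !mkrowE ev_add (ev_mul omega_root); congr (_ + _ * _).
by rewrite /ev /= zC_three -[zC Z0]/(0 : CC) mul0r addr0.
Qed.

Lemma kappa_neq0 (k : 'I_57) : k != linf -> kappa k != 0.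
Proof.
move=> k2; rewrite (ev_eq0 omega_root).
have h : all (fun k => (k == 2%nat) || ~~ eis0 (kap (eline k))) (iota 0 57) by vm_compute.
by have := all_iota h (ltn_ord k); rewrite (_ : (val k == 2%nat) = false) //; apply/negbTE.
Qed.

Lemma linfE : L57 linf = mkrow 0 0 1.
Proof.
by apply: row3P; rewrite /L57 /hess /= !mkrowE /ev /= -?[zC Z0]/(0 : CC) -?[zC (Zpos 1)]/(1 : CC) mul0r addr0.
Qed.

Lemma parallelE (i j : 'I_57) : i != linf -> j != linf ->
  (al i / kappa i == al j / kappa j) = concur i linf j.
Proof.
move=> /kappa_neq0 i0 /kappa_neq0 j0.
rewrite -concurE linfE /trip /dot /cross !mkrowE eqr_div // !kappaE -subr_eq0.
have -> : al i * (al j + 3 * be j) - al j * (al i + 3 * be i) =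
  - 3 * (al i * (0 * ga j - 1 * be j) + be i * (1 * al j - 0 * ga j) + ga i * (0 * be j - 0 * al j)) by ring.
by rewrite mulf_eq0 oppr_eq0 pnatr_eq0.
Qed.

Lemma L57_alexander : alexander_poly_is (arr_poly L57) 57 (('X - 1) ^+ 56).
Proof.
pose s (i : 'I_56) : 'I_57 := fintype.lift linf i.
have sl i : s i != linf by rewrite eq_sym neq_lift.
pose a i : CC := - (al (s i) / kappa (s i)); pose b i : CC := - (ga (s i) / kappa (s i)).
pose K : CC := \prod_i kappa (s i).
have K0 : K != 0 by apply/prodf_neq0 => i _; exact: kappa_neq0.
pose mu : CC := 57.-root K^-1.
have muE : mu ^+ 57 = K^-1 by exact: rootCK.
have mu0 : mu != 0 by apply: contraTneq isT => e; have := muE; rewrite e expr0n /= => /esym/eqP; rewrite invr_eq0 (negbTE K0).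
pose G : 'M[CC]_3 := rowsmx (mkrow mu mu 0) (mkrow 0 (3 * mu) 0) (mkrow 0 0 mu).
have aE i j : (a i == a j) = concur (s i) linf (s j) by rewrite eqr_opp parallelE.
apply: (@alexander_trivial_monodromy 56 a b _ G).
- move=> i j ij ea; apply/eqP => eb.
  have sij : s i != s j by rewrite (inj_eq lift_inj).
  move: (cross_L57 sij); rewrite (_ : L57 (s i) = (kappa (s i) / kappa (s j)) *: L57 (s j)).
    by rewrite -{2}(scale1r (L57 (s j))) cross_scale (_ : cross _ _ = 0) ?scaler0 ?eqxx //; apply: row3P; rewrite /cross !mkrowE mxE; ring.
  have [ki kj] := (kappa_neq0 (sl i), kappa_neq0 (sl j)).
  move/oppr_inj/eqP: ea; rewrite eqr_div // => /eqP ea; move/oppr_inj/eqP: eb; rewrite eqr_div // => /eqP eb.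
  have eal : al (s i) = kappa (s i) / kappa (s j) * al (s j) by apply: (mulIf kj); rewrite ea mulrAC divfK // mulrC.
  have ega : ga (s i) = kappa (s i) / kappa (s j) * ga (s j) by apply: (mulIf kj); rewrite eb mulrAC divfK // mulrC.
  have ebe : be (s i) = kappa (s i) / kappa (s j) * be (s j).
    have n3 : (3 : CC) != 0 by rewrite pnatr_eq0.
    apply: (mulfI n3); apply: (addrI (al (s i))); rewrite -kappaE eal mulrCA -mulrDr -kappaE divfK //.
  by apply: row3P; rewrite mxE.
- move=> i; have -> : slope_mult a (a i) = size (mlist linf (s i)).
    rewrite -card_toset toset_mlist (cardsD1 linf) inE -concurE.
    have -> : trip (L57 linf) (L57 linf) (L57 (s i)) = 0 by rewrite /trip /dot /cross !mkrowE; ring.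
    rewrite eqxx add1n; congr _.+1.
    rewrite -(card_imset [pred j | a j == a i] (@lift_inj _ linf)); apply: eq_card => k.
    rewrite !inE; apply/imsetP/andP => [[j]|[kl hk]].
      by rewrite inE aE => hj ->; split=> //; exact: sl.
    case: (unliftP linf k) kl hk => [j ->|->]; last by rewrite eqxx.
    by move=> _ hk; exists j; rewrite // inE aE.
  have h : all (fun k => (k == 2%nat) || coprime 57 (size (mlist 2 k))) (iota 0 57) by vm_compute.
  case/orP: (all_iota h (ltn_ord (s i))) => [e|hc]; last exact: hc.
  by case/negP: (sl i); rewrite -val_eqE; exact: e.
- have n3 : (3 : CC) != 0 by rewrite pnatr_eq0.
  rewrite unitmxE det_rows unitfE /trip /dot /cross !mkrowE.
  rewrite (_ : _ + _ = mu * (3 * mu * mu)); last by ring.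
  by rewrite !mulf_neq0.
move=> w; rewrite evalp_arr_poly (bigD1_ord linf) //=.
have Gw u : (u *m (G *m w)) 0 0 = mu * (u 0 o0 * (w o0 0 + w o1 0) + 3 * u 0 o1 * w o1 0 + u 0 o2 * w o2 0).
  by rewrite mxE !sum3 !mxE !sum3 !mxE /=; ring.
have Gs i : (L57 (s i) *m (G *m w)) 0 0 = mu * kappa (s i) * (w o1 0 - a i * w o0 0 - b i * w o2 0).
  rewrite Gw -[RHS]mulrA; congr (_ * _); rewrite /a /b.
  transitivity (kappa (s i) * w o1 0 + al (s i) * w o0 0 + ga (s i) * w o2 0); first by rewrite kappaE; ring.
  by have ks := kappa_neq0 (sl i); move: (kappa (s i)) ks => k ks; field.
under eq_bigr => i _ do rewrite Gs.
rewrite !big_split /= prodr_const card_ord -/K Gw linfE !mkrowE.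
rewrite !mul0r !mulr0 mul0r !add0r mul1r.
transitivity (w o2 0 * ((mu ^+ 57 * K) * \prod_i (w o1 0 - a i * w o0 0 - b i * w o2 0))).
  by rewrite exprS; ring.
by rewrite muE mulVf // mul1r.
Qed.
End AtInfinity.

Theorem theoremA :
  exists L : 'I_57 -> 'rV[CC]_3,
    [/\ line_arrangement L,
        rigid L,
        [/\ nk L 2 = 252%N, nk L 3 = 108%N, nk L 4 = 72%N, nk L 8 = 21%N &
            (forall k, (2 <= k)%N -> k \notin [:: 2; 3; 4; 8]%N -> nk L k = 0%N)],
        free_with_exponents (arr_poly L) 25 31 &
        alexander_poly_is (arr_poly L) 57 (('X - 1) ^+ 56)].
Proof.
exists L57; split.
- exact: L57_arrangement.
- exact: L57_rigid.
- exact: nk_L57.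
- exact: L57_free.
exact: L57_alexander.
Qed.
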